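(* Let $\Sigma$ be a system of grounding over the enriched version $\Lambda^+$ of a language of grounding $\Lambda$. For every derivation $\Delta$ in $\Sigma$ there is a normal derivation $\Delta^*$ in $\Sigma$ such that $\Delta\succ\Delta^*$ (i.e. $\Delta$ reduces to $\Delta^*$).
   Context: **Languages of grounding.** $L$ is a first-order language with $\wedge,\vee,\to,\forall,\exists$ and atomic $\bot$. An atomic base $\mathfrak{B}$ over $L$ consists of the individual constants of $L$, the relational constants of $L$, and an atomic system $\mathtt{S}=\langle L^*,\mathfrak{R}\rangle$, with $L^*\subseteq L$ and $\mathfrak{R}$ a recursively axiomatisable set of production rules from atomic formulas $\alpha_i\ne\bot$ of $L^*$ to an atomic formula $\beta$ of $L^*$ or $\bot$, every free variable of $\beta$ being free in some $\alpha_i$. A language of grounding $\Lambda$ over $\mathfrak{B}$ has typed terms (types are formulas of $L$; bound variables are written after the operational symbol) generated by: constants $\delta:\alpha$ naming the closed derivations of $\mathtt{S}$ with conclusion $\alpha$; typed-variables $\xi^\alpha_i:\alpha$; the primitive symbols: if $T:\alpha,U:\beta$ then $\wedge I(T,U):\alpha\wedge\beta$; if $T:\alpha_i$ then $\vee I[\alpha_i\rhd\alpha_1\vee\alpha_2](T):\alpha_1\vee\alpha_2$; if $T:\beta$ then $\to\! I\,\xi^\alpha(T):\alpha\to\beta$; if $T:\alpha(x)$ then $\forall I\,x(T):\forall y\,\alpha(y)$ (provided $x\notin FV(\gamma)$ for all $\xi^\gamma\in FV^T(T)$); if $T:\alpha(t)$ then $\exists I[\alpha(t)\rhd\exists x\alpha(x)](T):\exists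 x\,\alpha(x)$ ($t$ free for $x$); and a recursive set of non-primitive symbols $F[\alpha_1,\dots,\alpha_n\rhd\beta]$, possibly binding sequences $\underline{x},\underline{\xi}$ of individual and typed-variables: if $T_i:\alpha_i$ then $F\,\underline{x}\,\underline{\xi}(T_1,\dots,T_n):\beta$. $FV^I,FV^T,FV^F$ denote free individual, typed-, functional variables; substitution is capture-avoiding. **Enriched language $\Lambda^+$.** Adds functional variables $\mathtt{h}^\alpha_x,\mathtt{f}^\alpha$, with terms $\mathtt{h}^\alpha_x(t):\alpha(t/x)$ ($t$ a term of $L$) and $\mathtt{f}^\alpha(T):\alpha$ ($T$ a term of $\Lambda$), closed under operational symbols. Atomic formulas: $T:\alpha$ (for $T$ a term of type $\alpha$), $T\equiv U$ (for terms of the same type), $\bot^G$. Formulas are built with $\times$ (and), $+$ (or), $\supset$ (implies), $\Pi\nu$ (for all), $\mathfrak{E}\nu$ (exists), $\nu$ any individual, typed- or functional variable. Substituting $U$ for $\mathtt{f}^\alpha$ turns $\mathtt{f}^\alpha(Z)$ into $U$; for $\mathtt{h}^\beta_x$ it turns $\mathtt{h}^\beta_x(t)$ into $U[t/x]$ (allowed when $x\notin FV(\alpha)$ for $\xi^\alpha\in FV^T(U)$); substituted terms belong to $\Lambda$. **System of grounding $\Sigma$ over $\Lambda^+$.** Natural deduction, any formula may be assumed, with the rules: *Type introductions*: axioms $\delta:\alpha$. $\wedge I$: from $T:\alpha$, $U:\beta$ infer $\wedge I(T,U):\alpha\wedge\beta$. $\vee I$: from $T:\alpha_i$ infer $\vee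 I[\alpha_i\rhd\alpha_1\vee\alpha_2](T):\alpha_1\vee\alpha_2$. $\to\! I$: from a derivation of $T(\xi^\alpha):\beta$ from $\xi^\alpha:\alpha$ infer $\to\! I\,\xi^\alpha(T(\xi^\alpha)):\alpha\to\beta$, discharging $\xi^\alpha:\alpha$ ($\xi^\alpha$ not free in other undischarged assumptions). $\forall I$: from $T(x):\alpha(x)$ infer $\forall I\,y(T(y/x)):\forall y\,\alpha(y/x)$ ($x$ not free in undischarged assumptions). $\exists I$: from $T:\alpha(t/x)$ infer $\exists I(T):\exists x\,\alpha(x)$. *Type eliminations* (conclude $A$ from a major premise and derivation(s) of the minor premise $A$, discharging the listed assumptions): $D_\wedge$: major $T:\alpha\wedge\beta$; discharged $T\equiv\wedge I(\xi^\alpha,\xi^\beta)$, $\xi^\alpha:\alpha$, $\xi^\beta:\beta$. $D_\vee$: major $T:\alpha_1\vee\alpha_2$; two minor premises $A$, the $i$-th discharging $T\equiv\vee I(\xi^{\alpha_i})$, $\xi^{\alpha_i}:\alpha_i$. $D_\to$: major $T:\alpha\to\beta$; discharged $T\equiv\;\to\! I\,\xi^\alpha(\mathtt{f}^\beta(\xi^\alpha))$, $\Pi\xi^\alpha(\xi^\alpha:\alpha\supset\mathtt{f}^\beta(\xi^\alpha):\beta)$. $D_\forall$: major $T:\forall x\,\alpha(x)$; discharged $T\equiv\forall I\,x(\mathtt{h}^{\alpha(x)}_x(x))$, $\Pi x(\mathtt{h}^{\alpha(x)}_x(x):\alpha(x))$. $D_\exists$: major $T:\exists x\,\alpha(x)$;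 discharged $T\equiv\exists I(\xi^{\alpha(x)})$, $\xi^{\alpha(x)}:\alpha(x)$. The proper variables ($\xi^\alpha,\xi^\beta$ in $D_\wedge$; $\xi^{\alpha_1},\xi^{\alpha_2}$ in $D_\vee$; $\mathtt{f}^\beta$ in $D_\to$; $\mathtt{h}^{\alpha(x)}_x$ in $D_\forall$, also after replacing $x$ by any $t$; $x,\xi^{\alpha(x)}$ in $D_\exists$) are not free in $A$ nor in undischarged assumptions on which the minor premise depends other than the discharged ones. Also: from $T:\bot$ infer $\bot^G$. *Equivalence*: reflexivity $\equiv_R$ (axiom $T\equiv T$), symmetry, transitivity; $\equiv_P$: from $T\equiv U$ and $U:\alpha$ infer $T:\alpha$; for every operational symbol, from equivalence of corresponding arguments infer equivalence of the resulting terms (same bound variables); for primitive symbols also the converse (from equivalence of the two results infer equivalence of corresponding arguments); and, for the non-primitive $F$, equations, i.e. axioms $F\,\underline{x}\,\underline{\xi}(U_1,\dots,U_n)\equiv Z$ with $Z:\beta$, such that $FV^\bullet(Z)\subseteq FV^\bullet(F\,\underline{x}\,\underline{\xi}(U_1,\dots,U_n))$ for $\bullet=I,T,F$ and, for every substitution $[*/\circ]$ of terms for variables, there is an axiom $(F\,\underline{x}\,\underline{\xi}(U_1,\dots,U_n))[*/\circ]\equiv W$ with $\vdash_\Sigma W\equiv Z[*/\circ]$. The equations are assumed to be well-given: $\Sigma$ proves, for each $F$, that $F$ yields terms $\ldots:\beta$ when applied to arguments of the appropriate kind, and $\xi^{\alpha_1}:\alpha_1,\dots,\xi^{\alpha_n}:\alpha_n\vdash_\Sigma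 U:\beta$ for each term $U:\beta$ of $\Lambda$ with $FV^T(U)=\{\xi^{\alpha_1},\dots,\xi^{\alpha_n}\}$. *Logic*: the intuitionistic natural deduction introduction rules $(\kappa_I)$ and elimination rules $(\kappa_E)$ for $\kappa=\times,+,\supset,\Pi,\mathfrak{E}$, and $(\bot^G)$: from $\bot^G$ infer $A$. Quantifier rules apply to all kinds of variables, with instantiating terms of the right type (for $\mathtt{h}^\beta_x$: $x\notin FV(\alpha)$ for each $\xi^\alpha$ free in the term) and usual proper-variable restrictions. *Conventions on derivations* (without loss of generality): conclusions of $(\bot^G)$ are atomic; free and bound individual and typed-variables are all distinct; proper and non-proper variables are all distinct, and each proper variable occurs at most once. **Cut-segments.** A cut-segment in $\Delta$ is a sequence $\sigma$ of $n\ge1$ occurrences of one formula $A$ such that: the first is the conclusion of a type introduction rule $sI$ ($s\in\{\wedge,\vee,\to,\forall,\exists\}$) or of an introduction rule $(\kappa_I)$; for $1\le i<n$ the $(i+1)$-th occurrence is the conclusion of an application of $(+_E)$, $(\mathfrak{E}_E)$ or a type elimination of which the $i$-th is a minor premise; the $n$-th is the major premise of $D_s$ (resp. $(\kappa_E)$) if the first is the conclusion of $sI$ (resp. $(\kappa_I)$). Its length is $n$. **Measures.** $k^1(\alpha)$, for $\alpha$ a formula of $L$, is the standard logical complexity ($0$ for atomic, $\max+1$ for binary connectives, $+1$ for quantifiers). For a formula $A$ of $\Lambda^+$, $\tau(A)$ is the maximum of $k^1(\alpha)$ over subformulas of $A$ of the form $U:\alpha$ ($0$ if none); $k^2(A)$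 is its logical complexity with respect to $\times,+,\supset,\Pi,\mathfrak{E}$ (same recursion, atomic formulas having $0$); $\mu(A)=(\tau(A),k^2(A))$, ordered lexicographically. $\mu(\sigma)=\mu(A)$ for $\sigma$ a cut-segment with formula $A$. $M_\Delta$ is the set of $\mu(\sigma)$, $\sigma$ a cut-segment of $\Delta$; the degree is $\delta(\Delta)=(\mathrm{MAX}(M_\Delta),n)$, where $\mathrm{MAX}$ is the maximum ($(0,0)$ for the empty set) and $n$ is the sum of the lengths of the cut-segments of $\Delta$ of measure $\mathrm{MAX}(M_\Delta)$. Degrees are ordered lexicographically. $\Delta$ is normal iff $\delta(\Delta)=((0,0),0)$, otherwise non-normal. **Reductions** (applied to a sub-derivation). *Logical*: the standard Prawitz detour reductions for $(\kappa_I)$ immediately followed by $(\kappa_E)$ on the conclusion as major premise. *Typing*, for $sI$ immediately followed by $D_s$ with the conclusion of $sI$ as major premise: replace the whole by the derivation of the minor premise $A$ (for $\vee$, the $i$-th one, if the premise of $\vee I$ has type $\alpha_i$) in which: - $\wedge$: with premises $T:\alpha$ derived by $\Delta_1$ and $U:\beta$ by $\Delta_2$, substitute $T$ for $\xi^\alpha$, $U$ for $\xi^\beta$, put $\Delta_1,\Delta_2$ on the assumptions $\xi^\alpha:\alpha$, $\xi^\beta:\beta$; - $\vee$: with premise $T:\alpha_i$ derived by $\Delta_1$, substitute $T$ for $\xi^{\alpha_i}$ and put $\Delta_1$ on $\xi^{\alpha_i}:\alpha_i$; - $\exists$: with premise $T:\alpha(t/x)$ derived by $\Delta_1$, substitute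 $t$ for $x$, $T$ for $\xi^{\alpha(x)}$ and put $\Delta_1$ on $\xi^{\alpha(x)}:\alpha(x)$; - $\to$: with premise $T(\xi^\alpha):\beta$ derived by $\Delta_1$ from $\xi^\alpha:\alpha$, substitute $T(\xi^\alpha)$ for $\mathtt{f}^\beta(\xi^\alpha)$ and put, on $\Pi\xi^\alpha(\xi^\alpha:\alpha\supset\mathtt{f}^\beta(\xi^\alpha):\beta)$, the derivation obtained from $\Delta_1$ by $(\supset_I)$ discharging $\xi^\alpha:\alpha$ and then $(\Pi_I)$ on $\xi^\alpha$; - $\forall$: with premise $T(x):\alpha(x)$ derived by $\Delta_1$, substitute $T(x)$ for $\mathtt{h}^{\alpha(x)}_x(x)$ and put, on $\Pi x(\mathtt{h}^{\alpha(x)}_x(x):\alpha(x))$, the derivation obtained from $\Delta_1$ by $(\Pi_I)$ on $x$; and in all cases the discharged equivalence assumption is replaced by an instance of $\equiv_R$. *Permutations*: if the conclusion $S$ of an application $\star$ of $(+_E)$, $(\mathfrak{E}_E)$ or a type elimination is the major premise of an elimination or type elimination $\mathrm{elim}$ with conclusion $B$, apply $\mathrm{elim}$ (with copies of its minor derivations) to each minor premise $S$ of $\star$, and then $\star$ with conclusion $B$. $\Delta_a\succeq\Delta_b$ ($\Delta_a$ immediately reduces to $\Delta_b$) iff $\Delta_a=\Delta_b$ or $\Delta_b$ is obtained from $\Delta_a$ by one logical reduction, typing reduction or permutation. $\Delta_a\succ\Delta_b$ ($\Delta_a$ reduces to $\Delta_b$) iff there is a finite sequence $\Delta_a=\Del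ta_1\succeq\Delta_2\succeq\dots\succeq\Delta_n=\Delta_b$.
   Formalization: Equations: W≡Z[*/∘] must have a normal derivation; terms of Λ⁺ may be arguments of f and substituted; in D_→ the proper variable f^β is applied only to terms of type α, f^β(Z) becoming T(Z); the converse rules for →I and ∀I are stated for every instance of the bound variable. *)

(* Defs.v *)
From Stdlib Require Import List Relation_Operators.
Set Warnings "-notation-overridden".
From mathcomp Require Import all_boot all_order.

Set Implicit Arguments.
Unset Strict Implicit.
Unset Printing Implicit Defensive.

(* All bound variables are de Bruijn indices, with one index space for each of
   the four sorts of variables (and one for assumptions).  Terms and
   derivations are therefore identified up to renaming of bound and proper
   variables, and the usual conventions on distinctness of variables hold by
   construction: a rule with a proper variable has a premise that lives in an
   environment extended by a new variable, its other assumptions and its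
   conclusion being lifted to it. *)

Definition scons (X : Type) (x : X) (f : nat -> X) (n : nat) : X :=
  if n is n'.+1 then f n' else x.

Section Mapi.
Variables (X Y : Type) (f : nat -> X -> Y).
Fixpoint mapi (i : nat) (s : seq X) : seq Y :=
  if s is x :: s' then f i x :: mapi i.+1 s' else [::].
End Mapi.

(* Individual constants are the function symbols of arity 0. *)
Record fol := Fol {
  fsym : Type; far : fsym -> nat;
  rsym : Type; rar : rsym -> nat }.

Section FirstOrder.
Variable L : fol.

Inductive iterm : Type :=
| IVar of nat
| IFun (f : fsym L) of 'I_(far f) -> iterm.

Inductive form : Type :=
| FAtom (P : rsym L) of 'I_(rar P) -> iterm
| FBot
| FAnd of form & form
| FOr of form & form
| FImp of form & form
| FAll of form
| FEx of form.

Fixpoint isub (s : nat -> iterm) (t : iterm) : iterm :=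
  match t with
  | IVar n => s n
  | IFun f ts => IFun (fun i => isub s (ts i))
  end.

Definition ishift (n : nat) : iterm := IVar n.+1.
Definition upi (s : nat -> iterm) : nat -> iterm :=
  scons (IVar 0) (fun n => isub ishift (s n)).

Fixpoint fsub (s : nat -> iterm) (a : form) : form :=
  match a with
  | FAtom P ts => FAtom (fun i => isub s (ts i))
  | FBot => FBot
  | FAnd a b => FAnd (fsub s a) (fsub s b)
  | FOr a b => FOr (fsub s a) (fsub s b)
  | FImp a b => FImp (fsub s a) (fsub s b)
  | FAll a => FAll (fsub (upi s) a)
  | FEx a => FEx (fsub (upi s) a)
  end.

Definition fshift : form -> form := fsub ishift.
Definition finst (t : iterm) : form -> form := fsub (scons t IVar).

Fixpoint ifree (x : nat) (t : iterm) : Prop :=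
  match t with
  | IVar n => n = x
  | IFun f ts => exists i, ifree x (ts i)
  end.

Fixpoint ffree (x : nat) (a : form) : Prop :=
  match a with
  | FAtom P ts => exists i, ifree x (ts i)
  | FBot => False
  | FAnd a b | FOr a b | FImp a b => ffree x a \/ ffree x b
  | FAll a | FEx a => ffree x.+1 a
  end.

Definition is_atom (a : form) : bool := if a is FAtom _ _ then true else false.
Definition is_bot (a : form) : bool := if a is FBot then true else false.

Fixpoint k1 (a : form) : nat :=
  match a with
  | FAtom _ _ | FBot => 0
  | FAnd a b | FOr a b | FImp a b => (maxn (k1 a) (k1 b)).+1
  | FAll a | FEx a => (k1 a).+1
  end.

Section Sublanguage.
Variables (pf : pred (fsym L)) (pr : pred (rsym L)).
Fixpoint isubl (t : iterm) : Prop :=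
  match t with
  | IVar _ => True
  | IFun f ts => pf f /\ forall i, isubl (ts i)
  end.
Definition asubl (a : form) : Prop :=
  match a with
  | FAtom P ts => pr P /\ forall i, isubl (ts i)
  | FBot => True
  | _ => False
  end.
End Sublanguage.

Definition arule : Type := seq form * form.

(* Effectiveness is rendered synthetically: a recursive set is a boolean
   predicate, and a recursively axiomatisable one is given by an
   enumeration.  A rule schema is represented by its instances. *)
Record atsys := AtSys {
  star_f : pred (fsym L);
  star_r : pred (rsym L);
  arules : nat -> option arule;
  arules_prem : forall k r, arules k = Some r ->
    List.Forall (fun a => is_atom a /\ asubl star_f star_r a) r.1;
  arules_concl : forall k r, arules k = Some r ->
    (is_atom r.2 || is_bot r.2) /\ asubl star_f star_r r.2;
  arules_free : forall k r x, arules k = Some r -> ffree x r.2 ->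
    List.Exists (ffree x) r.1 }.

Inductive sder : Type := SDer (r : arule) of 'I_(size r.1) -> sder.

Definition sconcl (d : sder) : form := let: SDer r _ := d in r.2.

Variable S : atsys.

(* No assumption is ever made; by [arules_free] the conclusion is a closed
   formula. *)
Fixpoint svalid (d : sder) : Prop :=
  let: SDer r ds := d in
  (exists k, arules S k = Some r) /\
  forall i, svalid (ds i) /\ sconcl (ds i) = nth FBot r.1 i.

End FirstOrder.

Arguments IVar {L} _.
Arguments FBot {L}.
Arguments ishift {L} _.

Inductive sort := SI | ST | SF | SH.
Definition nsort (s : sort) : nat :=
  match s with SI => 0 | ST => 1 | SF => 2 | SH => 3 end.
Definition eq_sort (s s' : sort) : bool := nsort s == nsort s'.

(* The type F[a_1, ..., a_n |> b] of an occurrence of an operational symbol.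
   In its i-th argument the symbol binds [obi i] individual variables and then
   typed-variables of types [obt i]; [obt i] and [oarg i] may contain these
   individual variables. *)
Record optype (L : fol) (n : nat) := OpType {
  obi : 'I_n -> nat;
  obt : 'I_n -> seq (form L);
  oarg : 'I_n -> form L;
  ores : form L }.

Definition osub (L : fol) (n : nat) (s : nat -> iterm L) (ty : optype L n) :=
  let up i := iter (obi ty i) (@upi L) s in
  OpType (obi ty) (fun i => [seq fsub (up i) a | a <- obt ty i])
         (fun i => fsub (up i) (oarg ty i)) (fsub s (ores ty)).

(* [olang ty]: F with type ty is one of the non-primitive symbols.  Their
   closure under individual substitution makes T[t/x] a term whenever T is. *)
Record glang (L : fol) := GLang {
  osym : Type;
  onar : osym -> nat;
  olang : forall F, optype L (onar F) -> bool;
  olang_sub : forall F (s : nat -> iterm L) (ty : optype L (onar F)),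
    olang ty -> olang (osub s ty) }.

Section Grounding.
Variables (L : fol) (S : atsys L) (Lam : glang L).

Notation iterm := (iterm L).
Notation form := (form L).
Notation otype F := (optype L (onar (g := Lam) F)).

(* Terms of the enriched language: the terms without [Tf] and [Th] are those
   of the language itself.  Types of variables are given by environments, see
   below.  [TOr a a1 a2] and [TEx a0 a] are the symbols \/I[a |> a1 \/ a2] and
   EI[a0 |> E a]. *)
Inductive term : Type :=
| TVar of nat
| TCst of sder L
| TAnd of term & term
| TOr of form & form & form & term
| TImp of form & term
| TAll of term
| TEx of form & form & term
| TOp (F : osym Lam) of otype F & ('I_(onar F) -> term)
| Tf of nat & term
| Th of nat & iterm.

Definition osorts n (ty : optype L n) (i : 'I_n) : seq sort :=
  nseq (obi ty i) SI ++ nseq (size (obt ty i)) ST.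

(* Generic traversal, instantiated below by renaming, by substitution for
   individual and typed-variables, and by substitution for all variables. *)
Record traversal (X : Type) := Traversal {
  tr_up : sort -> X -> X;
  tr_i : X -> nat -> iterm;
  tr_v : X -> nat -> term;
  tr_f : X -> nat -> term -> term;
  tr_h : X -> nat -> iterm -> term }.

Fixpoint tmap X (K : traversal X) (x : X) (T : term) : term :=
  match T with
  | TVar n => tr_v K x n
  | TCst d => TCst d
  | TAnd T U => TAnd (tmap K x T) (tmap K x U)
  | TOr a a1 a2 T =>
      TOr (fsub (tr_i K x) a) (fsub (tr_i K x) a1) (fsub (tr_i K x) a2)
          (tmap K x T)
  | TImp a T => TImp (fsub (tr_i K x) a) (tmap K (tr_up K ST x) T)
  | TAll T => TAll (tmap K (tr_up K SI x) T)
  | TEx a0 a T =>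
      TEx (fsub (tr_i K x) a0) (fsub (upi (tr_i K x)) a) (tmap K x T)
  | TOp F ty Ts =>
      TOp (osub (tr_i K x) ty)
          (fun i => tmap K (foldl (fun y k => tr_up K k y) x (osorts ty i)) (Ts i))
  | Tf n Z => tr_f K x n (tmap K x Z)
  | Th n t => tr_h K x n (isub (tr_i K x) t)
  end.

Record ren := Ren {
  ri : nat -> iterm; rt : nat -> nat; rf : nat -> nat; rh : nat -> nat }.

Definition upr (r : nat -> nat) : nat -> nat := scons 0 (fun n => (r n).+1).

Definition rup (k : sort) (r : ren) : ren :=
  match k with
  | SI => Ren (upi (ri r)) (rt r) (rf r) (rh r)
  | ST => Ren (ri r) (upr (rt r)) (rf r) (rh r)
  | SF => Ren (ri r) (rt r) (upr (rf r)) (rh r)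
  | SH => Ren (ri r) (rt r) (rf r) (upr (rh r))
  end.

Definition tren : ren -> term -> term :=
  tmap (Traversal rup ri (fun r n => TVar (rt r n))
          (fun r n Z => Tf (rf r n) Z) (fun r n t => Th (rh r n) t)).

Definition shift (k : sort) : ren :=
  match k with
  | SI => Ren ishift id id id
  | ST => Ren IVar succn id id
  | SF => Ren IVar id succn id
  | SH => Ren IVar id id succn
  end.

Record tsb := Tsb { ti : nat -> iterm; tt : nat -> term }.

(* Terms do not bind functional variables. *)
Definition tup (k : sort) (s : tsb) : tsb :=
  match k with
  | SI => Tsb (upi (ti s)) (fun n => tren (shift SI) (tt s n))
  | ST => Tsb (ti s) (scons (TVar 0) (fun n => tren (shift ST) (tt s n)))
  | SF | SH => s
  end.

Definition tinst : tsb -> term -> term :=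
  tmap (Traversal tup ti tt (fun _ => Tf) (fun _ => Th)).

(* In the full substitutions, the term [sf n] put for the functional variable
   f_n lives under one additional typed-variable (index 0), which stands for
   the argument: f_n(Z) becomes (sf n)[Z/0].  The substitution of a term U for
   f_n is the case in which this variable does not occur.  Likewise [sh n]
   lives under one additional individual variable, and h_n(t) becomes
   (sh n)[t/0]. *)
Record sub := Sub {
  si : nat -> iterm; st : nat -> term; sf : nat -> term; sh : nat -> term }.

Definition sub_ren (r : ren) : sub :=
  Sub (ri r) (fun n => TVar (rt r n)) (fun n => Tf (rf r n) (TVar 0))
      (fun n => Th (rh r n) (IVar 0)).

Definition sid : sub := sub_ren (Ren IVar id id id).

Definition up (k : sort) (s : sub) : sub :=
  let w := tren (shift k) in
  match k with
  | SI => Sub (upi (si s)) (fun n => w (st s n)) (fun n => w (sf s n))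
              (fun n => tren (rup SI (shift SI)) (sh s n))
  | ST => Sub (si s) (scons (TVar 0) (fun n => w (st s n)))
              (fun n => tren (rup ST (shift ST)) (sf s n)) (fun n => w (sh s n))
  | SF => Sub (si s) (fun n => w (st s n))
              (scons (Tf 0 (TVar 0)) (fun n => w (sf s n)))
              (fun n => w (sh s n))
  | SH => Sub (si s) (fun n => w (st s n)) (fun n => w (sf s n))
              (scons (Th 0 (IVar 0)) (fun n => w (sh s n)))
  end.

Definition ups (ks : seq sort) (s : sub) : sub := foldl (fun s k => up k s) s ks.

Definition tsub : sub -> term -> term :=
  tmap (Traversal up si st
          (fun s n Z => tinst (Tsb IVar (scons Z TVar)) (sf s n))
          (fun s n t => tinst (Tsb (scons t IVar) TVar) (sh s n))).

Definition twk (k : sort) : term -> term := tren (shift k).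

(* What a binder binds.  The functional variables f^b of the language are those
   of kind [KF None b], applicable to terms of any type.  The kind
   [KF (Some a) b] is only used for the proper variable f^b of D_-> with major
   premise of type a -> b: replacing f^b(Z) by T(Z), where T(xi^a) : b, makes
   sense only if Z has type a.  In [KH b], the individual variable x of
   h^b_x is the variable 0 of b. *)
Inductive kind :=
| KI
| KT of form
| KF of option form & form
| KH of form.

Definition sort_of (k : kind) : sort :=
  match k with KI => SI | KT _ => ST | KF _ _ => SF | KH _ => SH end.

Definition ksub (s : nat -> iterm) (k : kind) : kind :=
  match k with
  | KI => KI
  | KT a => KT (fsub s a)
  | KF d b => KF (omap (fsub s) d) (fsub s b)
  | KH b => KH (fsub (upi s) b)
  end.

(* The types of the variables; the individual variable n is [IVar n] in every
   environment. *)
Record env := Env {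
  eT : nat -> form;
  eF : nat -> option form * form;
  eH : nat -> form }.

Definition ext (E : env) (k : kind) : env :=
  match k with
  | KI => Env (fun n => fshift (eT E n))
              (fun n => (omap (@fshift L) (eF E n).1, fshift (eF E n).2))
              (fun n => fsub (upi ishift) (eH E n))
  | KT a => Env (scons a (eT E)) (eF E) (eH E)
  | KF d b => Env (eT E) (scons (d, b) (eF E)) (eH E)
  | KH b => Env (eT E) (eF E) (scons b (eH E))
  end.

Definition exts (E : env) (ks : seq kind) : env := foldl ext E ks.

Definition okinds n (ty : optype L n) (i : 'I_n) : seq kind :=
  nseq (obi ty i) KI ++ [seq KT a | a <- obt ty i].

Inductive has_ty : env -> term -> form -> Prop :=
| ty_var E n : has_ty E (TVar n) (eT E n)
| ty_cst E d : svalid S d -> has_ty E (TCst d) (sconcl d)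
| ty_and E T U a b :
    has_ty E T a -> has_ty E U b -> has_ty E (TAnd T U) (FAnd a b)
| ty_or E a a1 a2 T :
    a = a1 \/ a = a2 -> has_ty E T a -> has_ty E (TOr a a1 a2 T) (FOr a1 a2)
| ty_imp E a b T : has_ty (ext E (KT a)) T b -> has_ty E (TImp a T) (FImp a b)
| ty_all E a T : has_ty (ext E KI) T a -> has_ty E (TAll T) (FAll a)
| ty_ex E a t T :
    has_ty E T (finst t a) -> has_ty E (TEx (finst t a) a T) (FEx a)
| ty_op E F (ty : otype F) Ts :
    olang ty ->
    (forall i, has_ty (exts E (okinds ty i)) (Ts i) (oarg ty i)) ->
    has_ty E (TOp ty Ts) (ores ty)
| ty_f E n Z a :
    has_ty E Z a -> (if (eF E n).1 is Some d then a = d else True) ->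
    has_ty E (Tf n Z) (eF E n).2
| ty_h E n t : has_ty E (Th n t) (finst t (eH E n)).

(* [occ k x T]: the variable x of sort k occurs free in T, the types of the
   variables of T being disregarded. *)
Fixpoint occ (k : sort) (x : nat) (T : term) : Prop :=
  match T with
  | TVar n => k = ST /\ n = x
  | TCst _ => False
  | TAnd T U => occ k x T \/ occ k x U
  | TOr a a1 a2 T =>
      (k = SI /\ (ffree x a \/ ffree x a1 \/ ffree x a2)) \/ occ k x T
  | TImp a T => (k = SI /\ ffree x a) \/ occ k (eq_sort k ST + x) T
  | TAll T => occ k (eq_sort k SI + x) T
  | TEx a0 a T => (k = SI /\ (ffree x a0 \/ ffree x.+1 a)) \/ occ k x T
  | TOp F ty Ts =>
      (k = SI /\ (ffree x (ores ty) \/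
         exists i, ffree (obi ty i + x) (oarg ty i) \/
                   List.Exists (ffree (obi ty i + x)) (obt ty i))) \/
      exists i, occ k (count (eq_sort k) (osorts ty i) + x) (Ts i)
  | Tf n Z => (k = SF /\ n = x) \/ occ k x Z
  | Th n t => (k = SH /\ n = x) \/ (k = SI /\ ifree x t)
  end.

(* FV^I; FV^T and FV^F are given by [occ ST], and by [occ SF] and [occ SH]. *)
Definition ivar_free (E : env) (x : nat) (T : term) : Prop :=
  [\/ occ SI x T,
      exists2 n, occ ST n T & ffree x (eT E n),
      exists2 n, occ SF n T & ffree x (eF E n).2 |
      exists2 n, occ SH n T & ffree x.+1 (eH E n)].

Definition in_Lambda (T : term) : Prop :=
  forall n, ~ occ SF n T /\ ~ occ SH n T.

(* A functional variable declared by (d, b) may be replaced by T.  For f^b, T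
   is a functional variable of the same kind or a term U : b. *)
Definition fun_ok (E : env) (d : option form) (b : form) (T : term) : Prop :=
  match d with
  | Some a => has_ty (ext E (KT a)) T b
  | None => (exists2 m, T = Tf m (TVar 0) & eF E m = (None, b)) \/
            (exists2 U, T = twk ST U & has_ty E U b)
  end.

(* s replaces the variables of E by terms, of the right types, over E'. *)
Definition wt_sub (E E' : env) (s : sub) : Prop :=
  [/\ forall n, has_ty E' (st s n) (fsub (si s) (eT E n)),
      forall n, fun_ok E' (omap (fsub (si s)) (eF E n).1)
                       (fsub (si s) (eF E n).2) (sf s n) &
      forall n, has_ty (ext E' KI) (sh s n) (fsub (upi (si s)) (eH E n))].

Inductive gform : Type :=
| GTy of term & form
| GEq of term & term
| GBot
| GAnd of gform & gform
| GOr of gform & gform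
| GImp of gform & gform
| GAll of kind & gform
| GEx of kind & gform.

Fixpoint gsub (s : sub) (A : gform) : gform :=
  match A with
  | GTy T a => GTy (tsub s T) (fsub (si s) a)
  | GEq T U => GEq (tsub s T) (tsub s U)
  | GBot => GBot
  | GAnd A B => GAnd (gsub s A) (gsub s B)
  | GOr A B => GOr (gsub s A) (gsub s B)
  | GImp A B => GImp (gsub s A) (gsub s B)
  | GAll k A => GAll (ksub (si s) k) (gsub (up (sort_of k) s) A)
  | GEx k A => GEx (ksub (si s) k) (gsub (up (sort_of k) s) A)
  end.

Definition wk (k : sort) : sub := sub_ren (shift k).
Definition gwks (ks : seq sort) (A : gform) : gform :=
  foldl (fun A k => gsub (wk k) A) A ks.

Definition quantifiable (k : kind) : Prop :=
  if k is KF (Some _) _ then False else True.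

Fixpoint wf (E : env) (A : gform) : Prop :=
  match A with
  | GTy T a => has_ty E T a
  | GEq T U => exists2 a, has_ty E T a & has_ty E U a
  | GBot => True
  | GAnd A B | GOr A B | GImp A B => wf E A /\ wf E B
  | GAll k A | GEx k A => quantifiable k /\ wf (ext E k) A
  end.

Definition gatomic (A : gform) : bool :=
  match A with GTy _ _ | GEq _ _ | GBot => true | _ => false end.

Fixpoint tau (A : gform) : nat :=
  match A with
  | GTy _ a => k1 a
  | GEq _ _ | GBot => 0
  | GAnd A B | GOr A B | GImp A B => maxn (tau A) (tau B)
  | GAll _ A | GEx _ A => tau A
  end.

Fixpoint k2 (A : gform) : nat :=
  match A with
  | GTy _ _ | GEq _ _ | GBot => 0
  | GAnd A B | GOr A B | GImp A B => (maxn (k2 A) (k2 B)).+1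
  | GAll _ A | GEx _ A => (k2 A).+1
  end.

Definition mu (A : gform) : nat *l nat := (tau A, k2 A).

(* Instantiating terms of the quantifiers.  In [InstH U], U lives under one
   additional individual variable, so that x does not occur in the types of
   its free typed-variables. *)
Inductive inst :=
| InstI of iterm
| InstT of term
| InstF of term
| InstH of term.

Definition sub_inst (i : inst) : sub :=
  match i with
  | InstI t => Sub (scons t IVar) (st sid) (sf sid) (sh sid)
  | InstT U => Sub IVar (scons U (st sid)) (sf sid) (sh sid)
  | InstF U => Sub IVar (st sid) (scons (twk ST U) (sf sid)) (sh sid)
  | InstH U => Sub IVar (st sid) (sf sid) (scons U (sh sid))
  end.

Definition inst_ok (E : env) (i : inst) (k : kind) : Prop :=
  match i, k with
  | InstI _, KI => True
  | InstT U, KT a => has_ty E U a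
  | InstF U, KF None b => has_ty E U b
  | InstH U, KH b => has_ty (ext E KI) U b
  | _, _ => False
  end.

Definition inst_sub (s : sub) (i : inst) : inst :=
  match i with
  | InstI t => InstI (isub (si s) t)
  | InstT U => InstT (tsub s U)
  | InstF U => InstF (tsub s U)
  | InstH U => InstH (tsub (up SI s) U)
  end.

Inductive rule : Type :=
| RAss of nat
| RCst | RIAnd | RIOr | RIImp | RIAll | RIEx of iterm
| DAnd | DOr | DImp | DAll | DEx | DBot
| RRefl | RSym | RTrans | RPres
| RCongAnd | RCongOr | RCongImp | RCongAll | RCongEx | RCongOp of seq (seq sort)
| RInvAnd1 | RInvAnd2 | RInvOr | RInvImp of term | RInvAll of iterm | RInvEx
| REqn
(* instance of an equation awaiting its derivation, see [resolve] *)
| RInst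
| RAndI | RAndE1 | RAndE2 | ROrI1 | ROrI2 | ROrE | RImpI | RImpE
| RAllI of sort | RAllE of inst | RExI of inst | RExE of sort | RBotE.

(* A rule, its conclusion, and the derivations of its premises, the major
   premise of an elimination being the first one. *)
Inductive der : Type := Node of rule & gform & seq der.

Definition concl (D : der) : gform := let: Node _ A _ := D in A.

(* The sorts of the variables bound, and the number of assumptions discharged,
   by a rule in the derivation of its i-th premise. *)
Definition binds (r : rule) (i : nat) : seq sort * nat :=
  match r, i with
  | RIImp, 0 => ([:: ST], 1)
  | RIAll, 0 => ([:: SI], 0)
  | DAnd, 1 => ([:: ST; ST], 3)
  | DOr, (1 | 2) => ([:: ST], 2)
  | DImp, 1 => ([:: SF], 2)
  | DAll, 1 => ([:: SH], 2)
  | DEx, 1 => ([:: SI; ST], 2)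
  | RCongImp, 0 => ([:: ST], 0)
  | RCongAll, 0 => ([:: SI], 0)
  | RCongOp kss, _ => (nth [::] kss i, 0)
  | ROrE, (1 | 2) => ([::], 1)
  | RImpI, 0 => ([::], 1)
  | RAllI k, 0 => ([:: k], 0)
  | RExE k, 1 => ([:: k], 1)
  | _, _ => ([::], 0)
  end.

(* A premise: kinds of the variables bound, assumptions discharged (both for
   the derivation of that premise), and formula. *)
Record premise := Prem { pkinds : seq kind; phyps : seq gform; pconcl : gform }.
Definition prem0 (A : gform) : premise := Prem [::] [::] A.

Section Derivations.

(* The equations, i.e. axioms L == Z.  They depend on the environment since a
   variable comes with its type. *)
Variable eqn : env -> term -> term -> Prop.

Inductive rule_ok (E : env) (G : seq gform) :
    rule -> seq premise -> gform -> Prop :=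
| ok_ass n A : onth G n = Some A -> rule_ok E G (RAss n) [::] A
| ok_cst d : svalid S d -> rule_ok E G RCst [::] (GTy (TCst d) (sconcl d))
| ok_Iand T U a b :
    rule_ok E G RIAnd [:: prem0 (GTy T a); prem0 (GTy U b)]
      (GTy (TAnd T U) (FAnd a b))
| ok_Ior T a a1 a2 :
    a = a1 \/ a = a2 ->
    rule_ok E G RIOr [:: prem0 (GTy T a)] (GTy (TOr a a1 a2 T) (FOr a1 a2))
| ok_Iimp T a b :
    rule_ok E G RIImp [:: Prem [:: KT a] [:: GTy (TVar 0) a] (GTy T b)]
      (GTy (TImp a T) (FImp a b))
| ok_Iall T a :
    rule_ok E G RIAll [:: Prem [:: KI] [::] (GTy T a)] (GTy (TAll T) (FAll a))
| ok_Iex T a t :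
    rule_ok E G (RIEx t) [:: prem0 (GTy T (finst t a))]
      (GTy (TEx (finst t a) a T) (FEx a))
| ok_Dand T a b A :
    rule_ok E G DAnd
      [:: prem0 (GTy T (FAnd a b));
          Prem [:: KT a; KT b]
               [:: GEq (twk ST (twk ST T)) (TAnd (TVar 1) (TVar 0));
                   GTy (TVar 1) a; GTy (TVar 0) b]
               (gwks [:: ST; ST] A)] A
| ok_Dor T a1 a2 A :
    rule_ok E G DOr
      [:: prem0 (GTy T (FOr a1 a2));
          Prem [:: KT a1]
               [:: GEq (twk ST T) (TOr a1 a1 a2 (TVar 0)); GTy (TVar 0) a1]
               (gwks [:: ST] A);
          Prem [:: KT a2]
               [:: GEq (twk ST T) (TOr a2 a1 a2 (TVar 0)); GTy (TVar 0) a2]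
               (gwks [:: ST] A)] A
| ok_Dimp T a b A :
    rule_ok E G DImp
      [:: prem0 (GTy T (FImp a b));
          Prem [:: KF (Some a) b]
               [:: GEq (twk SF T) (TImp a (Tf 0 (TVar 0)));
                   GAll (KT a) (GImp (GTy (TVar 0) a) (GTy (Tf 0 (TVar 0)) b))]
               (gwks [:: SF] A)] A
| ok_Dall T a A :
    rule_ok E G DAll
      [:: prem0 (GTy T (FAll a));
          Prem [:: KH a]
               [:: GEq (twk SH T) (TAll (Th 0 (IVar 0)));
                   GAll KI (GTy (Th 0 (IVar 0)) a)]
               (gwks [:: SH] A)] A
| ok_Dex T a A :
    rule_ok E G DEx
      [:: prem0 (GTy T (FEx a));
          Prem [:: KI; KT a]
               [:: GEq (twk ST (twk SI T))
                       (TEx a (fsub (upi ishift) a) (TVar 0));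
                   GTy (TVar 0) a]
               (gwks [:: SI; ST] A)] A
| ok_Dbot T : rule_ok E G DBot [:: prem0 (GTy T FBot)] GBot
| ok_refl T : rule_ok E G RRefl [::] (GEq T T)
| ok_sym T U : rule_ok E G RSym [:: prem0 (GEq T U)] (GEq U T)
| ok_trans T U V :
    rule_ok E G RTrans [:: prem0 (GEq T U); prem0 (GEq U V)] (GEq T V)
| ok_pres T U a :
    rule_ok E G RPres [:: prem0 (GEq T U); prem0 (GTy U a)] (GTy T a)
| ok_cong_and T U T' U' :
    rule_ok E G RCongAnd [:: prem0 (GEq T T'); prem0 (GEq U U')]
      (GEq (TAnd T U) (TAnd T' U'))
| ok_cong_or a a1 a2 T T' :
    rule_ok E G RCongOr [:: prem0 (GEq T T')]
      (GEq (TOr a a1 a2 T) (TOr a a1 a2 T'))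
| ok_cong_imp a T T' :
    rule_ok E G RCongImp [:: Prem [:: KT a] [::] (GEq T T')]
      (GEq (TImp a T) (TImp a T'))
| ok_cong_all T T' :
    rule_ok E G RCongAll [:: Prem [:: KI] [::] (GEq T T')]
      (GEq (TAll T) (TAll T'))
| ok_cong_ex a0 a T T' :
    rule_ok E G RCongEx [:: prem0 (GEq T T')]
      (GEq (TEx a0 a T) (TEx a0 a T'))
| ok_cong_op F (ty : otype F) Ts Ts' :
    rule_ok E G (RCongOp [seq osorts ty i | i <- enum 'I_(onar F)])
      [seq Prem (okinds ty i) [::] (GEq (Ts i) (Ts' i)) | i <- enum 'I_(onar F)]
      (GEq (TOp ty Ts) (TOp ty Ts'))
| ok_inv_and1 T U T' U' :
    rule_ok E G RInvAnd1 [:: prem0 (GEq (TAnd T U) (TAnd T' U'))] (GEq T T')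
| ok_inv_and2 T U T' U' :
    rule_ok E G RInvAnd2 [:: prem0 (GEq (TAnd T U) (TAnd T' U'))] (GEq U U')
| ok_inv_or a a1 a2 T T' :
    rule_ok E G RInvOr [:: prem0 (GEq (TOr a a1 a2 T) (TOr a a1 a2 T'))]
      (GEq T T')
(* The variable bound in the premise becomes free in the conclusion; the rule
   is stated for all the terms that may be substituted for it. *)
| ok_inv_imp a T T' Z :
    has_ty E Z a ->
    rule_ok E G (RInvImp Z) [:: prem0 (GEq (TImp a T) (TImp a T'))]
      (GEq (tsub (sub_inst (InstT Z)) T) (tsub (sub_inst (InstT Z)) T'))
| ok_inv_all T T' t :
    rule_ok E G (RInvAll t) [:: prem0 (GEq (TAll T) (TAll T'))]
      (GEq (tsub (sub_inst (InstI t)) T) (tsub (sub_inst (InstI t)) T'))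
| ok_inv_ex a0 a T T' :
    rule_ok E G RInvEx [:: prem0 (GEq (TEx a0 a T) (TEx a0 a T'))] (GEq T T')
| ok_eqn T Z : eqn E T Z -> rule_ok E G REqn [::] (GEq T Z)
| ok_andI A B : rule_ok E G RAndI [:: prem0 A; prem0 B] (GAnd A B)
| ok_andE1 A B : rule_ok E G RAndE1 [:: prem0 (GAnd A B)] A
| ok_andE2 A B : rule_ok E G RAndE2 [:: prem0 (GAnd A B)] B
| ok_orI1 A B : rule_ok E G ROrI1 [:: prem0 A] (GOr A B)
| ok_orI2 A B : rule_ok E G ROrI2 [:: prem0 B] (GOr A B)
| ok_orE A B C :
    rule_ok E G ROrE
      [:: prem0 (GOr A B); Prem [::] [:: A] C; Prem [::] [:: B] C] C
| ok_impI A B : rule_ok E G RImpI [:: Prem [::] [:: A] B] (GImp A B)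
| ok_impE A B : rule_ok E G RImpE [:: prem0 (GImp A B); prem0 A] B
| ok_allI k A :
    rule_ok E G (RAllI (sort_of k)) [:: Prem [:: k] [::] A] (GAll k A)
| ok_allE k A i :
    inst_ok E i k ->
    rule_ok E G (RAllE i) [:: prem0 (GAll k A)] (gsub (sub_inst i) A)
| ok_exI k A i :
    inst_ok E i k ->
    rule_ok E G (RExI i) [:: prem0 (gsub (sub_inst i) A)] (GEx k A)
| ok_exE k A B :
    rule_ok E G (RExE (sort_of k))
      [:: prem0 (GEx k A); Prem [:: k] [:: A] (gwks [:: sort_of k] B)] B
| ok_botE A : gatomic A -> rule_ok E G RBotE [:: prem0 GBot] A.

(* [deriv E G D A]: D is a derivation of A from (at most) the assumptions G, the
   types of the variables being given by E. *)
Inductive deriv : env -> seq gform -> der -> gform -> Prop :=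
| Deriv E G r A ps prs :
    wf E A ->
    rule_ok E G r prs A ->
    List.Forall2 (fun p pr =>
        deriv (exts E (pkinds pr))
              (phyps pr ++
                 [seq gwks [seq sort_of k | k <- pkinds pr] B | B <- G])
              p (pconcl pr)) ps prs ->
    deriv E G (Node r A ps) A.

End Derivations.

(* Occurrences of formulas are positions in the tree: i :: p is the position p
   in the i-th immediate subderivation. *)
Fixpoint sub_at (p : seq nat) (D : der) : option der :=
  if p is i :: p' then
    let: Node _ _ ps := D in obind (sub_at p') (onth ps i)
  else Some D.

Fixpoint positions (D : der) : seq (seq nat) :=
  let: Node _ _ ps := D in
  [::] :: flatten (mapi (fun i d => [seq i :: p | p <- positions d]) 0 ps).

Definition parent (p : seq nat) : seq nat := take (size p).-1 p.

Definition label (D : der) (p : seq nat) : option rule :=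
  omap (fun d : der => let: Node r _ _ := d in r) (sub_at p D).

Definition transmits (r : rule) : bool :=
  match r with
  | ROrE | RExE _ | DAnd | DOr | DImp | DAll | DEx => true
  | _ => false
  end.

Definition eliminates (r : rule) : bool :=
  match r with
  | RAndE1 | RAndE2 | RImpE | RAllE _ => true
  | _ => transmits r
  end.

Definition matching (intro elim : rule) : bool :=
  match intro, elim with
  | RIAnd, DAnd | RIOr, DOr | RIImp, DImp | RIAll, DAll | RIEx _, DEx => true
  | RAndI, (RAndE1 | RAndE2) | (ROrI1 | ROrI2), ROrE | RImpI, RImpE
  | RAllI _, RAllE _ | RExI _, RExE _ => true
  | _, _ => false
  end.

Definition minor_of (D : der) (p q : seq nat) : bool :=
  [&& p != [::], q == parent p, last 0 p != 0 &
      if label D q is Some r then transmits r else false].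

Definition major_of (p : seq nat) : bool := (p != [::]) && (last 0 p == 0).

(* In a derivation, a minor premise of a rule [r] with [transmits r] is the
   conclusion of the rule (lifted to the environment of the premise), so that
   the positions are occurrences of one formula. *)
Definition cut_segment (D : der) (s : seq (seq nat)) : bool :=
  if s is p :: s' then
    let q := last p s' in
    [&& path (minor_of D) p s', major_of q &
        if (label D p, label D (parent q)) is (Some r, Some r')
        then matching r r' else false]
  else false.

(* Each occurrence is the parent of the preceding one, so a cut-segment is
   determined by its first position and its length. *)
Definition cut_segments (D : der) : seq (seq (seq nat)) :=
  [seq s <- [seq traject parent p n | p <- positions D, n <- iota 1 (size p)]
     | cut_segment D s].

Definition seg_mu (D : der) (s : seq (seq nat)) : nat *l nat :=
  if sub_at (head [::] s) D is Some d then mu (concl d) else (0, 0).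

Definition max_mu (D : der) : nat *l nat :=
  \big[Order.max/((0, 0) : nat *l nat)]_(s <- cut_segments D) seg_mu D s.

Definition degree (D : der) : (nat *l nat) * nat :=
  (max_mu D, \sum_(s <- cut_segments D | seg_mu D s == max_mu D) size s).

Definition normal (D : der) : Prop := degree D = ((0, 0) : nat *l nat, 0).

Definition rule_sub (s : sub) (r : rule) : rule :=
  match r with
  | RIEx t => RIEx (isub (si s) t)
  | RInvImp Z => RInvImp (tsub s Z)
  | RInvAll t => RInvAll (isub (si s) t)
  | RAllE i => RAllE (inst_sub s i)
  | RExI i => RExI (inst_sub s i)
  | REqn => RInst
  | _ => r
  end.

(* Substitution for variables.  An equation L == Z becomes its instance
   L[s] == Z[s], which need not be an axiom: it is labelled [RInst]. *)
Fixpoint dsub (s : sub) (D : der) : der :=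
  let: Node r A ps := D in
  Node (rule_sub s r) (gsub s A)
       (mapi (fun i d => dsub (ups (binds r i).1 s) d) 0 ps).

Definition dwks (ks : seq sort) (D : der) : der :=
  foldl (fun D k => dsub (wk k) D) D ks.

Definition lift (m : nat) (r : nat -> nat) (n : nat) : nat :=
  if n < m then n else m + r (n - m).

Fixpoint dren (r : nat -> nat) (D : der) : der :=
  match D with
  | Node (RAss n) A ps => Node (RAss (r n)) A ps
  | Node q A ps =>
      Node q A (mapi (fun i d => dren (lift (binds q i).2 r) d) 0 ps)
  end.

(* Replacement of the assumption n by a derivation, or by the assumption k. *)
Definition lift_plug (b : seq sort * nat) (h : nat -> nat + der) (n : nat) :
    nat + der :=
  if n < b.2 then inl n else
  match h (n - b.2) with
  | inl k => inl (b.2 + k)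
  | inr D => inr (dren (addn b.2) (dwks b.1 D))
  end.

Fixpoint dplug (h : nat -> nat + der) (D : der) : der :=
  match D with
  | Node (RAss n) A ps =>
      match h n with inl k => Node (RAss k) A ps | inr D' => D' end
  | Node q A ps =>
      Node q A (mapi (fun i d => dplug (lift_plug (binds q i) h) d) 0 ps)
  end.

(* The derivations ds are put on the first assumptions of D. *)
Definition plug (ds : seq der) (D : der) : der :=
  dplug (fun n => if onth ds n is Some d then inr d else inl (n - size ds)) D.

Definition drefl (T : term) : der := Node RRefl (GEq T T) [::].

(* The elimination el, with conclusion B and minor derivations [behead ps],
   applied to the i-th minor premise m of the rule r. *)
Definition permute (r el : rule) (B : gform) (ps : seq der) (i : nat) (m : der)
    : der :=
  let b := binds r i in
  let: Node el' B' ps' := dren (addn b.2) (dwks b.1 (Node el B ps)) in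
  Node el' B' (m :: behead ps').

Inductive contract : der -> der -> Prop :=
| c_and A B T U D1 D2 M :
    contract (Node DAnd A [:: Node RIAnd (GTy (TAnd T U) B) [:: D1; D2]; M])
      (plug [:: drefl (TAnd T U); D1; D2]
         (dsub (Sub IVar (scons U (scons T (st sid))) (sf sid) (sh sid)) M))
| c_or1 A B T a1 a2 D1 M1 M2 :
    contract (Node DOr A [:: Node RIOr (GTy (TOr a1 a1 a2 T) B) [:: D1]; M1; M2])
      (plug [:: drefl (TOr a1 a1 a2 T); D1] (dsub (sub_inst (InstT T)) M1))
| c_or2 A B T a1 a2 D1 M1 M2 :
    contract (Node DOr A [:: Node RIOr (GTy (TOr a2 a1 a2 T) B) [:: D1]; M1; M2])
      (plug [:: drefl (TOr a2 a1 a2 T); D1] (dsub (sub_inst (InstT T)) M2))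
| c_imp A T a b D1 M :
    contract (Node DImp A [:: Node RIImp (GTy (TImp a T) (FImp a b)) [:: D1]; M])
      (let B := GImp (GTy (TVar 0) a) (GTy T b) in
       plug [:: drefl (TImp a T);
                Node (RAllI ST) (GAll (KT a) B) [:: Node RImpI B [:: D1]]]
         (dsub (Sub IVar (st sid) (scons T (sf sid)) (sh sid)) M))
| c_all A T a D1 M :
    contract (Node DAll A [:: Node RIAll (GTy (TAll T) (FAll a)) [:: D1]; M])
      (plug [:: drefl (TAll T); Node (RAllI SI) (GAll KI (GTy T a)) [:: D1]]
         (dsub (sub_inst (InstH T)) M))
| c_ex A B T a0 a t D1 M :
    contract (Node DEx A [:: Node (RIEx t) (GTy (TEx a0 a T) B) [:: D1]; M])
      (plug [:: drefl (TEx a0 a T); D1]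
         (dsub (Sub (scons t IVar) (scons T (st sid)) (sf sid) (sh sid)) M))
| c_land1 A B D1 D2 :
    contract (Node RAndE1 A [:: Node RAndI B [:: D1; D2]]) D1
| c_land2 A B D1 D2 :
    contract (Node RAndE2 A [:: Node RAndI B [:: D1; D2]]) D2
| c_lor1 A B D M1 M2 :
    contract (Node ROrE A [:: Node ROrI1 B [:: D]; M1; M2]) (plug [:: D] M1)
| c_lor2 A B D M1 M2 :
    contract (Node ROrE A [:: Node ROrI2 B [:: D]; M1; M2]) (plug [:: D] M2)
| c_limp A B D1 D2 :
    contract (Node RImpE A [:: Node RImpI B [:: D1]; D2]) (plug [:: D2] D1)
| c_lall A B k i D1 :
    contract (Node (RAllE i) A [:: Node (RAllI k) B [:: D1]])
      (dsub (sub_inst i) D1)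
| c_lex A B k i D1 M :
    contract (Node (RExE k) A [:: Node (RExI i) B [:: D1]; M])
      (plug [:: D1] (dsub (sub_inst i) M))
| c_perm r el C B maj ms ns :
    transmits r -> eliminates el ->
    let D := Node r C (maj :: ms) in
    contract (Node el B (D :: ns))
      (Node r B (maj :: mapi (permute r el B (D :: ns)) 1 ms)).

Section Reduction.
Variable eqn : env -> term -> term -> Prop.

(* An instance T == Z of an equation is kept if it is itself an axiom, and is
   otherwise derived by transitivity from an axiom T == W and a closed
   derivation of W == Z. *)
Inductive resolve : der -> der -> Prop :=
| rs_axiom T Z :
    resolve (Node RInst (GEq T Z) [::]) (Node REqn (GEq T Z) [::])
| rs_trans T Z W E D :
    deriv eqn E [::] D (GEq W Z) ->
    resolve (Node RInst (GEq T Z) [::])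
            (Node RTrans (GEq T Z) [:: Node REqn (GEq T W) [::]; D])
| rs_node r A ps ps' :
    List.Forall2 resolve ps ps' -> resolve (Node r A ps) (Node r A ps').

Inductive step : der -> der -> Prop :=
| step_here D D1 D' : contract D D1 -> resolve D1 D' -> step D D'
| step_in r A ps1 ps2 D D' :
    step D D' -> step (Node r A (ps1 ++ D :: ps2)) (Node r A (ps1 ++ D' :: ps2)).

(* Immediate reducibility between derivations of A from G; since [RInst] is
   the label of no rule, all the instances of equations in D' have been
   resolved. *)
Definition ired E G A (D D' : der) : Prop :=
  [/\ deriv eqn E G D A, deriv eqn E G D' A & D = D' \/ step D D'].

Definition reduces E G A : der -> der -> Prop :=
  clos_refl_trans der (ired E G A).

End Reduction.

(* The i-th argument of F is of the appropriate kind: Pi x Pi xi (xi : g imp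
   T_i : a_i) for the sequences x and xi bound by F. *)
Definition arg_hyp n (ty : optype L n) (Ts : 'I_n -> term) (i : 'I_n) :
    gform :=
  foldr (fun k B =>
           if k is KT g then GAll k (GImp (GTy (TVar 0) g) B) else GAll k B)
        (GTy (Ts i) (oarg ty i)) (okinds ty i).

Record gsystem := GSystem {
  geqn : env -> term -> term -> Prop;
  geqn_shape : forall E T Z, geqn E T Z ->
    exists F (ty : otype F) Us,
      [/\ T = TOp ty Us, has_ty E T (ores ty) & has_ty E Z (ores ty)];
  geqn_free : forall E T Z, geqn E T Z ->
    (forall x, ivar_free E x Z -> ivar_free E x T) /\
    (forall k x, k <> SI -> occ k x Z -> occ k x T);
  (* [normal D] excludes only systems in which some derivable W == Z[s] has no
     normal derivation, i.e. in which normalisation fails for the derivations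
     of W == Z[s].  A substitution puts D in the place of an axiom, hence D
     must not bring in cuts of its own. *)
  geqn_sub : forall E E' s T Z, geqn E T Z -> wt_sub E E' s ->
    exists W D, [/\ geqn E' (tsub s T) W,
                    deriv geqn E' [::] D (GEq W (tsub s Z)) & normal D];
  well_given_op : forall E F (ty : otype F) Ts, has_ty E (TOp ty Ts) (ores ty) ->
    exists D, deriv geqn E [seq arg_hyp ty Ts i | i <- enum 'I_(onar F)] D
                    (GTy (TOp ty Ts) (ores ty));
  well_given_term : forall E U b, in_Lambda U -> has_ty E U b ->
    exists ns D, (forall n, n \in ns <-> occ ST n U) /\
                 deriv geqn E [seq GTy (TVar n) (eT E n) | n <- ns] D (GTy U b) }.

End Grounding.

(* Main.v *)
(* A cut on a formula of measure mu is removed by a contraction that only creates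
   cuts of smaller measure, once permutations have brought the introduction in
   contact with the elimination.  Let [m] be the largest measure of a cut.  By
   induction on the derivation, from the assumptions to the conclusion, all the
   cuts of measure [m] are removed; the invariant is that no new segment from an
   introduction to the conclusion appears, except for conclusions of measure less
   than [m].  Then [m] decreases in the lexicographic order.  The result of a
   substitution contains unresolved instances of equations: it is typed in a
   calculus where these are leaves, and resolving them by cut-free derivations
   changes neither the cuts nor the segments. *)
From Stdlib Require Import FunctionalExtensionality Relation_Operators.
From mathcomp Require Import all_boot all_order.
Require Import Defs.

Set Implicit Arguments.
Unset Strict Implicit.
Unset Printing Implicit Defensive.

(** * Substitution for individual variables *)

(** The types come first in the measure because contracting [DImp] puts on a discharged assumption a
    formula of logical complexity 2, while the cut formula is atomic; only the types have become
    simpler. Logical contractions lower [k2] and do not raise [tau].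

    The invariant on segments holds for the following reason. A contraction ends either in a minor
    derivation or in a component of the cut formula. In the first case the conclusion may have any
    measure, but a segment that reaches it through the minor derivation already passed through the
    elimination; a segment that starts in a derivation put on an assumption carries a component of
    the cut formula.

    Equations are an obstacle to every step: an instance of an axiom is derivable but need not be an
    axiom. This concerns permutations too, since lifting the copied minor derivations under a binder
    is a substitution. As every intermediate tree of a reduction has to be a derivation, resolution
    takes place within each step.

    The degree is defined by positions in the tree, which substitution and plugging do not treat
    well. Cuts are therefore computed by recursion, and the two notions are compared once. *)

Lemma funext (X Y : Type) (f g : X -> Y) : f =1 g -> f = g.
Proof. exact: functional_extensionality. Qed.

Section FirstOrderSubstitution.
Variable L : fol.
Implicit Types (s : nat -> iterm L) (t : iterm L) (a : form L).

Definition icomp s s' : nat -> iterm L := fun n => isub s (s' n).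

Lemma isub_comp s s' t : isub s (isub s' t) = isub (icomp s s') t.
Proof. by elim: t => //= f ts IH; congr IFun; apply: funext. Qed.

Lemma isub_id t : isub IVar t = t.
Proof. by elim: t => //= f ts IH; congr IFun; apply: funext. Qed.

Lemma upi_id : upi IVar = IVar :> (nat -> iterm L).
Proof. by apply: funext; case. Qed.

Lemma upi_comp s s' : icomp (upi s) (upi s') = upi (icomp s s').
Proof. by apply: funext; case=> //= n; rewrite /icomp /= !isub_comp. Qed.

Lemma fsub_comp s s' a : fsub s (fsub s' a) = fsub (icomp s s') a.
Proof.
elim: a s s' => [P ts|||||a IH|a IH] s s' //=; last 2 first.
- by rewrite IH upi_comp.
- by rewrite IH upi_comp.
- by congr FAtom; apply: funext => i; exact: isub_comp.
all: by congruence.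
Qed.

Lemma fsub_id a : fsub IVar a = a.
Proof.
elim: a => [P ts|||||a IH|a IH] //=; rewrite ?upi_id; try by congruence.
by congr FAtom; apply: funext => i; exact: isub_id.
Qed.

Lemma map_fsub_id (l : seq (form L)) : map (fsub IVar) l = l.
Proof. by elim: l => //= a l ->; rewrite fsub_id. Qed.

Lemma iter_upi_id n : iter n (@upi L) IVar = IVar.
Proof. by elim: n => //= n ->; exact: upi_id. Qed.

Lemma iter_upi_comp n s s' :
  icomp (iter n (@upi L) s) (iter n (@upi L) s') = iter n (@upi L) (icomp s s').
Proof. by elim: n => //= n <-; exact: upi_comp. Qed.

Lemma osub_comp n s s' (ty : optype L n) : osub s (osub s' ty) = osub (icomp s s') ty.
Proof.
rewrite /osub /= fsub_comp; congr OpType; apply: funext => i.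
  rewrite -map_comp; apply: eq_map => a /=.
  by rewrite fsub_comp iter_upi_comp.
by rewrite fsub_comp iter_upi_comp.
Qed.

Lemma osub_id n (ty : optype L n) : osub IVar ty = ty.
Proof.
case: ty => obi obt oarg ores; rewrite /osub /= fsub_id; congr OpType.
  by apply: funext => i; rewrite iter_upi_id map_fsub_id.
by apply: funext => i; rewrite iter_upi_id fsub_id.
Qed.

Lemma osorts_sub n s (ty : optype L n) i : osorts (osub s ty) i = osorts ty i.
Proof. by rewrite /osorts /= size_map. Qed.

Lemma fsub_finst s t a : fsub s (finst t a) = finst (isub s t) (fsub (upi s) a).
Proof.
rewrite /finst !fsub_comp; congr fsub; apply: funext; case=> //= n.
by rewrite /icomp /= isub_comp isub_id.
Qed.

Lemma finst_fshift t a : finst t (fshift a) = a.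
Proof. by rewrite /finst /fshift fsub_comp -[RHS]fsub_id. Qed.

Lemma finst_upi_shift a : finst (IVar 0) (fsub (upi ishift) a) = a.
Proof.
rewrite /finst fsub_comp -[RHS]fsub_id; congr fsub.
by apply: funext; case.
Qed.

Lemma fsub_fshift s a : fsub (upi s) (fshift a) = fshift (fsub s a).
Proof. by rewrite /fshift !fsub_comp. Qed.

Lemma fsub_upi_shift s a :
  fsub (upi (upi s)) (fsub (upi ishift) a) = fsub (upi ishift) (fsub (upi s) a).
Proof. by rewrite !fsub_comp !upi_comp. Qed.

Lemma k1_sub s a : k1 (fsub s a) = k1 a.
Proof. by elim: a s => //= [a IHa b IHb|a IHa b IHb|a IHa b IHb|a IH|a IH] s; rewrite ?IHa ?IHb ?IH. Qed.

Lemma isub_free s s' t : (forall x, ifree x t -> s x = s' x) -> isub s t = isub s' t.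
Proof.
elim: t => [n|f ts IH] /= H; first exact: H.
by congr IFun; apply: funext => i; apply: IH => x Hx; apply: H; exists i.
Qed.

Lemma fsub_free s s' a : (forall x, ffree x a -> s x = s' x) -> fsub s a = fsub s' a.
Proof.
have up_eq u v b : (forall x, ffree x.+1 b -> u x = v x) ->
    forall x, ffree x b -> upi u x = upi v x.
  by move=> H [|x] //= Hx; rewrite (H x Hx).
elim: a s s' => [P ts||a IHa b IHb|a IHa b IHb|a IHa b IHb|a IH|a IH] s s' H //=.
- congr FAtom; apply: funext => i; apply: isub_free => x Hx; apply: H.
  by exists i.
- by rewrite (IHa s s') ?(IHb s s') // => x Hx; apply: H; [right | left].
- by rewrite (IHa s s') ?(IHb s s') // => x Hx; apply: H; [right | left].
- by rewrite (IHa s s') ?(IHb s s') // => x Hx; apply: H; [right | left].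
- by rewrite (IH _ (upi s')) //; apply: up_eq => x Hx; apply: H.
- by rewrite (IH _ (upi s')) //; apply: up_eq => x Hx; apply: H.
Qed.

(** By [arules_free] a free variable of the conclusion is free in a premise, which is the conclusion
    of an immediate subderivation; the induction excludes this. Hence substitution leaves constants
    and their types alone. *)
Lemma sconcl_closed (S : atsys L) d x : svalid S d -> ~ ffree x (sconcl d).
Proof.
elim: d => r ds IH /= [[k Hk] Hds] Hx.
have := arules_free Hk Hx.
have : forall i (Hi : i < size r.1), ~ ffree x (nth FBot r.1 i).
  move=> i Hi; have [Hv /= <-] := Hds (Ordinal Hi).
  exact: IH.
elim: (r.1) => [|a l IHl] Hn He; first by inversion He.
inversion He; subst; first exact: (Hn 0 isT).
by apply: IHl => // i Hi; exact: (Hn i.+1).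
Qed.

Lemma sconcl_sub (S : atsys L) d s : svalid S d -> fsub s (sconcl d) = sconcl d.
Proof.
move=> Hd; rewrite -[RHS]fsub_id; apply: fsub_free => x.
by move/(sconcl_closed Hd).
Qed.

End FirstOrderSubstitution.

(** * Composition of substitutions in terms *)

Section TermSubstitution.
Variables (L : fol) (Lam : glang L).
Notation term := (term Lam).
Notation sub := (sub Lam).
Notation TVar := (TVar Lam).
Notation Th := (Th Lam).
Notation sid := (sid Lam).
Notation sub_ren := (sub_ren Lam).
Implicit Types (T U Z : term) (s : sub) (r : ren L) (k : sort).

Lemma eq_sub s s' : si s =1 si s' -> st s =1 st s' -> sf s =1 sf s' -> sh s =1 sh s' ->
  s = s'.
Proof.
case: s s' => [a b c d] [a' b' c' d'] /=.
by move=> /funext-> /funext-> /funext-> /funext->.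
Qed.

Lemma eq_ren r r' : ri r =1 ri r' -> rt r =1 rt r' -> rf r =1 rf r' -> rh r =1 rh r' ->
  r = r'.
Proof.
case: r r' => [a b c d] [a' b' c' d'] /=.
by move=> /funext-> /funext-> /funext-> /funext->.
Qed.

(** The sorts that terms can bind. The restriction matters for [tinst]: its [tup] does nothing at
    the functional sorts, so the condition on binders in [tmap_fuse] would fail there. *)
Definition term_sort k := if k is (SI | ST) then true else false.

(** The induction shared by all the composition laws. Each of them reduces to the variables and to
    the passage under one binder. *)
Lemma tmap_fuse X Y V (K1 : traversal Lam X) (K2 : traversal Lam Y)
    (K3 : traversal Lam V) (c : Y -> X -> V) :
  (forall k x y, term_sort k -> c (tr_up K2 k y) (tr_up K1 k x) = tr_up K3 k (c y x)) ->
  (forall x y, icomp (tr_i K2 y) (tr_i K1 x) = tr_i K3 (c y x)) ->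
  (forall x y n, tmap K2 y (tr_v K1 x n) = tr_v K3 (c y x) n) ->
  (forall x y n T, tmap K2 y (tr_f K1 x n T) = tr_f K3 (c y x) n (tmap K2 y T)) ->
  (forall x y n t, tmap K2 y (tr_h K1 x n t) = tr_h K3 (c y x) n (isub (tr_i K2 y) t)) ->
  forall T y x, tmap K2 y (tmap K1 x T) = tmap K3 (c y x) T.
Proof.
move=> Hup Hi Hv Hf Hh; elim=> [n|d|T IHT U IHU|a a1 a2 T IH|a T IH|T IH|a a' T IH
  |F ty Ts IH|n T IH|n t] y x //=.
- by rewrite IHT IHU.
- by rewrite !fsub_comp Hi IH.
- by rewrite fsub_comp Hi IH Hup.
- by rewrite IH Hup.
- by rewrite !fsub_comp upi_comp Hi IH.
- rewrite osub_comp Hi; congr TOp; apply: funext => i.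
  rewrite osorts_sub IH; congr tmap.
  have: all term_sort (osorts ty i) by rewrite all_cat !all_nseq !orbT.
  elim: (osorts ty i) x y => //= k ks IHks x y /andP[Hk Hks].
  by rewrite IHks // Hup.
- by rewrite Hf IH.
- by rewrite Hh isub_comp Hi.
Qed.

Lemma tmap_eq X Y (K1 : traversal Lam X) (K2 : traversal Lam Y) (c : X -> Y) :
  (forall k x, term_sort k -> c (tr_up K1 k x) = tr_up K2 k (c x)) ->
  (forall x, tr_i K1 x = tr_i K2 (c x)) ->
  (forall x n, tr_v K1 x n = tr_v K2 (c x) n) ->
  (forall x n T, tr_f K1 x n T = tr_f K2 (c x) n T) ->
  (forall x n t, tr_h K1 x n t = tr_h K2 (c x) n t) ->
  forall T x, tmap K1 x T = tmap K2 (c x) T.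
Proof.
move=> Hup Hi Hv Hf Hh; elim=> [n|d|T IHT U IHU|a a1 a2 T IH|a T IH|T IH|a a' T IH
  |F ty Ts IH|n T IH|n t] x //=; rewrite ?Hi.
- by rewrite IHT IHU.
- by rewrite IH.
- by rewrite IH Hup.
- by rewrite IH Hup.
- by rewrite IH.
- congr TOp; apply: funext => i; rewrite IH; congr tmap.
  have: all term_sort (osorts ty i) by rewrite all_cat !all_nseq !orbT.
  elim: (osorts ty i) x => //= k ks IHks x /andP[Hk Hks].
  by rewrite IHks // Hup.
- by rewrite Hf IH.
- by rewrite Hh.
Qed.

Lemma tren_sub r T : tren r T = tsub (sub_ren r) T.
Proof.
rewrite /tren /tsub; apply: tmap_eq => //= k {}r.
by case: k => //= _; apply: eq_sub => //=; case.
Qed.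

Definition sub_tsb (s : tsb Lam) : sub := Sub (ti s) (tt s) (sf sid) (sh sid).

Lemma tinst_sub (s : tsb Lam) T : tinst s T = tsub (sub_tsb s) T.
Proof.
rewrite /tinst /tsub; apply: tmap_eq => //= k {}s.
by case: k => //= _; apply: eq_sub => //=; case.
Qed.

Lemma up_sid k : up k sid = sid.
Proof.
by case: k; apply: eq_sub => //=; case.
Qed.

Lemma tmap_id X (K : traversal Lam X) x :
  (forall k, tr_up K k x = x) -> tr_i K x = IVar ->
  (forall n, tr_v K x n = TVar n) -> (forall n T, tr_f K x n T = Tf n T) ->
  (forall n t, tr_h K x n t = Th n t) ->
  forall T, tmap K x T = T.
Proof.
move=> Hup Hi Hv Hf Hh; elim=> [n|d|T IHT U IHU|a a1 a2 T IH|a T IH|T IH|a a' T IH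
  |F ty Ts IH|n T IH|n t] //=; rewrite ?Hup ?Hi ?upi_id ?fsub_id ?isub_id //.
- by rewrite IHT IHU.
- by rewrite IH.
- by rewrite IH.
- by rewrite IH.
- by rewrite IH.
- rewrite osub_id; congr TOp; apply: funext => i.
  suff -> : foldl (fun y k => tr_up K k y) x (osorts ty i) = x by exact: IH.
  by elim: (osorts ty i) => //= k ks IHks; rewrite Hup.
- by rewrite Hf IH.
Qed.

Lemma tsub_id T : tsub sid T = T.
Proof. by apply: tmap_id => //= k; exact: up_sid. Qed.

(** * Composition laws, from renamings up to full substitutions *)

Definition sub_after_ren s r : sub :=
  Sub (icomp (si s) (ri r)) (st s \o rt r) (sf s \o rf r) (sh s \o rh r).

Lemma up_sub_after_ren k s r :
  sub_after_ren (up k s) (rup k r) = up k (sub_after_ren s r).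
Proof.
case: k; apply: eq_sub => //= n; rewrite ?upi_comp //; try by case: n.
Qed.

(** The start of a chain: each composition law gives the weakening laws that serve as condition on
    binders for the next one. [tinst] takes part in the chain because replacing a functional
    variable performs an inner instantiation. *)
Lemma tsub_tren s r T : tsub s (tren r T) = tsub (sub_after_ren s r) T.
Proof.
by apply: tmap_fuse => // k x y _; exact: up_sub_after_ren.
Qed.

Definition rcomp r r' : ren L :=
  Ren (icomp (ri r) (ri r')) (rt r \o rt r') (rf r \o rf r') (rh r \o rh r').

Lemma tren_tren r r' T : tren r (tren r' T) = tren (rcomp r r') T.
Proof.
by rewrite (tren_sub r) tsub_tren tren_sub.
Qed.

Lemma rup_comp k r r' : rup k (rcomp r r') = rcomp (rup k r) (rup k r').
Proof. by case: k; apply: eq_ren => //= n; rewrite ?upi_comp //; case: n. Qed.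

Lemma rup_shift k r : rcomp (rup k r) (shift L k) = rcomp (shift L k) r.
Proof. by case: k; apply: eq_ren => //= n; rewrite /icomp /= ?isub_id. Qed.

Lemma tren_up k r T : tren (rup k r) (twk k T) = twk k (tren r T).
Proof. by rewrite /twk !tren_tren rup_shift. Qed.

(** The entries of [sf] and [sh] live under an additional variable, of sort [j] here; this is
    [tren_up] below that variable. *)
Lemma tren_up2 j k r T :
  tren (rup j (rup k r)) (tren (rup j (shift L k)) T)
  = tren (rup j (shift L k)) (tren (rup j r) T).
Proof. by rewrite !tren_tren -!rup_comp rup_shift. Qed.

Ltac by_sort lem :=
  first [exact: (lem SI) | exact: (lem ST) | exact: (lem SF) | exact: (lem SH)].
Lemma tren_upC j k r T : j <> k ->
  tren (rup j (rup k r)) (twk k T) = twk k (tren (rup j r) T).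
Proof.
by move=> Hjk; rewrite -tren_up; congr tren; case: j k Hjk => [] [].
Qed.

(** Each sort has its own index space, so binders of different sorts do not interact. *)
Lemma up_upC j k s : j <> k -> up j (up k s) = up k (up j s).
Proof.
case: j k => [] [] // _; apply: eq_sub => //= -[|n] //=.
all: by rewrite !tren_tren; congr tren; apply: eq_ren => //= -[].
Qed.

Ltac by_sort2 lem := first [by_sort (lem SI) | by_sort (lem ST)].

Ltac by_upC lem :=
  first [by apply: (lem ST SI) | by apply: (lem ST SF) | by apply: (lem ST SH) |
         by apply: (lem SI ST) | by apply: (lem SI SF) | by apply: (lem SI SH)].

Lemma tren_tinst r (g : tsb Lam) T :
  tren r (tinst g T) = tsub (Sub (icomp (ri r) (ti g)) (tren r \o tt g)
    (fun n => Tf (rf r n) (TVar 0)) (fun n => Th (rh r n) (IVar 0))) T.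
Proof.
pose c r (g : tsb Lam) := Sub (icomp (ri r) (ti g)) (tren r \o tt g)
    (fun n => Tf (rf r n) (TVar 0)) (fun n => Th (rh r n) (IVar 0)).
rewrite -/(c r g); apply: tmap_fuse => //= k {}g {}r.
case: k => // _; apply: eq_sub => //= n; rewrite ?upi_comp //; try by_sort tren_up.
by case: n => //= n; by_sort tren_up.
Qed.

Definition ren_after_sub r s : sub :=
  Sub (icomp (ri r) (si s)) (tren r \o st s) (tren (rup ST r) \o sf s)
      (tren (rup SI r) \o sh s).

Lemma up_ren_after_sub k r s :
  ren_after_sub (rup k r) (up k s) = up k (ren_after_sub r s).
Proof.
case: k; apply: eq_sub => //= n; rewrite ?upi_comp //.
all: try by_sort tren_up; try by_sort2 tren_up2.
all: try by_upC tren_upC.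
all: by case: n => //= n; first [by_sort tren_up | by_upC tren_upC].
Qed.

Lemma tsub1_twk k g T : sub_after_ren g (shift L k) = sid -> tsub g (twk k T) = T.
Proof. by rewrite /twk tsub_tren => ->; exact: tsub_id. Qed.

Lemma tren_tinst1 r Z T :
  tren r (tinst (Tsb IVar (scons Z TVar)) T)
  = tinst (Tsb IVar (scons (tren r Z) TVar)) (tren (rup ST r) T).
Proof.
rewrite tren_tinst tinst_sub tsub_tren; congr tsub.
by apply: eq_sub => //= -[|n] //=; rewrite /icomp /= ?isub_id.
Qed.

Lemma tren_tinst1I r t T :
  tren r (tinst (Tsb (scons t IVar) TVar) T)
  = tinst (Tsb (scons (isub (ri r) t) IVar) TVar) (tren (rup SI r) T).
Proof.
rewrite tren_tinst tinst_sub tsub_tren; congr tsub.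
by apply: eq_sub => //= -[|n] //=; rewrite /icomp /= ?isub_comp ?isub_id.
Qed.

Lemma tren_tsub r s T : tren r (tsub s T) = tsub (ren_after_sub r s) T.
Proof.
apply: tmap_fuse => //= [k x y _|x y n U|x y n t].
- exact: up_ren_after_sub.
- exact: tren_tinst1.
- exact: tren_tinst1I.
Qed.

Lemma up_after_shift k s : sub_after_ren (up k s) (shift L k) = ren_after_sub (shift L k) s.
Proof.
case: k; apply: eq_sub => //= n; rewrite /icomp /= ?isub_id //.
all: by congr tren; apply: eq_ren => //= -[].
Qed.

Lemma tsub_up k s T : tsub (up k s) (twk k T) = twk k (tsub s T).
Proof. by rewrite /twk tsub_tren tren_tsub up_after_shift. Qed.

Lemma tsub_up2 j k s T :
  tsub (up j (up k s)) (tren (rup j (shift L k)) T)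
  = tren (rup j (shift L k)) (tsub (up j s) T).
Proof.
by rewrite tsub_tren tren_tsub up_sub_after_ren up_after_shift -up_ren_after_sub.
Qed.

Lemma tsub_upC j k s T : j <> k ->
  tsub (up j (up k s)) (twk k T) = twk k (tsub (up j s) T).
Proof. by move=> Hjk; rewrite up_upC // tsub_up. Qed.

Definition sub_after_tsb s (g : tsb Lam) : sub :=
  Sub (icomp (si s) (ti g)) (tsub s \o tt g) (sf s) (sh s).

Lemma tsub_tinst s g T : tsub s (tinst g T) = tsub (sub_after_tsb s g) T.
Proof.
apply: tmap_fuse => //= k {}g {}s.
case: k => // _; apply: eq_sub => //= n; rewrite ?upi_comp //; try by_sort tsub_up.
by case: n => //= n; by_sort tsub_up.
Qed.

Lemma sub_tsb_up k g : term_sort k -> sub_tsb (tup k g) = up k (sub_tsb g).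
Proof. by case: k => // _; apply: eq_sub => //=; case. Qed.

Lemma tinst_up k (g : tsb Lam) T : term_sort k -> tinst (tup k g) (twk k T) = twk k (tinst g T).
Proof. by move=> Hk; rewrite !tinst_sub sub_tsb_up // tsub_up. Qed.

Lemma tinst_up2 j k g T : term_sort j -> term_sort k ->
  tinst (tup j (tup k g)) (tren (rup j (shift L k)) T)
  = tren (rup j (shift L k)) (tinst (tup j g) T).
Proof. by move=> Hj Hk; rewrite !tinst_sub !sub_tsb_up // tsub_up2. Qed.

Lemma tinst_upC j k g T : term_sort j -> term_sort k -> j <> k ->
  tinst (tup j (tup k g)) (twk k T) = twk k (tinst (tup j g) T).
Proof. by move=> Hj Hk Hjk; rewrite !tinst_sub !sub_tsb_up // tsub_upC. Qed.

Definition tsb_after_sub (g : tsb Lam) s : sub :=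
  Sub (icomp (ti g) (si s)) (tinst g \o st s) (tinst (tup ST g) \o sf s)
      (tinst (tup SI g) \o sh s).

Lemma tsub_tinst1 s Z T :
  tsub s (tinst (Tsb IVar (scons Z TVar)) T)
  = tsub (Sub (si s) (scons (tsub s Z) (st s)) (sf s) (sh s)) T.
Proof. by rewrite tsub_tinst; congr tsub; apply: eq_sub => //=; case. Qed.

Lemma tsub_tinst1I s t T :
  tsub s (tinst (Tsb (scons t IVar) TVar) T)
  = tsub (Sub (scons (isub (si s) t) (si s)) (st s) (sf s) (sh s)) T.
Proof. by rewrite tsub_tinst; congr tsub; apply: eq_sub => //=; case. Qed.

Lemma tinst1_twk Z T : tinst (Tsb IVar (scons Z TVar)) (twk ST T) = T.
Proof. by rewrite tinst_sub tsub1_twk. Qed.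

Lemma tinst1I_twk t T : tinst (Tsb (scons t IVar) TVar) (twk SI T) = T.
Proof. by rewrite tinst_sub tsub1_twk. Qed.

Lemma tinst_tsub (g : tsb Lam) s T : tinst g (tsub s T) = tsub (tsb_after_sub g s) T.
Proof.
have tinst_up_ k (h : tsb Lam) U := @tinst_up k h U.
have tinst_upC_ j k (h : tsb Lam) U Hjk Hj Hk := @tinst_upC j k h U Hj Hk Hjk.
have tinst_up2_ j k (h : tsb Lam) U := @tinst_up2 j k h U.
apply: tmap_fuse => //= [k {}s {}g Hk|{}s {}g n Z|{}s {}g n t].
- case: k Hk => // _; apply: eq_sub => //= n; rewrite ?upi_comp //.
  all: try by_sort tinst_up_; try by_sort2 tinst_up2_; try by_upC tinst_upC_.
  by case: n => //= n; by_sort tinst_up_.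
- rewrite [LHS]tinst_sub [RHS]tinst_sub !tsub_tinst; congr tsub.
  by apply: eq_sub => //= -[|m] //=; rewrite /icomp /= ?isub_id -?tinst_sub // tinst1_twk.
- rewrite [LHS]tinst_sub [RHS]tinst_sub !tsub_tinst; congr tsub.
  apply: eq_sub => //= -[|m] //=; rewrite /icomp /= -?tinst_sub ?isub_comp ?isub_id //.
  all: by rewrite tinst1I_twk.
Qed.

Definition scomp s s' : sub :=
  Sub (icomp (si s) (si s')) (tsub s \o st s') (tsub (up ST s) \o sf s')
      (tsub (up SI s) \o sh s').

Lemma up_scomp k s s' : scomp (up k s) (up k s') = up k (scomp s s').
Proof.
case: k; apply: eq_sub => //= n; rewrite ?upi_comp //.
all: try by_sort tsub_up; try by_sort2 tsub_up2; try by_upC tsub_upC.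
all: by case: n => //= n; first [by_sort tsub_up | by_upC tsub_upC].
Qed.

(** The functional-variable case of [tsub_comp]: the instantiation performed at f_n(Z) commutes with
    a later substitution. *)
Lemma tsub_tinst_up s Z T :
  tsub s (tinst (Tsb IVar (scons Z TVar)) T)
  = tinst (Tsb IVar (scons (tsub s Z) TVar)) (tsub (up ST s) T).
Proof.
rewrite tsub_tinst1 tinst_tsub; congr tsub; apply: eq_sub => m.
- by rewrite /= /icomp isub_id.
- by case: m => //= m; rewrite tinst1_twk.
- rewrite /= tinst_sub tsub_tren -[LHS]tsub_id; congr tsub.
  by apply: eq_sub => //= -[].
- rewrite /= -[LHS]tsub_id tinst_sub tsub_tren; congr tsub.
  by apply: eq_sub => //= -[].
Qed.

Lemma tsub_tinst_upI s t T :
  tsub s (tinst (Tsb (scons t IVar) TVar) T)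
  = tinst (Tsb (scons (isub (si s) t) IVar) TVar) (tsub (up SI s) T).
Proof.
rewrite tsub_tinst1I tinst_tsub; congr tsub; apply: eq_sub => m.
- by case: m => //= m; rewrite /icomp /= ?isub_comp ?isub_id.
- by rewrite /= tinst1I_twk.
- rewrite /= -[LHS]tsub_id tinst_sub tsub_tren; congr tsub.
  by apply: eq_sub => //= -[].
- rewrite /= -[LHS]tsub_id tinst_sub tsub_tren; congr tsub.
  by apply: eq_sub => //= -[].
Qed.

Lemma tsub_comp s s' T : tsub s (tsub s' T) = tsub (scomp s s') T.
Proof.
apply: tmap_fuse => [k x y _|||x y n Z|x y n t] //.
- exact: up_scomp.
- exact: tsub_tinst_up.
- exact: tsub_tinst_upI.
Qed.

Lemma ksub_comp s s' (k : kind L) :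
  ksub (si s) (ksub (si s') k) = ksub (icomp (si s) (si s')) k.
Proof. by case: k => [|a|[d|] b|b] //=; rewrite ?fsub_comp ?upi_comp. Qed.

Lemma sort_of_sub g (k : kind L) : sort_of (ksub g k) = sort_of k.
Proof. by case: k. Qed.

Lemma gsub_comp s s' (A : gform Lam) : gsub s (gsub s' A) = gsub (scomp s s') A.
Proof.
elim: A s s' => [T a|T U||A IHA B IHB|A IHA B IHB|A IHA B IHB|k A IH|k A IH] s s' /=;
  rewrite ?tsub_comp ?fsub_comp ?IHA ?IHB // IH ksub_comp sort_of_sub.
all: by rewrite up_scomp.
Qed.

Lemma ksub_id (k : kind L) : ksub IVar k = k.
Proof. by case: k => [|a|[d|] b|b] //=; rewrite ?upi_id ?fsub_id. Qed.

Lemma gsub_id (A : gform Lam) : gsub sid A = A.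
Proof.
by elim: A => [T a|T U||A IHA B IHB|A IHA B IHB|A IHA B IHB|k A IH|k A IH];
  rewrite /= ?tsub_id ?fsub_id ?IHA ?IHB // up_sid ksub_id IH.
Qed.

(** The measure reads only the types and the logical skeleton. Terms put for variables do not enter
    it, and replacing individual variables in a type keeps its complexity; so contractions may
    substitute any terms. *)
Lemma mu_sub s (A : gform Lam) : mu (gsub s A) = mu A.
Proof.
rewrite /mu; elim: A s => [T a|T U||A IHA B IHB|A IHA B IHB|A IHA B IHB|k A IH|k A IH] s //=.
- by rewrite k1_sub.
all: first [by case: (IH (up (sort_of k) s)) => -> ->
           | by case: (IHA s) (IHB s) => -> -> [-> ->]].
Qed.

End TermSubstitution.

(** * Substitution preserves types *)

Section Typing.
Variables (L : fol) (S : atsys L) (Lam : glang L).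
Notation term := (term Lam).
Notation sub := (sub Lam).
Notation TVar := (TVar Lam).
Notation Th := (Th Lam).
Notation sid := (sid Lam).
Notation sub_ren := (sub_ren Lam).
Notation has_ty := (has_ty S).
Implicit Types (T U Z : term) (s : sub) (r : ren L) (E : env L).

Definition kup (k : kind L) (g : nat -> iterm L) := if k is KI then upi g else g.
(** A sequence of kinds is a telescope: individual variables bound earlier may occur in the types
    declared later, so the substitution is lifted along the way. *)
Fixpoint ksubs (g : nat -> iterm L) (ks : seq (kind L)) :=
  if ks is k :: ks' then ksub g k :: ksubs (kup k g) ks' else [::].

Lemma ksubs_cat g ks ks' :
  ksubs g (ks ++ ks') = ksubs g ks ++ ksubs (foldl (fun h k => kup k h) g ks) ks'.
Proof. by elim: ks g => //= k ks IH g; rewrite IH. Qed.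

Lemma foldl_kup g n (l : seq (form L)) :
  foldl (fun h k => kup k h) g (nseq n (KI L) ++ map (@KT L) l) = iter n (@upi L) g.
Proof.
rewrite foldl_cat; have -> : forall h, foldl (fun h k => kup k h) h (map (@KT L) l) = h.
  by elim: l.
by elim: n g => //= n IH g; rewrite IH -iterSr.
Qed.

Lemma ksubs_nseq g n : ksubs g (nseq n (KI L)) = nseq n (KI L).
Proof. by elim: n g => //= n IH g; rewrite IH. Qed.

Lemma okinds_sub n g (ty : optype L n) i :
  okinds (osub g ty) i = ksubs g (okinds ty i).
Proof.
rewrite /okinds ksubs_cat ksubs_nseq /=; congr cat.
have := foldl_kup g (obi ty i) [::]; rewrite /= cats0 => ->.
by elim: (obt ty i) => //= a l ->.
Qed.

Lemma sort_okinds n (ty : optype L n) i : map (@sort_of L) (okinds ty i) = osorts ty i.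
Proof.
rewrite map_cat map_nseq -map_comp; congr cat.
by elim: (obt ty i) => //= a l ->.
Qed.

Lemma sort_ksubs g ks : map (@sort_of L) (ksubs g ks) = map (@sort_of L) ks.
Proof. by elim: ks g => //= k ks IH g; rewrite sort_of_sub IH. Qed.

(** One typing induction for renaming, instantiation and full substitution; [P E E' x] expresses
    that [x] is well-typed from [E] to [E']. *)
Lemma tmap_ty X (K : traversal Lam X) (P : env L -> env L -> X -> Prop) :
  (forall x, tr_i K (tr_up K SI x) = upi (tr_i K x)) ->
  (forall x, tr_i K (tr_up K ST x) = tr_i K x) ->
  (forall E E' x, P E E' x -> P (ext E (KI L)) (ext E' (KI L)) (tr_up K SI x)) ->
  (forall E E' x a, P E E' x ->
     P (ext E (KT a)) (ext E' (KT (fsub (tr_i K x) a))) (tr_up K ST x)) ->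
  (forall E E' x n, P E E' x -> has_ty E' (tr_v K x n) (fsub (tr_i K x) (eT E n))) ->
  (forall E E' x n Z a, P E E' x -> has_ty E' Z (fsub (tr_i K x) a) ->
     (if (eF E n).1 is Some d then a = d else True) ->
     has_ty E' (tr_f K x n Z) (fsub (tr_i K x) (eF E n).2)) ->
  (forall E E' x n t, P E E' x ->
     has_ty E' (tr_h K x n t) (finst t (fsub (upi (tr_i K x)) (eH E n)))) ->
  forall E T a, has_ty E T a -> forall E' x, P E E' x ->
  has_ty E' (tmap K x T) (fsub (tr_i K x) a).
Proof.
move=> iI iT PI PT Hv Hf Hh E T a.
elim=> {E T a} [E n|E d Hd|E T U a b _ IHT _ IHU|E a a1 a2 T Ha _ IH|E a b T _ IH
  |E a T _ IH|E a t T _ IH|E F ty Ts Hty _ IH|E n Z a _ IH Ha|E n t] E' x HP //=.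
- exact: Hv.
- by rewrite (sconcl_sub _ Hd); exact: ty_cst.
- by apply: ty_and; [exact: IHT | exact: IHU].
- apply: ty_or; last exact: IH.
  by case: Ha => ->; [left | right].
- apply: ty_imp; rewrite -[in fsub _ b]iT; apply: IH; exact: PT.
- apply: ty_all; rewrite -iI; apply: IH; exact: PI.
- by rewrite fsub_finst; apply: ty_ex; rewrite -fsub_finst; exact: IH.
- apply: ty_op (olang_sub _ Hty) _ => i.
  rewrite okinds_sub /= -sort_okinds.
  (* Both [P] and the underlying individual substitution are followed along the telescope bound in
     the [i]-th argument. *)
  have HK : forall ks E E' x, all (fun k => term_sort (sort_of k)) ks -> P E E' x ->
      P (exts E ks) (exts E' (ksubs (tr_i K x) ks))
        (foldl (fun y k => tr_up K k y) x (map (@sort_of L) ks)).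
    elim=> //= k ks IHk E1 E2 y /andP[Hk Hks] Hy.
    have -> : kup k (tr_i K y) = tr_i K (tr_up K (sort_of k) y).
      by case: k Hk => //= *; rewrite ?iI ?iT.
    by apply: IHk => //; case: k Hk => [|b|d b|b] //= _; [exact: PI | exact: PT].
  have HI : forall ks x, all (fun k => term_sort (sort_of k)) ks ->
      tr_i K (foldl (fun y k => tr_up K k y) x (map (@sort_of L) ks))
      = foldl (fun h k => kup k h) (tr_i K x) ks.
    elim=> //= k ks IHk y /andP[Hk Hks]; rewrite IHk //.
    by case: k Hk => //= *; rewrite ?iI ?iT.
  have Hall : all (fun k => term_sort (sort_of k)) (okinds ty i).
    by rewrite all_cat all_nseq orbT /=; elim: (obt ty i).
  rewrite -[iter _ _ _](foldl_kup _ _ (obt ty i)) -HI //.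
  by apply: IH; exact: HK.
- exact: Hf (IH _ _ HP) Ha.
- by rewrite fsub_finst; exact: Hh.
Qed.

Definition wt_ren E E' r :=
  [/\ forall n, eT E' (rt r n) = fsub (ri r) (eT E n),
      forall n, eF E' (rf r n) = (omap (fsub (ri r)) (eF E n).1, fsub (ri r) (eF E n).2) &
      forall n, eH E' (rh r n) = fsub (upi (ri r)) (eH E n)].

Lemma omap_fsub_comp (g g' : nat -> iterm L) d :
  omap (fsub g) (omap (fsub g') d) = omap (fsub (icomp g g')) d.
Proof. by case: d => //= a; rewrite fsub_comp. Qed.

Lemma omap_fsub_id d : omap (@fsub L IVar) d = d.
Proof. by case: d => //= a; rewrite fsub_id. Qed.

Lemma wt_rup E E' r k : wt_ren E E' r -> wt_ren (ext E k) (ext E' (ksub (ri r) k)) (rup (sort_of k) r).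
Proof.
case=> HT HF HH; case: k => [|a|d b|b]; split=> n /=.
- by rewrite HT fsub_fshift.
- by rewrite HF /= !omap_fsub_comp fsub_fshift.
- by rewrite HH fsub_upi_shift.
- by case: n => //= n.
- by [].
- by [].
- by [].
- by case: n => //= n.
- by [].
- by [].
- by [].
- by case: n => //= n.
Qed.

Lemma ty_f_eq E n Z a b : has_ty E Z a -> (if (eF E n).1 is Some d then a = d else True) ->
  b = (eF E n).2 -> has_ty E (Tf n Z) b.
Proof. by move=> HZ Hd ->; exact: ty_f HZ Hd. Qed.

Lemma tren_ty E E' r T a : wt_ren E E' r -> has_ty E T a ->
  has_ty E' (tren r T) (fsub (ri r) a).
Proof.
move=> Hr HT; move: HT E' r Hr; apply: tmap_ty => //=.
- by move=> E1 E2 r; exact: (@wt_rup _ _ _ (KI L)).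
- by move=> E1 E2 r b; exact: (@wt_rup _ _ _ (KT b)).
- by move=> E1 E2 r n [HT _ _]; rewrite -HT; exact: ty_var.
- move=> E1 E2 r n Z b [_ HF _] HZ Hd; apply: ty_f_eq HZ _ _; rewrite HF //=.
  by case: (eF E1 n).1 Hd => //= d ->.
- by move=> E1 E2 r n t [_ _ HH]; rewrite -HH; exact: ty_h.
Qed.

Definition wt_tsb E E' (g : tsb Lam) :=
  [/\ forall n, has_ty E' (tt g n) (fsub (ti g) (eT E n)),
      forall n, eF E' n = (omap (fsub (ti g)) (eF E n).1, fsub (ti g) (eF E n).2) &
      forall n, eH E' n = fsub (upi (ti g)) (eH E n)].

Lemma wt_shift E k : wt_ren E (ext E k) (shift L (sort_of k)).
Proof.
by case: k => [|a|d b|b]; split=> n //=; rewrite ?upi_id ?fsub_id ?omap_fsub_id //; case: (eF E n).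
Qed.

Lemma twk_ty E k T a : has_ty E T a ->
  has_ty (ext E k) (twk (sort_of k) T) (fsub (ri (shift L (sort_of k))) a).
Proof. exact: tren_ty (wt_shift E k). Qed.

Lemma tinst_ty E E' g T a : wt_tsb E E' g -> has_ty E T a ->
  has_ty E' (tinst g T) (fsub (ti g) a).
Proof.
move=> Hr HT; move: HT E' g Hr; apply: tmap_ty => //=.
- move=> E1 E2 g [HT HF HH]; split=> n /=.
  + by rewrite fsub_fshift; exact: (@twk_ty _ (KI L)).
  + by rewrite HF /= !omap_fsub_comp fsub_fshift.
  + by rewrite HH fsub_upi_shift.
- move=> E1 E2 g a1 [HT HF HH]; split=> //= -[|n] /=; first exact: ty_var.
  have := @twk_ty _ (KT (fsub (ti g) a1)) _ _ (HT n).
  by rewrite fsub_id.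
- by move=> E1 E2 g n [].
- move=> E1 E2 r n Z b [_ HF _] HZ Hd; apply: ty_f_eq HZ _ _; rewrite HF //=.
  by case: (eF E1 n).1 Hd => //= d ->.
- by move=> E1 E2 r n t [_ _ HH]; rewrite -HH; exact: ty_h.
Qed.

Lemma fun_ok_ren E E' r d b T : wt_ren E E' r -> fun_ok S E d b T ->
  fun_ok S E' (omap (fsub (ri r)) d) (fsub (ri r) b) (tren (rup ST r) T).
Proof.
move=> Hr; case: d => [a|] /=.
  exact: tren_ty (@wt_rup _ _ _ (KT a) Hr).
case=> [[m -> Hm]|[U -> HU]]; [left | right].
  by exists (rf r m) => //; case: Hr => _ -> _; rewrite Hm.
exists (tren r U); last exact: tren_ty HU.
exact: tren_up.
Qed.

Lemma has_ty_id E T a : has_ty E T (fsub IVar a) -> has_ty E T a.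
Proof. by rewrite fsub_id. Qed.

Lemma fun_ok_var E m d b : eF E m = (d, b) -> fun_ok S E d b (Tf m (TVar 0)).
Proof.
case: d => [a|] Hm /=; last by left; exists m.
by apply: ty_f_eq (ty_var _ _ _ 0) _ _; rewrite /= Hm.
Qed.

Lemma ty_h_eq E n t b : b = finst t (eH E n) -> has_ty E (Th n t) b.
Proof. by move=> ->; exact: ty_h. Qed.

Lemma wt_up E E' s k : wt_sub S E E' s ->
  wt_sub S (ext E k) (ext E' (ksub (si s) k)) (up (sort_of k) s).
Proof.
case=> HT HF HH; case: k => [|a|d b|b]; split=> n /=.
- by rewrite fsub_fshift; exact: (@twk_ty _ (KI L)).
- have := fun_ok_ren (wt_shift E' (KI L)) (HF n); rewrite fsub_fshift /=.
  rewrite !omap_fsub_comp.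
  by congr fun_ok; congr tren; apply: eq_ren => //= -[].
- rewrite fsub_upi_shift.
  exact: tren_ty (@wt_rup _ _ _ (KI L) (wt_shift E' (KI L))) (HH n).
- case: n => [|n] /=; first exact: ty_var.
  by apply: has_ty_id; exact: (@twk_ty _ (KT _)).
- have := fun_ok_ren (wt_shift E' (KT (fsub (si s) a))) (HF n).
  by rewrite /= omap_fsub_id fsub_id.
- have := tren_ty (@wt_rup _ _ _ (KI L) (wt_shift E' (KT (fsub (si s) a)))) (HH n).
  rewrite /= upi_id fsub_id.
  by congr Defs.has_ty; congr tren; apply: eq_ren => //= -[].
- by apply: has_ty_id; exact: (@twk_ty _ (KF _ _)).
- case: n => [|n] /=; first exact: fun_ok_var.
  have := fun_ok_ren (wt_shift E' (KF (omap (fsub (si s)) d) (fsub (si s) b))) (HF n).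
  rewrite /= omap_fsub_id fsub_id.
  by congr fun_ok; congr tren; apply: eq_ren => //= -[].
- have := tren_ty (@wt_rup _ _ _ (KI L) (wt_shift E' (KF (omap (fsub (si s)) d) (fsub (si s) b)))) (HH n).
  rewrite /= upi_id fsub_id.
  by congr Defs.has_ty; congr tren; apply: eq_ren => //= -[].
- by apply: has_ty_id; exact: (@twk_ty _ (KH _)).
- have := fun_ok_ren (wt_shift E' (KH (fsub (upi (si s)) b))) (HF n).
  rewrite /= omap_fsub_id fsub_id.
  by congr fun_ok; congr tren; apply: eq_ren => //= -[].
- case: n => [|n] /=.
    by apply: ty_h_eq; rewrite /= finst_upi_shift.
  have := tren_ty (@wt_rup _ _ _ (KI L) (wt_shift E' (KH (fsub (upi (si s)) b)))) (HH n).
  by rewrite /= upi_id fsub_id.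
Qed.

Lemma wt_tsb1 E a Z : has_ty E Z a -> wt_tsb (ext E (KT a)) E (Tsb IVar (scons Z TVar)).
Proof.
move=> HZ; split=> n /=; rewrite ?upi_id ?fsub_id ?omap_fsub_id //; last by case: (eF E n).
by case: n => //= n; exact: ty_var.
Qed.

Lemma wt_tsb1I E t : wt_tsb (ext E (KI L)) E (Tsb (scons t IVar) TVar).
Proof.
split=> n /=.
- by rewrite [fsub _ _]finst_fshift; exact: ty_var.
- rewrite [fsub _ (fshift _)]finst_fshift omap_fsub_comp.
  by rewrite (_ : icomp _ _ = IVar) // omap_fsub_id; case: (eF E n).
- by rewrite fsub_comp upi_comp (_ : icomp _ _ = IVar) // upi_id fsub_id.
Qed.

Lemma tsub_ty E E' s T a : wt_sub S E E' s -> has_ty E T a ->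
  has_ty E' (tsub s T) (fsub (si s) a).
Proof.
move=> Hs HT; move: HT E' s Hs; apply: tmap_ty => //=.
- by move=> E1 E2 s; exact: (@wt_up _ _ _ (KI L)).
- by move=> E1 E2 s b; exact: (@wt_up _ _ _ (KT b)).
- by move=> E1 E2 s n [].
- move=> E1 E2 s n Z b [_ HF _] HZ Hd; move: (HF n); case: (eF E1 n) Hd => -[d|] c /=.
    by move=> <- Hc; have := tinst_ty (wt_tsb1 HZ) Hc; rewrite fsub_id.
  (* Without a declared domain, [Z] has an arbitrary type. Either the entry is again a functional
     variable without domain, or it is a weakened term, in which [Z] disappears. *)
  move=> _ [[m -> Hm]|[U -> HU]].
    by apply: ty_f_eq HZ _ _; rewrite Hm.
  by rewrite tinst1_twk.
- by move=> E1 E2 s n t [_ _ HH]; exact: tinst_ty (wt_tsb1I _ _) (HH n).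
Qed.

(** Eta law for the entries of a full substitution: below the binder of a typed-variable xi, the
    image of f_n(xi) is the entry for f_n itself. *)
Lemma tinst_var_up T :
  tinst (Tsb IVar (scons (TVar 0) TVar)) (tren (rup ST (shift L ST)) T) = T.
Proof.
rewrite tinst_sub tsub_tren -[RHS]tsub_id; congr tsub.
by apply: eq_sub => //= -[].
Qed.

Lemma tinst_var_upI T :
  tinst (Tsb (scons (IVar 0) IVar) TVar) (tren (rup SI (shift L SI)) T) = T.
Proof.
rewrite tinst_sub tsub_tren -[RHS]tsub_id; congr tsub.
by apply: eq_sub => //= -[].
Qed.

Lemma fun_ok_sub E E' s d b T : wt_sub S E E' s -> fun_ok S E d b T ->
  fun_ok S E' (omap (fsub (si s)) d) (fsub (si s) b) (tsub (up ST s) T).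
Proof.
move=> Hs; case: d => [a|] /=.
  exact: tsub_ty (@wt_up _ _ _ (KT a) Hs).
case=> [[m -> Hm]|[U -> HU]]; last first.
  right; exists (tsub s U); last exact: tsub_ty HU.
  exact: tsub_up.
case: Hs => _ /(_ m); rewrite Hm /= => HF _.
by move: HF; rewrite -{1 2}[sf s m]tinst_var_up.
Qed.

Lemma wt_scomp E E' E'' s s' : wt_sub S E E' s' -> wt_sub S E' E'' s ->
  wt_sub S E E'' (scomp s s').
Proof.
move=> [HT HF HH] Hs; split=> n /=.
- by rewrite -fsub_comp; exact: tsub_ty Hs (HT n).
- by have := fun_ok_sub Hs (HF n); rewrite omap_fsub_comp fsub_comp.
- rewrite -upi_comp -fsub_comp; exact: tsub_ty (@wt_up _ _ _ (KI L) Hs) (HH n).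
Qed.

Lemma wf_sub E E' s (A : gform Lam) : wt_sub S E E' s -> wf S E A -> wf S E' (gsub s A).
Proof.
elim: A E E' s => [T a|T U||A IHA B IHB|A IHA B IHB|A IHA B IHB|k A IH|k A IH] E E' s Hs //=.
- exact: tsub_ty.
- by case=> a HT HU; exists (fsub (si s) a); exact: tsub_ty Hs _.
- by case=> HA HB; split; [exact: IHA HA | exact: IHB HB].
- by case=> HA HB; split; [exact: IHA HA | exact: IHB HB].
- by case=> HA HB; split; [exact: IHA HA | exact: IHB HB].
- case=> Hk HA; split; first by case: k Hk {HA} => // -[].
  by apply: IH HA; exact: wt_up.
- case=> Hk HA; split; first by case: k Hk {HA} => // -[].
  by apply: IH HA; exact: wt_up.
Qed.

Lemma wt_ups E E' s ks : wt_sub S E E' s ->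
  wt_sub S (exts E ks) (exts E' (ksubs (si s) ks)) (ups (map (@sort_of L) ks) s).
Proof.
elim: ks E E' s => //= k ks IH E E' s Hs.
have -> : kup k (si s) = si (up (sort_of k) s) by case: k.
by apply: IH; exact: wt_up.
Qed.

Lemma wt_sub_ren E E' r : wt_ren E E' r -> wt_sub S E E' (sub_ren r).
Proof.
case=> HT HF HH; split=> n /=.
- by rewrite -HT; exact: ty_var.
- by apply: fun_ok_var; rewrite HF.
- by apply: ty_h_eq; rewrite /= HH finst_upi_shift.
Qed.

Lemma wt_wk E k : wt_sub S E (ext E k) (wk Lam (sort_of k)).
Proof. exact: wt_sub_ren (wt_shift E k). Qed.

Lemma wt_sid E : wt_sub S E E sid.
Proof.
apply: wt_sub_ren; split=> n /=; rewrite ?upi_id ?fsub_id ?omap_fsub_id //.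
by case: (eF E n).
Qed.

Lemma wt_inst E (i : inst Lam) k : inst_ok S E i k -> wt_sub S (ext E k) E (sub_inst i).
Proof.
have [HT HF HH] := wt_sid E.
case: i k => [t|U|U|U] [|a|d b|b] //=.
- move=> _; split=> n /=.
  + by rewrite [fsub _ _]finst_fshift; exact: ty_var.
  + rewrite [fsub _ (fshift _)]finst_fshift omap_fsub_comp (_ : icomp _ _ = IVar) //.
    by have := HF n; rewrite /= fsub_id.
  + by rewrite fsub_comp upi_comp (_ : icomp _ _ = IVar) //; exact: HH.
- move=> HU; split=> //= -[|n] /=; last exact: HT.
  by rewrite fsub_id.
- case: d => // HU; split=> //= -[|n] /=; last exact: HF.
  by right; exists U => //; rewrite fsub_id.
- move=> HU; split=> //= -[|n] /=; last exact: HH.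
  by rewrite upi_id fsub_id.
Qed.

End Typing.

(** * Rules under substitution *)

Section RuleSubstitution.
Variables (L : fol) (S : atsys L) (Lam : glang L).
Notation term := (term Lam).
Notation sub := (sub Lam).
Notation gform := (gform Lam).
Notation TVar := (TVar Lam).
Notation Th := (Th Lam).
Notation sid := (sid Lam).
Notation sub_ren := (sub_ren Lam).
Implicit Types (T U Z : term) (s : sub) (r : ren L) (E : env L) (A B : gform).

Local Arguments up : simpl never.
Local Arguments sub_inst : simpl never.
Local Arguments shift : simpl never.
Local Arguments rup : simpl never.
Local Arguments twk : simpl never.

Lemma up_sub_ren k r : up k (sub_ren r) = sub_ren (rup k r).
Proof. by case: k; apply: eq_sub => //= -[]. Qed.

Lemma scomp_ren s r : scomp s (sub_ren r) = sub_after_ren s r.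
Proof.
by apply: eq_sub => //= n; [exact: tinst_var_up | exact: tinst_var_upI].
Qed.

Lemma ren_scomp r s : scomp (sub_ren r) s = ren_after_sub r s.
Proof.
by apply: eq_sub => n; rewrite /comp /= ?up_sub_ren -?tren_sub.
Qed.

Lemma gsub_wk k s A : gsub (up k s) (gsub (wk Lam k) A) = gsub (wk Lam k) (gsub s A).
Proof. by rewrite !gsub_comp scomp_ren ren_scomp up_after_shift. Qed.

Lemma gwks_sub ks s A : gsub (ups ks s) (gwks ks A) = gwks ks (gsub s A).
Proof. by elim: ks s A => //= k ks IH s A; rewrite IH gsub_wk. Qed.

Lemma mu_gwks ks A : mu (gwks ks A) = mu A.
Proof. by elim: ks A => //= k ks IH A; rewrite IH mu_sub. Qed.

Definition inst_sort (i : inst Lam) : Defs.sort :=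
  match i with InstI _ => SI | InstT _ => ST | InstF _ => SF | InstH _ => SH end.

Lemma inst_ok_sort E (i : inst Lam) k : inst_ok S E i k -> sort_of k = inst_sort i.
Proof. by case: i k => [t|U|U|U] [|a|[d|] b|b]. Qed.

Lemma up_sub_after_shift i j :
  sub_after_ren (up j (sub_inst i)) (rup j (shift L (inst_sort i))) = sid.
Proof.
rewrite up_sub_after_ren -[RHS](up_sid Lam j); congr up.
by case: i => *; apply: eq_sub => //= -[].
Qed.

(** The substitution lemma that makes the quantifier rules, and the converse rules for the binding
    symbols, stable under substitution. *)
Lemma scomp_inst s i :
  scomp s (sub_inst i) = scomp (sub_inst (inst_sub s i)) (up (inst_sort i) s).
Proof.
have H j T : tsub (up j (sub_inst (inst_sub s i))) (tren (rup j (shift L (inst_sort i))) T) = T.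
  have {1}-> : inst_sort i = inst_sort (inst_sub s i) by case: i.
  by rewrite tsub_tren up_sub_after_shift tsub_id.
have H0 T : tsub (sub_inst (inst_sub s i)) (tren (shift L (inst_sort i)) T) = T.
  by apply: tsub1_twk; case: i {H} => *; apply: eq_sub => //= -[].
(* Weakening by one sort does not see a binder of another sort; this brings the mixed entries into
   the form required by [H]. *)
have shC j k T : j <> k -> tren (shift L k) T = tren (rup j (shift L k)) T.
  by move=> Hjk; congr tren; case: j k Hjk => [] [] // _; apply: eq_ren => //= -[].
case: i H H0 => [t|U|U|U] H H0; apply: eq_sub => n.
- by case: n => //= n; rewrite /icomp /= isub_comp isub_id.
- by rewrite /= H0.
- by rewrite /= (@shC ST) // H; exact: tinst_var_up.
- by rewrite /= H; exact: tinst_var_upI.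
- by rewrite /= /icomp /= isub_id.
- by case: n => //= n; rewrite H0.
- by rewrite /= H; exact: tinst_var_up.
- by rewrite /= (@shC SI) // H; exact: tinst_var_upI.
- by rewrite /= /icomp /= isub_id.
- by rewrite /= H0.
- case: n => [|n] /=; last by rewrite (@shC ST) // H; exact: tinst_var_up.
  by rewrite tsub_up [RHS]tinst_var_up.
- by rewrite /= (@shC SI) // H; exact: tinst_var_upI.
- by rewrite /= /icomp /= isub_id.
- by rewrite /= H0.
- by rewrite /= (@shC ST) // H; exact: tinst_var_up.
- case: n => [|n] /=; last by rewrite (@shC SI) // H; exact: tinst_var_upI.
  by rewrite [RHS]tinst_var_upI.
Qed.

Lemma inst_ok_sub E E' s (i : inst Lam) k : wt_sub S E E' s -> inst_ok S E i k ->
  inst_ok S E' (inst_sub s i) (ksub (si s) k).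
Proof.
move=> Hs; case: i k => [t|U|U|U] [|a|[d|] b|b] //=.
- exact: tsub_ty.
- exact: tsub_ty.
- exact: tsub_ty (@wt_up _ _ _ _ _ _ (KI L) Hs).
Qed.

Definition prem_sub s (pr : premise Lam) :=
  let u := ups (map (@sort_of L) (pkinds pr)) s in
  Prem (ksubs (si s) (pkinds pr)) (map (gsub u) (phyps pr)) (gsub u (pconcl pr)).

Variable eqn : env L -> term -> term -> Prop.

Lemma rule_ok_eq E G (r : rule Lam) prs prs' A A' : rule_ok S eqn E G r prs A ->
  prs = prs' -> A = A' -> rule_ok S eqn E G r prs' A'.
Proof. by move=> H <- <-. Qed.

Lemma gwk1_sub k s A : gsub (up k s) (gwks [:: k] A) = gwks [:: k] (gsub s A).
Proof. exact: (gwks_sub [:: k]). Qed.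

Lemma gwk2_sub k k' s A :
  gsub (up k' (up k s)) (gwks [:: k; k'] A) = gwks [:: k; k'] (gsub s A).
Proof. exact: (gwks_sub [:: k; k']). Qed.

(** The rules are schematic in their terms, except for the equations: an instance of an equation is
    derivable, but not necessarily an axiom. *)
Lemma rule_ok_sub E E' G s (r : rule Lam) prs A : wt_sub S E E' s -> r <> REqn Lam ->
  rule_ok S eqn E G r prs A ->
  rule_ok S eqn E' (map (gsub s) G) (rule_sub s r) (map (prem_sub s) prs) (gsub s A).
Proof.
move=> Hs Hr H; case: H Hr => {r prs A}
  [n A H|d H|T U a b|T a a1 a2 H|T a b|T a|T a t|T a b A|T a1 a2 A|T a b A|T a A|T a A
  |T|T|T U|T U V|T U a|T U T' U'|a a1 a2 T T'|a T T'|T T'|a0 a T T'|F ty Ts Ts'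
  |T U T' U'|T U T' U'|a a1 a2 T T'|a T T' Z H|T T' t|a0 a T T'|T Z H
  |A B|A B|A B|A B|A B|A B C|A B|A B|k A|k A i H|k A i H|k A B|A H] /= Hr.
- by apply: ok_ass; rewrite onth_map H.
- by rewrite (sconcl_sub _ H); exact: ok_cst.
- exact: ok_Iand.
- by apply: ok_Ior; case: H => ->; [left | right].
- exact: ok_Iimp.
- exact: ok_Iall.
- have := ok_Iex S eqn E' (map (gsub s) G) (tsub s T) (fsub (upi (si s)) a) (isub (si s) t).
  by rewrite -fsub_finst.
- by apply: rule_ok_eq (ok_Dand _ _ _ _ _ _ _ _) _ _ => //; rewrite /prem_sub /= !tsub_up gwk2_sub.
- by apply: rule_ok_eq (ok_Dor _ _ _ _ _ _ _ _) _ _ => //; rewrite /prem_sub /= !tsub_up !gwk1_sub.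
- by apply: rule_ok_eq (ok_Dimp _ _ _ _ _ _ _ _) _ _ => //; rewrite /prem_sub /= !tsub_up !gwk1_sub.
- by apply: rule_ok_eq (ok_Dall _ _ _ _ _ _ _) _ _ => //; rewrite /prem_sub /= !tsub_up !gwk1_sub.
- apply: rule_ok_eq (ok_Dex S eqn E' _ (tsub s T) (fsub (upi (si s)) a) _) _ _ => //.
  by rewrite /prem_sub /= !tsub_up !gwk2_sub -(fsub_upi_shift (si s) a).
- exact: ok_Dbot.
- exact: ok_refl.
- exact: ok_sym.
- exact: ok_trans.
- exact: ok_pres.
- exact: ok_cong_and.
- exact: ok_cong_or.
- exact: ok_cong_imp.
- exact: ok_cong_all.
- exact: ok_cong_ex.
- have := ok_cong_op S eqn E' (map (gsub s) G) (osub (si s) ty)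
     (fun i => tsub (ups (osorts ty i) s) (Ts i)) (fun i => tsub (ups (osorts ty i) s) (Ts' i)).
  have <- : [seq osorts ty i | i <- enum 'I_(onar F)]
          = [seq osorts (osub (si s) ty) i | i <- enum 'I_(onar F)].
    by apply: eq_map => i; rewrite osorts_sub.
  move=> H; apply: rule_ok_eq H _ _ => //; rewrite -map_comp; apply: eq_map => i.
  by rewrite /prem_sub /= okinds_sub sort_okinds.
- exact: ok_inv_and1.
- exact: ok_inv_and2.
- exact: ok_inv_or.
- apply: rule_ok_eq (ok_inv_imp _ _ _ _ (tsub_ty Hs H)) _ _ => //.
  by rewrite !tsub_comp !scomp_inst.
- by apply: rule_ok_eq (ok_inv_all S eqn E' _ (tsub (up SI s) T) (tsub (up SI s) T')
    (isub (si s) t)) _ _ => //; rewrite !tsub_comp !scomp_inst.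
- exact: ok_inv_ex.
- by [].
- exact: ok_andI.
- exact: ok_andE1.
- exact: ok_andE2.
- exact: ok_orI1.
- exact: ok_orI2.
- exact: ok_orE.
- exact: ok_impI.
- exact: ok_impE.
- have := ok_allI S eqn E' (map (gsub s) G) (ksub (si s) k) (gsub (up (sort_of k) s) A).
  by rewrite sort_of_sub.
- apply: rule_ok_eq (ok_allE _ _ _ (inst_ok_sub Hs H)) _ _ => //.
  by rewrite !gsub_comp scomp_inst (inst_ok_sort H).
- apply: rule_ok_eq (ok_exI _ _ _ (inst_ok_sub Hs H)) _ _ => //.
  by rewrite /prem_sub /= !gsub_comp scomp_inst (inst_ok_sort H).
- have := ok_exE S eqn E' (map (gsub s) G) (ksub (si s) k) (gsub (up (sort_of k) s) A) (gsub s B).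
  by rewrite sort_of_sub /prem_sub /= gwk1_sub.
- by apply: ok_botE; case: A H.
Qed.

(** The operations on raw derivations consult [binds], typing consults the premises; this is the
    link between the two. *)
Lemma rule_ok_binds E G (r : rule Lam) prs A i pr : rule_ok S eqn E G r prs A -> onth prs i = Some pr ->
  binds r i = (map (@sort_of L) (pkinds pr), size (phyps pr)).
Proof.
move=> H; case: H i pr => {r prs A}; try by move=> *; match goal with
  H : onth (_ :: _) ?i = Some _ |- _ => case: i H => [|[|[|i]]] /=; rewrite ?onth0n => // -[<-] end.
all: try by move=> *; match goal with H : onth [::] ?i = Some _ |- _ => rewrite onth0n in H end.
move=> F ty Ts Ts' i pr; rewrite onth_map.
case Hi: (onth (enum _) i) => [j|] //= [<-] /=; rewrite sort_okinds; congr pair.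
by apply: onth_nth; rewrite onth_map Hi.
Qed.

Lemma rule_ok_ctx E G G' (r : rule Lam) prs A :
  (forall n, r = RAss Lam n -> onth G n = Some A -> onth G' n = Some A) ->
  rule_ok S eqn E G r prs A -> rule_ok S eqn E G' r prs A.
Proof.
move=> HG H; case: H HG => {r prs A}; try by move=> *; constructor.
by move=> n A H HG; apply: ok_ass; exact: HG.
Qed.

(** The premise 0 is the major one. Consequently the measure and the principal symbol are constant
    along a segment. *)
Lemma transmits_concl E G (r : rule Lam) prs A i pr :
  rule_ok S eqn E G r prs A -> transmits r -> onth prs i.+1 = Some pr ->
  pconcl pr = gwks (map (@sort_of L) (pkinds pr)) A.
Proof.
move=> H; case: H i pr => {r prs A} // *; match goal with
  H : onth _ _.+1 = Some _ |- _ => move: H end.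
all: by match goal with |- context [onth _ ?i.+1] =>
  case: i => [|[|i]] /=; rewrite ?onth0n => // -[<-] end.
Qed.

End RuleSubstitution.

(** * Derivations with unresolved instances of equations *)

Lemma onth_mapi (X Y : Type) (f : nat -> X -> Y) k s i :
  onth (mapi f k s) i = omap (f (k + i)) (onth s i).
Proof.
elim: s k i => [|x s IH] k [|i] //=; first by rewrite addn0.
by rewrite IH addSnnS.
Qed.

Lemma size_mapi (X Y : Type) (f : nat -> X -> Y) k s : size (mapi f k s) = size s.
Proof. by elim: s k => //= x s IH k; rewrite IH. Qed.

Lemma Forall2_onth (X Y : Type) (R : X -> Y -> Prop) s t :
  List.Forall2 R s t <-> size s = size t /\
    forall i x y, onth s i = Some x -> onth t i = Some y -> R x y.
Proof.
split=> [|[]].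
  elim=> {s t} [|x y s t Hxy _ [Hs IH]]; first by split=> // i x y; rewrite onth0n.
  by split=> [|[|i] x' y' /=]; [rewrite /= Hs | move=> [<-] [<-] | exact: IH].
elim: s t => [|x s IH] [|y t] //= [Hs] H; constructor; first exact: (H 0).
by apply: IH Hs _ => i; exact: (H i.+1).
Qed.

Lemma onth_Some (X Y : Type) (s : seq X) (t : seq Y) i y :
  size s = size t -> onth t i = Some y -> exists x, onth s i = Some x.
Proof.
move=> Hs Hy; have := onthTE t i; rewrite Hy -Hs -onthTE.
by case: onth => // x _; exists x.
Qed.

Lemma map_eq_onth (X Y V : Type) (f : X -> V) (g : Y -> V) l t :
  size l = size t -> (forall i x y, onth l i = Some x -> onth t i = Some y -> f x = g y) ->
  map f l = map g t.
Proof.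
elim: l t => [|x s IH] [|y t] //= [Hs] H.
by rewrite (H 0 x y) // (IH t) // => i; exact: (H i.+1).
Qed.

Section Derivations.
Variables (L : fol) (S : atsys L) (Lam : glang L) (Sigma : gsystem S Lam).
Notation term := (term Lam).
Notation sub := (sub Lam).
Notation gform := (gform Lam).
Notation der := (der Lam).
Notation rule := (rule Lam).
Notation eqn := (geqn Sigma).
Notation TVar := (TVar Lam).
Notation sid := (sid Lam).
Implicit Types (T U Z : term) (s : sub) (E : env L) (A B : gform) (G : seq gform)
  (D : der) (r : rule).

Notation psorts pr := (map (@sort_of L) (pkinds pr)).

(** The leaf [PInst] records an axiom and a substitution, so that a further substitution is absorbed
    by composition. With [b] false this is [deriv]. Premises are indexed rather than related by a
    nested [Forall2], which gives usable induction hypotheses. *)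
Inductive pderiv (b : bool) : env L -> seq gform -> der -> gform -> Prop :=
| PNode E G r A ps prs :
    wf S E A -> rule_ok S eqn E G r prs A -> size ps = size prs ->
    (forall i p pr, onth ps i = Some p -> onth prs i = Some pr ->
       pderiv b (exts E (pkinds pr)) (phyps pr ++ map (gwks (psorts pr)) G)
         p (pconcl pr)) ->
    pderiv b E G (Node r A ps) A
| PInst E0 E s G T Z :
    b -> eqn E0 T Z -> wt_sub S E0 E s ->
    pderiv b E G (Node (RInst Lam) (GEq (tsub s T) (tsub s Z)) [::])
      (GEq (tsub s T) (tsub s Z)).

Fixpoint der_ind' (P : der -> Prop)
  (H : forall r A ps, (forall i p, onth ps i = Some p -> P p) -> P (Node r A ps)) D : P D.
Proof.
case: D => r A ps; apply: (H) => {r A}.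
elim: ps => [|p ps IH] i q; first by rewrite onth0n.
case: i => [|i] /=; last exact: IH.
by case=> <-; exact: (der_ind' P H).
Defined.

Lemma deriv_pderiv E G D A : deriv S eqn E G D A <-> pderiv false E G D A.
Proof.
split.
  elim/der_ind': D E G A => r B ps IH E G A.
  move HD: (Node r B ps) => D H; case: H HD => {}E {}G r' {}A ps' prs HA Hr.
  move=> /Forall2_onth[Hs Hps] [? ? ?]; subst.
  by apply: (PNode HA Hr Hs) => i p pr Hp Hpr; apply: (IH _ _ Hp); exact: Hps Hp Hpr.
elim=> {E G D A} // E G r A ps prs HA Hr Hs _ IH.
by apply: (Deriv HA Hr); apply/Forall2_onth; split.
Qed.

Lemma pderiv_weak b E G D A : pderiv false E G D A -> pderiv b E G D A.
Proof.
by elim=> {E G D A} // E G r A ps prs HA Hr Hs _ IH; exact: PNode HA Hr Hs IH.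
Qed.

Lemma pderiv_concl b E G D A : pderiv b E G D A -> concl D = A.
Proof. by case. Qed.

Lemma pderiv_wf b E G D A : pderiv b E G D A -> wf S E A.
Proof.
case=> // E0 E' s _ T Z _ HTZ Hs.
have [F [ty [Us [_ HT HZ]]]] := geqn_shape HTZ.
by exists (fsub (si s) (ores ty)); exact: tsub_ty Hs _.
Qed.

Lemma pderiv_cat b E G G' D A : pderiv b E G D A -> pderiv b E (G ++ G') D A.
Proof.
move=> H; elim: H G' => {E G D A} [E G r A ps prs HA Hr Hs _ IH|E0 E s G T Z Hb HT Hs] G';
  last exact: PInst HT Hs.
apply: (PNode (prs := prs) HA) Hs _ => [|i p pr Hp Hpr]; last first.
  by rewrite map_cat catA; exact: IH Hp Hpr _.
by apply: rule_ok_ctx Hr => n _; rewrite onth_cat -onthTE => ->.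
Qed.

(** * Recursive computation of cuts and segments *)

Definition is_intro r : bool :=
  match r with
  | RIAnd | RIOr | RIImp | RIAll | RIEx _
  | RAndI | ROrI1 | ROrI2 | RImpI | RAllI _ | RExI _ => true
  | _ => false
  end.

(* [top_]: some segment starting at an introduction reaches the conclusion.
   Cuts are counted here by their last formula, without [matching]; in a derivation
   the shapes of the formulas make the two notions agree ([normal_cutfree]). *)
Record summary := Summary { top_ : bool; mu_ : nat *l nat; cuts_ : seq (nat *l nat) }.

(** All that cuts and segments depend on in a rule. Substitution and renaming may change a rule, but
    not its class, and so preserve summaries. *)
Definition rclass r := (is_intro r, transmits r, eliminates r).

Definition snode (c : bool * bool * bool) (m : nat *l nat) (ss : seq summary) : summary :=
  Summary (c.1.1 || c.1.2 && has top_ (behead ss)) m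
    ((if ss is x :: _ then if c.2 && top_ x then [:: mu_ x] else [::] else [::])
       ++ flatten (map cuts_ ss)).

Fixpoint summ D : summary :=
  let: Node r A ps := D in snode (rclass r) (mu A) (map summ ps).

Notation top D := (top_ (summ D)).
Notation cuts D := (cuts_ (summ D)).

Lemma mu_summ D : mu_ (summ D) = mu (concl D).
Proof. by case: D. Qed.

Lemma summ_dsub s D : summ (dsub s D) = summ D.
Proof.
elim/der_ind': D s => r A ps IH s /=; rewrite mu_sub; congr snode.
  by case: r.
apply: map_eq_onth; first by rewrite size_mapi.
by move=> i x y; rewrite onth_mapi => + Hy; rewrite Hy => -[<-]; exact: IH Hy _.
Qed.

Lemma summ_dwks ks D : summ (dwks ks D) = summ D.
Proof. by elim: ks D => //= k ks IH D; rewrite IH summ_dsub. Qed.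

Lemma summ_dren f D : summ (dren f D) = summ D.
Proof.
elim/der_ind': D f => r A ps IH f.
have H : forall b, map summ (mapi (fun i d => dren (lift (b i) f) d) 0 ps) = map summ ps.
  move=> b; apply: map_eq_onth; first by rewrite size_mapi.
  by move=> i x y; rewrite onth_mapi => + Hy; rewrite Hy => -[<-]; exact: IH Hy _.
by case: r => *; rewrite /= ?H.
Qed.

(** Rules carry terms with function-valued arguments, so no decidable equality is at hand; only the
    constructor is inspected. *)
Lemma REqn_or r : r = REqn Lam \/ r <> REqn Lam.
Proof. by case: r; (by left) || (by right). Qed.

Lemma dsub_ok b E E' G s D A : pderiv b E G D A -> wt_sub S E E' s ->
  pderiv true E' (map (gsub s) G) (dsub s D) (gsub s A).
Proof.
move=> H; elim: H E' s => {E G D A} [E G r A ps prs HA Hr Hs _ IH|E0 E s0 G T Z _ HT Hs0] E' s Hws;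
  last first.
  (* An instance of an instance is an instance of the same axiom. *)
  by rewrite /= !tsub_comp; apply: PInst HT _ => //; exact: wt_scomp Hs0 Hws.
have [Er|nEr] := REqn_or r.
  rewrite {}Er in Hr *; case E1: _ _ _ / Hr Hs {HA IH} => // [T Z HT] /size0nil -> /=.
  exact: PInst HT Hws.
apply: (PNode (wf_sub Hws HA) (rule_ok_sub Hws nEr Hr)).
  by rewrite size_mapi size_map.
move=> i p pr; rewrite onth_mapi onth_map.
case Hp: (onth ps i) => [q|] //= [<-]; case Hpr: (onth prs i) => [pr0|] //= [<-] /=.
have := IH _ _ _ Hp Hpr _ _ (wt_ups (pkinds pr0) Hws).
rewrite (rule_ok_binds Hr Hpr) /= map_cat sort_ksubs -!map_comp.
have E1 : gsub (ups (psorts pr0) s) \o gwks (psorts pr0) =1 gwks (psorts pr0) \o gsub s.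
  by move=> B; exact: gwks_sub.
by rewrite (eq_map E1).
Qed.

Lemma RAss_or r : (exists n, r = RAss Lam n) \/ (forall n, r <> RAss Lam n).
Proof. by case: r; first [by left; eexists | by right]. Qed.

Lemma dren_node f r A ps : (forall n, r <> RAss Lam n) ->
  dren f (Node r A ps) = Node r A (mapi (fun i d => dren (lift (binds r i).2 f) d) 0 ps).
Proof. by case: r => // n /(_ n). Qed.

Lemma dplug_node h r A ps : (forall n, r <> RAss Lam n) ->
  dplug h (Node r A ps)
  = Node r A (mapi (fun i d => dplug (lift_plug (binds r i) h) d) 0 ps).
Proof. by case: r => // n /(_ n). Qed.

Lemma rule_ass_inv E G n prs A : rule_ok S eqn E G (RAss Lam n) prs A ->
  prs = [::] /\ onth G n = Some A.
Proof.
by move E1: (RAss Lam n) => r H; case: H E1 => // k B HB [->].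
Qed.

Lemma dren_ok b E G G' f D A : pderiv b E G D A ->
  (forall n B, onth G n = Some B -> onth G' (f n) = Some B) ->
  pderiv b E G' (dren f D) A.
Proof.
move=> H; elim: H G' f => {E G D A} [E G r A ps prs HA Hr Hs _ IH|E0 E s0 G T Z Hb HT Hs0]
  G' f Hf; last exact: PInst HT Hs0.
have [[n Er]|nEr] := RAss_or r.
  rewrite {}Er in Hr *; have [E1 HG] := rule_ass_inv Hr.
  move: Hs; rewrite E1 => /size0nil -> /=; apply: (PNode (prs := [::])) => //.
  - by apply: ok_ass; exact: Hf.
  - by move=> i p pr; rewrite onth0n.
rewrite dren_node //; apply: (PNode (prs := prs) HA).
- by apply: rule_ok_ctx Hr => n /nEr.
- by rewrite size_mapi.
move=> i p pr; rewrite onth_mapi; case Hp: (onth ps i) => [q|] //= [<-] Hpr.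
apply: (IH _ _ _ Hp Hpr) => n B; rewrite (rule_ok_binds Hr Hpr) /lift /= !onth_cat.
case: ltnP => Hn; first by rewrite Hn.
rewrite [_ + _ < _]ltnNge leq_addr /= addKn !onth_map.
by case HB: (onth G _) => [C|] //= [<-]; rewrite (Hf _ _ HB).
Qed.

Lemma dwks_ok E G ks D A : pderiv true E G D A ->
  pderiv true (exts E ks) (map (gwks (map (@sort_of L) ks)) G)
    (dwks (map (@sort_of L) ks) D) (gwks (map (@sort_of L) ks) A).
Proof.
elim: ks E G D A => [|k ks IH] E G D A H /=; first by rewrite map_id.
have := IH _ _ _ _ (dsub_ok H (wt_wk S Lam E k)).
by rewrite -map_comp.
Qed.

(** * Derivations put on assumptions *)

Definition bounded m D := all (fun x => (x < m)%O) (cuts D).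

Lemma bounded_node m r A ps :
  bounded m (Node r A ps)
  = (if ps is p :: _ then eliminates r && top p ==> (mu (concl p) < m)%O else true)
    && all (bounded m) ps.
Proof.
rewrite /bounded /= all_cat; congr andb.
  by case: ps => //= p ps; rewrite mu_summ; case: (_ && _); rewrite //= andbT.
elim: ps => //= p ps; rewrite all_cat => ->; congr andb.
Qed.

Lemma top_node r A ps : top (Node r A ps) = is_intro r || transmits r && has (fun p => top p) (behead ps).
Proof. by case: ps => //= p ps; rewrite has_map. Qed.

Lemma onth_all (X : Type) (a : pred X) l :
  all a l <-> (forall i x, onth l i = Some x -> a x).
Proof.
split.
  elim: l => [_ i x|x l IH /= /andP[Hx Hl] [|i] y /=]; first by rewrite onth0n.
    by case=> <-.
  exact: IH.
elim: l => //= x l IH H; rewrite (H 0) //=; apply: IH => i; exact: (H i.+1).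
Qed.

Lemma onth_has (X : Type) (a : pred X) l :
  has a l <-> (exists i x, onth l i = Some x /\ a x).
Proof.
split; last first.
  case=> i [x []]; elim: l i => [|y l IH] [|i] //= => [[->] ->|Hi Hx] //.
  by rewrite (IH i) ?orbT.
elim: l => //= x l IH /orP[Hx|/IH[i [y Hy]]]; first by exists 0, x.
by exists i.+1, y.
Qed.

Lemma onth_behead (X : Type) (l : seq X) i : onth (behead l) i = onth l i.+1.
Proof. by case: l => //=; rewrite onth0n. Qed.

(** A derivation put on an assumption may end a segment only if its formula lies below [m]; this is
    what keeps the cuts created by plugging below [m]. *)
Definition plug_ok m E G G' (h : nat -> nat + der) :=
  forall n B, onth G n = Some B ->
  match h n with
  | inl k => onth G' k = Some B
  | inr D => [/\ pderiv true E G' D B, bounded m D & top D -> (mu B < m)%O]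
  end.

(** A segment that is new at some formula occurrence starts inside a plugged derivation and runs
    through its conclusion, of measure [< m]. The measure being constant along segments, this bounds
    both a new cut and a new segment to the conclusion. *)
Lemma dplug_ok m b E G G' h D A : pderiv b E G D A -> plug_ok m E G G' h ->
  [/\ pderiv true E G' (dplug h D) A, bounded m D -> bounded m (dplug h D) &
      top (dplug h D) -> top D \/ (mu A < m)%O].
Proof.
move=> H; elim: H G' h => {E G D A} [E G r A ps prs HA Hr Hs Hps IH|E0 E s0 G T Z Hb HT Hs0]
  G' h Hh; last by split=> //; exact: PInst HT Hs0.
have [[n Er]|nEr] := RAss_or r.
  rewrite {}Er in Hr *; have [E1 HG] := rule_ass_inv Hr.
  move: Hs; rewrite E1 => /size0nil -> /=; move: (Hh _ _ HG).
  case: (h n) => [k Hk|D' [HD Hb Ht]]; last by split=> // /Ht; right.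
  split=> //; apply: (PNode (prs := [::])) => //.
  - by apply: ok_ass.
  - by move=> i p pr; rewrite onth0n.
rewrite dplug_node //; set qs := mapi _ _ _.
have Hq i q pr : onth qs i = Some q -> onth prs i = Some pr -> exists2 p, onth ps i = Some p &
  [/\ concl p = pconcl pr,
    pderiv true (exts E (pkinds pr)) (phyps pr ++ map (gwks (psorts pr)) G') q (pconcl pr),
    bounded m p -> bounded m q & top q -> top p \/ (mu (pconcl pr) < m)%O].
  rewrite /qs onth_mapi; case Hp: (onth ps i) => [p|] //= [<-] Hpr; exists p => //.
  suff [? ? ?] : [/\ pderiv true (exts E (pkinds pr)) (phyps pr ++ map (gwks (psorts pr)) G')
      (dplug (lift_plug (binds r i) h) p) (pconcl pr), bounded m p ->
      bounded m (dplug (lift_plug (binds r i) h) p) &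
      top (dplug (lift_plug (binds r i) h) p) -> top p \/ (mu (pconcl pr) < m)%O].
    by split=> //; exact: pderiv_concl (Hps _ _ _ Hp Hpr).
  (* [plug_ok] below the rule: discharged assumptions stay, and the plugged derivations are
     weakened, which changes neither their summaries nor the measures of their conclusions. *)
  apply: (IH _ _ _ Hp Hpr) => n B; rewrite (rule_ok_binds Hr Hpr) /lift_plug /= onth_cat.
  case: ifP => Hn; first by rewrite onth_cat Hn.
  rewrite onth_map; case HB: (onth G _) => [C|] //= [<-].
  move: (Hh _ _ HB); case: (h _) => [k Hk|D' [HD Hb Ht]].
    by rewrite onth_cat [_ + _ < _]ltnNge leq_addr /= addKn onth_map Hk.
  split.
  - apply: dren_ok (dwks_ok (pkinds pr) HD) _ => j B' HB'.
    by rewrite onth_cat [_ + _ < _]ltnNge leq_addr /= addKn.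
  - by rewrite /bounded summ_dren summ_dwks.
  - by rewrite summ_dren summ_dwks mu_gwks.
have Hqs : size qs = size prs by rewrite size_mapi.
have Hqs' i q : onth qs i = Some q -> exists pr, onth prs i = Some pr.
  by move=> Hi; exact: (onth_Some (esym Hqs) Hi).
split.
- apply: PNode HA _ Hqs _; first by apply: rule_ok_ctx Hr => n /nEr.
  by move=> i q pr Hi /(Hq _ _ _ Hi)[p _ []].
- rewrite !bounded_node => /andP[Hmaj /onth_all Hb]; apply/andP; split.
    case Eq : qs (Hq 0) (Hqs' 0) => [|q qs'] //= Hq0 /(_ _ erefl)[pr Hpr].
    have [p Hp [Hcp Hdq _ Ht]] := Hq0 _ _ erefl Hpr.
    apply/implyP => /andP[Hel /Ht Htp]; rewrite (pderiv_concl Hdq).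
    (* Either the segment is new and has measure [< m], or the cut was already present at this
       node. *)
    case: Htp => // Htp; case: ps Hp Hmaj {IH Hs Hb Hps qs Hq Hqs Hqs' Eq Hq0} => //= p' ps' [->].
    by rewrite Hel Htp /= Hcp.
  apply/onth_all => i q Hi; have [pr Hpr] := Hqs' _ _ Hi.
  by have [p Hp [_ _ Hbp _]] := Hq _ _ _ Hi Hpr; apply: Hbp; exact: Hb Hp.
- rewrite !top_node; case: (is_intro r) => /=; first by left.
  case Htr: (transmits r) => //= /onth_has[i [q]].
  rewrite onth_behead; case=> Hi Htq.
  have [pr Hpr] := Hqs' _ _ Hi; have [p Hp [_ _ _ Ht]] := Hq _ _ _ Hi Hpr.
  case: (Ht Htq) => [Htp|]; last by rewrite (transmits_concl Hr Htr Hpr) mu_gwks; right.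
  by left; apply/onth_has; exists i, p; rewrite onth_behead.
Qed.

End Derivations.

(** * Cut-segments *)

Section CutSegments.
Variables (L : fol) (S : atsys L) (Lam : glang L) (Sigma : gsystem S Lam).
Notation gform := (gform Lam).
Notation der := (der Lam).
Notation rule := (rule Lam).
Notation eqn := (geqn Sigma).
Notation pderiv := (pderiv Sigma).
Notation top D := (top_ (summ D)).
Notation cuts D := (cuts_ (summ D)).
Notation psorts pr := (map (@sort_of L) (pkinds pr)).
Implicit Types (E : env L) (A B : gform) (G : seq gform) (D : der) (r : rule) (p q : seq nat).

Lemma sub_at_rcons q i D :
  sub_at (rcons q i) D = obind (fun d : der => let: Node _ _ ps := d in onth ps i) (sub_at q D).
Proof.
elim: q D => [|j q IH] [r A ps] /=; first by case: (onth ps i).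
by case: (onth ps j).
Qed.

Lemma mem_positions q D d : sub_at q D = Some d -> q \in positions D.
Proof.
elim/der_ind': D q => r A ps IH [|i q] //= Hd; rewrite inE //=.
have H l : forall k j, (forall j e, onth l j = Some e -> forall q, sub_at q e = Some d ->
    q \in positions e) -> obind (sub_at q) (onth l j) = Some d ->
  j + k :: q \in flatten (mapi (fun i0 e => [seq i0 :: p | p <- positions e]) k l).
  elim: l => [|e l IHl] k [|j] //= {}IH {}Hd; rewrite mem_cat.
    by apply/orP; left; apply: map_f; exact: (IH 0) Hd.
  apply/orP; right; rewrite addSnnS; apply: IHl => //.
  by move=> j'; exact: (IH j'.+1).
by have := H ps 0 i IH Hd; rewrite addn0.
Qed.

Lemma parent_rcons q i : parent (rcons q i) = q.
Proof. by rewrite /parent size_rcons -cats1 take_size_cat. Qed.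

Lemma rcons_parent q : q != [::] -> q = rcons (parent q) (last 0 q).
Proof. by case/lastP: q => // q i _; rewrite last_rcons parent_rcons. Qed.

Lemma cut_node r A ps : cuts (Node r A ps) = [::] <->
  (forall e, onth ps 0 = Some e -> ~~ (eliminates r && top e)) /\
  (forall i e, onth ps i = Some e -> cuts e = [::]).
Proof.
rewrite /=; split.
  move/eqP; rewrite -size_eq0 size_cat addn_eq0 !size_eq0 => /andP[/eqP H1 /eqP H2]; split.
    by case: ps H1 {H2} => //= e ps + _ [<-]; case: (_ && _).
  elim: ps {H1} H2 => [|e ps IH] H2 i e'; first by rewrite onth0n.
  move: H2 => /= /eqP; rewrite -size_eq0 size_cat addn_eq0 !size_eq0 => /andP[/eqP H1 /eqP H2].
  by case: i => [|i] /=; [case=> <- | exact: IH].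
case=> H1 H2; have -> : flatten (map (@cuts_) (map (@summ L Lam) ps)) = [::].
  elim: ps {H1} H2 => //= e ps IH H2; rewrite (H2 0) //= IH // => i; exact: (H2 i.+1).
by case: ps H1 {H2} => //= e ps /(_ _ erefl); case: (_ && _).
Qed.

Lemma cuts_sub q D d : sub_at q D = Some d -> cuts D = [::] -> cuts d = [::].
Proof.
elim: q D => [|i q IH] [r A ps] /=; first by case=> <-.
case Hi: (onth ps i) => [e|] //= Hd /(cut_node r A ps) [_ Hc]; apply: IH Hd _; exact: Hc Hi.
Qed.

Lemma minor_top D p s d : path (minor_of D) p s -> sub_at p D = Some d -> top d ->
  exists2 d', sub_at (last p s) D = Some d' & top d'.
Proof.
elim: s p d => [|q s IH] p d /=; first by exists d.
case/andP=> /and4P[Hp /eqP Hq Hl Hr] Hs Hd Htd; subst q.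
move: Hr; rewrite /label; case Hd': (sub_at (parent p) D) => [[r A ps]|] //= Hr.
apply: (IH _ _ Hs Hd').
rewrite top_node Hr /=; apply/orP; right; apply/onth_has.
move: Hd; rewrite (rcons_parent Hp) sub_at_rcons Hd' /=.
case: (last 0 p) Hl => //= i _ Hi; exists i, d; by rewrite onth_behead.
Qed.

Lemma matching_class r r' : matching r r' -> is_intro r /\ eliminates r'.
Proof. by case: r => //; case: r'. Qed.

(** A matching pair is in particular an introduction and an elimination, and [top_] propagates along
    every path of minor premises. Hence this direction needs no typing. *)
Lemma cutfree_normal D : cuts D = [::] -> normal D.
Proof.
move=> Hc; have Hs : cut_segments D = [::].
  rewrite /cut_segments; elim: [seq traject _ _ _ | _ <- _, _ <- _] => //= s l ->.
  case: ifP => //; case: s => // p s /= /and3P[Hp /andP[Hq Hl]].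
  rewrite /label; case Hd: (sub_at p D) => [[r A ps]|] //=.
  case Hd': (sub_at _ D) => [[r' A' ps']|] //= /matching_class[Hr Hr'].
  have [|e He Hte] := minor_top Hp Hd; first by rewrite top_node Hr.
  have := cuts_sub Hd' Hc; case/cut_node => /(_ e) + _.
  move: He; rewrite (rcons_parent Hq) sub_at_rcons Hd' (eqP Hl) /= => He /(_ He).
  by rewrite Hr' Hte.
by rewrite /normal /degree /max_mu Hs !big_nil.
Qed.

(** * From recursive cuts back to cut-segments *)

Definition head_form A : nat :=
  match A with
  | GTy _ (FAnd _ _) => 1 | GTy _ (FOr _ _) => 2 | GTy _ (FImp _ _) => 3
  | GTy _ (FAll _) => 4 | GTy _ (FEx _) => 5
  | GAnd _ _ => 6 | GOr _ _ => 7 | GImp _ _ => 8 | GAll _ _ => 9 | GEx _ _ => 10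
  | _ => 0
  end.

(** A common code for principal symbols of formulas and of rules, 0 standing for none. An
    introduction and an elimination with the same code match. *)
Definition head_rule r : nat :=
  match r with
  | RIAnd | DAnd => 1 | RIOr | DOr => 2 | RIImp | DImp => 3 | RIAll | DAll => 4
  | RIEx _ | DEx => 5 | RAndI | RAndE1 | RAndE2 => 6 | ROrI1 | ROrI2 | ROrE => 7
  | RImpI | RImpE => 8 | RAllI _ | RAllE _ => 9 | RExI _ | RExE _ => 10
  | _ => 0
  end.

Lemma head_form_sub s A : head_form (gsub s A) = head_form A.
Proof. by case: A => //= T []. Qed.

Lemma head_form_gwks ks A : head_form (gwks ks A) = head_form A.
Proof. by elim: ks A => //= k ks IH A; rewrite IH head_form_sub. Qed.

Lemma head_intro E G r prs A : rule_ok S eqn E G r prs A -> is_intro r -> head_form A = head_rule r.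
Proof. by case. Qed.

Lemma head_elim E G r prs A pr : rule_ok S eqn E G r prs A -> eliminates r ->
  onth prs 0 = Some pr -> head_form (pconcl pr) = head_rule r.
Proof. by case=> //= *; match goal with H : Some _ = Some _ |- _ => case: H => <- end. Qed.

Lemma matching_head r r' : is_intro r -> eliminates r' -> head_rule r = head_rule r' ->
  matching r r'.
Proof. by case: r => //; case: r'. Qed.

(** Goes back from a conclusion to the introduction where a segment starts. The two equations at the
    end place the segment in the enumeration [cut_segments]; the equation on codes will make it
    match the elimination below it. Only [d] has to be a derivation, [D] merely supplies
    positions. *)
Lemma top_segment E G d A b q D : pderiv b E G d A -> top d -> sub_at q D = Some d ->
  exists p s r B ps, [/\ path (minor_of D) p s, last p s = q, sub_at p D = Some (Node r B ps),
    is_intro r & head_rule r = head_form A] /\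
    [/\ p :: s = traject parent p (size s).+1 & size p = size q + size s].
Proof.
move=> H; elim: H q => {E G d A} // E G r A ps prs _ Hr Hs _ IH q.
rewrite top_node => /orP[Hi Hq|/andP[Htr /onth_has[i [d]]]].
  exists q, [::], r, A, ps; do !split=> //; first by rewrite (head_intro Hr).
  by rewrite addn0.
rewrite onth_behead => -[Hd Htd] Hq.
have [pr Hpr] := onth_Some (esym Hs) Hd.
have [||p [s [r' [B [ps' [[Hp Hl Hsub Hi Hh] [Ht Hsz]]]]]]] := IH _ _ _ Hd Hpr (rcons q i.+1) => //.
  by rewrite sub_at_rcons Hq.
exists p, (rcons s q), r', B, ps'; split; split=> //.
- rewrite rcons_path Hp /= Hl /minor_of last_rcons parent_rcons eqxx /label Hq /=.
  by rewrite Htr andbT; case: (q).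
- by rewrite last_rcons.
- by rewrite Hh (transmits_concl Hr Htr Hpr) head_form_gwks.
- rewrite size_rcons trajectSr -Ht -rcons_cons; congr rcons.
  by case: Ht => Ht; rewrite iterS -last_traject -Ht Hl parent_rcons.
- by rewrite Hsz !size_rcons addSnnS.
Qed.

Lemma normal_cutfree b E G D A : pderiv b E G D A -> normal D -> cuts D = [::].
Proof.
move=> HD Hn.
(* A degree [((0, 0), 0)] forces a cut-segment to have measure [(0, 0)]; its length would then count
   in the second component, but the empty sequence is no cut-segment. *)
have no_seg : forall s, s \notin cut_segments D.
  move=> s; apply/negP => Hs; move: Hn; rewrite /normal /degree => -[Hm Hsum].
  have : (seg_mu D s <= max_mu D)%O by exact: Order.TotalTheory.le_bigmax_seq.
  rewrite Hm Order.ProdLexiOrder.leEprodlexi /= !Order.NatOrder.leEnat leqn0.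
  case Es: (seg_mu D s) => [x y] /= /andP[/eqP Hx]; rewrite leqn0 => /eqP Hy.
  move/eqP: Hsum; rewrite sum_nat_seq_eq0 => /allP /(_ s Hs).
  rewrite Hm Es Hx Hy eqxx /= => /eqP/size0nil Hs0.
  by move: Hs; rewrite Hs0 mem_filter.
(* Segments are enumerated by positions in the whole of [D], so the induction runs over its
   subderivations together with their positions. *)
suff: forall q d E' G' A', sub_at q D = Some d -> pderiv b E' G' d A' -> cuts d = [::].
  by move=> H; exact: (H [::] D E G A).
move=> q d; elim/der_ind': d q => r B ps IH q E' G' A' Hq Hd.
move E1: (Node r B ps) Hd IH => d Hd; case: Hd E1 => {E' G' d A'} // E' G' r' A' ps' prs HA Hr Hs Hps.
case=> E1 E2 E3; subst r' B ps' => IH.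
apply/cut_node; split=> [e He|i e He]; last first.
  have [pr Hpr] := onth_Some (esym Hs) He.
  apply: (IH i e He (rcons q i) _ _ _ _ (Hps _ _ _ He Hpr)).
  by rewrite sub_at_rcons Hq.
apply/negP => /andP[Hel Hte]; have [pr Hpr] := onth_Some (esym Hs) He.
have [|p [s [r0 [B0 [ps0 [[Hp Hl Hsub Hi Hh] [Ht Hsz]]]]]]] :=
  top_segment (q := rcons q 0) (D := D) (Hps _ _ _ He Hpr) Hte; first by rewrite sub_at_rcons Hq.
apply/negP: (no_seg (p :: s)); rewrite negbK mem_filter; apply/andP; split.
  rewrite /cut_segment Hp Hl /major_of last_rcons parent_rcons /label Hsub Hq /= eqxx.
  rewrite matching_head ?andbT //; first by case: (q).
  by rewrite Hh (head_elim Hr Hel Hpr).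
rewrite Ht; apply/allpairsPdep; exists p, (size s).+1; split=> //=.
  exact: mem_positions Hsub.
by rewrite mem_iota /= add1n ltnS Hsz size_rcons ltnS leq_addl.
Qed.

End CutSegments.

(** * Contractions *)

Lemma list_choice (X Y : Type) (R : nat -> X -> Y -> Prop) l :
  (forall i x, onth l i = Some x -> exists y, R i x y) ->
  exists2 l', size l' = size l &
    forall i x y, onth l i = Some x -> onth l' i = Some y -> R i x y.
Proof.
elim: l R => [|x l IH] R H; first by exists [::] => // i x y; rewrite onth0n.
have [y Hy] := H 0 x erefl.
have [l' Hs Hl'] := IH (fun i => R i.+1) (fun i => H i.+1).
by exists (y :: l') => [|[|i] x' y' /=]; [rewrite /= Hs | case=> <- [<-] | exact: Hl'].
Qed.

(** The form of decrease in the typing contractions; [lt_lexi2] is the one in the logical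
    contractions. *)
Lemma lt_lexi1 (x y : nat *l nat) : x.1 < y.1 -> (x < y)%O.
Proof.
move=> H; rewrite Order.ProdLexiOrder.ltEprodlexi !Order.NatOrder.leEnat.
by rewrite (ltnW H) leqNgt H.
Qed.

Lemma lt_lexi2 (x y : nat *l nat) : x.1 <= y.1 -> x.2 < y.2 -> (x < y)%O.
Proof.
move=> H1 H2; rewrite Order.ProdLexiOrder.ltEprodlexi !Order.NatOrder.leEnat.
by rewrite H1 /= Order.NatOrder.ltEnat /= H2 implybT.
Qed.

Section Contraction.
Variables (L : fol) (S : atsys L) (Lam : glang L) (Sigma : gsystem S Lam).
Notation gform := (gform Lam).
Notation term := (term Lam).
Notation sub := (sub Lam).
Notation der := (der Lam).
Notation rule := (rule Lam).
Notation sid := (sid Lam).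
Notation TVar := (TVar Lam).
Notation eqn := (geqn Sigma).
Notation pderiv := (pderiv Sigma).
Notation top D := (top_ (summ D)).
Notation cuts D := (cuts_ (summ D)).
Notation psorts pr := (map (@sort_of L) (pkinds pr)).
Implicit Types (E : env L) (A B : gform) (G : seq gform) (D : der)
  (T U : term) (s : sub).

Lemma resolve_ok b E G D A : pderiv b E G D A ->
  exists D', [/\ resolve S eqn D D', pderiv false E G D' A & summ D' = summ D].
Proof.
elim=> {E G D A} [E G r A ps prs HA Hr Hs Hps IH|E0 E s G T Z Hb HT Hs].
  have [i p Hp|ps' Hs' Hps'] := @list_choice _ _ (fun i p p' => forall pr, onth prs i = Some pr ->
    [/\ resolve S eqn p p', pderiv false (exts E (pkinds pr))
     (phyps pr ++ [seq gwks (psorts pr) i | i <- G]) p' (pconcl pr) & summ p' = summ p]) ps.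
    have [pr Hpr] := onth_Some (esym Hs) Hp.
    have [p' Hp'] := IH _ _ _ Hp Hpr; exists p' => pr'; by rewrite Hpr => -[<-].
  have Hx i p p' : onth ps i = Some p -> onth ps' i = Some p' -> exists2 pr, onth prs i = Some pr &
    [/\ resolve S eqn p p', pderiv false (exts E (pkinds pr))
     (phyps pr ++ [seq gwks (psorts pr) i | i <- G]) p' (pconcl pr) & summ p' = summ p].
    move=> Hp Hp'; have [pr Hpr] := onth_Some (esym Hs) Hp.
    by exists pr => //; exact: Hps' Hp Hp' _ Hpr.
  exists (Node r A ps'); split.
  - constructor; apply/Forall2_onth; split=> // i p p' Hp Hp'.
    by have [pr _ []] := Hx _ _ _ Hp Hp'.
  - apply: (PNode HA Hr); first by rewrite Hs'.
    move=> i p' pr Hp' Hpr; have [p Hp] := onth_Some (esym Hs') Hp'.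
    by have [] := Hps' _ _ _ Hp Hp' _ Hpr.
  - rewrite /=; congr snode; apply: map_eq_onth => // i p' p Hp' Hp.
    by have [pr _ []] := Hx _ _ _ Hp Hp'.
have [W [D [HW /deriv_pderiv HD Hn]]] := geqn_sub HT Hs.
have [F [ty [Us [E1 HTy HZ]]]] := geqn_shape HT.
have [F' [ty' [Us' [E1' HTy' HW']]]] := geqn_shape HW.
(* A leaf becomes a transitivity step. [D] is normal, hence cut-free, and [RTrans] is no
   introduction and transmits nothing, so the summary of the leaf is unchanged. *)
exists (Node (RTrans Lam) (GEq (tsub s T) (tsub s Z)) [:: Node (REqn Lam) (GEq (tsub s T) W) [::]; D]).
split; last by rewrite /= /snode /= (normal_cutfree HD Hn).
- by apply: (@rs_trans _ _ _ _ _ _ _ E); apply/deriv_pderiv.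
- apply: (PNode _ (ok_trans S eqn E G _ W _)) => //.
    by exists (fsub (si s) (ores ty)); exact: tsub_ty Hs _.
  move=> [|[|i]] p pr /=; rewrite ?onth0n // => -[<-] [<-] /=.
    apply: (PNode (prs := [::])) => //; first by exists (ores ty').
      exact: ok_eqn.
    by move=> j p0 pr0; rewrite onth0n.
  exact: (pderiv_cat _ HD).
Qed.

Definition arg_ok m E G D A := [/\ pderiv true E G D A, bounded m D & top D -> (mu A < m)%O].

Lemma plug_arg_ok m b E G hs ds D A : pderiv b E (hs ++ G) D A -> size ds = size hs ->
  (forall i d B, onth ds i = Some d -> onth hs i = Some B -> arg_ok m E G d B) ->
  bounded m D ->
  [/\ pderiv true E G (plug ds D) A, bounded m (plug ds D) &
      top (plug ds D) -> top D \/ (mu A < m)%O].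
Proof.
move=> HD Hs Hds Hb; have [n B|H1 H2 H3] := @dplug_ok _ _ _ _ m _ _ _ G
  (fun n => if onth ds n is Some d then inr d else inl (n - size ds)) _ _ HD; last first.
  by split=> //; exact: H2.
rewrite onth_cat -Hs -onthTE; case Hd: (onth ds n) => [d|] /= HB.
  by have [] := Hds _ _ _ Hd HB.
by [].
Qed.

(** The common form of the contractions in which proper variables of a minor derivation are
    replaced: [s] instantiates the variables [ks], hence fixes every formula lifted past them, and
    [ds] go on the discharged assumptions [hs]. *)
Lemma plug_dsub_ok m E E' G hs ks ds D A s :
  pderiv false E' (hs ++ map (gwks ks) G) D (gwks ks A) -> wt_sub S E' E s ->
  (forall B, gsub s (gwks ks B) = B) -> size ds = size hs ->
  (forall i d B, onth ds i = Some d -> onth hs i = Some B -> arg_ok m E G d (gsub s B)) ->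
  bounded m D ->
  [/\ pderiv true E G (plug ds (dsub s D)) A, bounded m (plug ds (dsub s D)) &
      top (plug ds (dsub s D)) -> top D \/ (mu A < m)%O].
Proof.
move=> HD Hs Hks Hsz Hds Hb; have := dsub_ok HD Hs.
rewrite map_cat -map_comp (_ : map (gsub s \o gwks ks) G = G); last first.
  by rewrite -[RHS]map_id; apply: eq_map => B /=; exact: Hks.
rewrite Hks => {}HD; have [|i d B Hd||H1 H2] := plug_arg_ok (m := m) HD (ds := ds).
- by rewrite size_map.
- rewrite onth_map; case HB: (onth hs i) => [C|] //= [<-]; exact: Hds Hd HB.
- by rewrite /bounded summ_dsub.
- by rewrite summ_dsub.
Qed.

Lemma pderiv_inv b E G r C qs A : pderiv b E G (Node r C qs) A -> is_intro r \/ eliminates r ->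
  C = A /\ exists prs, [/\ wf S E A, rule_ok S eqn E G r prs A, size qs = size prs &
    forall i p pr, onth qs i = Some p -> onth prs i = Some pr ->
       pderiv b (exts E (pkinds pr)) (phyps pr ++ map (gwks (psorts pr)) G) p (pconcl pr)].
Proof.
move E1: (Node r C qs) => D H; case: H E1 => {E G D A} [E G r' A ps prs HA Hr Hs Hps [-> -> ->]|].
  by split=> //; exists prs.
by move=> E0 E s G T Z _ _ _ [-> _ _] [].
Qed.

(** [RRefl] is no introduction, so this argument starts no segment and its measure is unconstrained,
    even for [m] equal to [(0, 0)]. *)
Lemma drefl_ok m E G T a : has_ty S E T a -> arg_ok m E G (drefl T) (GEq T T).
Proof.
move=> HT; split=> //; apply: (PNode (prs := [::])) => //; first by exists a.
  exact: ok_refl.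
by move=> i p pr; rewrite onth0n.
Qed.

Lemma gsub_gwk1 s k A : sub_after_ren s (shift L k) = sid -> gsub s (gwks [:: k] A) = A.
Proof. by move=> H; rewrite /= gsub_comp scomp_ren H gsub_id. Qed.

Lemma gsub_gwk2 s j k A : sub_after_ren (sub_after_ren s (shift L k)) (shift L j) = sid ->
  gsub s (gwks [:: j; k] A) = A.
Proof. by move=> H; rewrite /= !gsub_comp scomp_ren scomp_ren H gsub_id. Qed.

Lemma ctx_nil G : [::] ++ map (gwks [::]) G = G.
Proof. exact: map_id. Qed.

(** [t] tells whether a segment reached the conclusion before the contraction. The contractum is
    still unresolved, whence [pderiv true]. *)
Definition contracts m E G D B (t : bool) := exists D1,
  [/\ contract D D1, pderiv true E G D1 B, bounded m D1 & top D1 -> t \/ (mu B < m)%O].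

Lemma wt_sub_pair E a b T U : has_ty S E T a -> has_ty S E U b ->
  wt_sub S (exts E [:: KT a; KT b]) E
    (Sub IVar (scons U (scons T (st sid))) (sf sid) (sh sid)).
Proof.
move=> HT HU; have [H1 H2 H3] := wt_sid S Lam E.
split=> //= -[|[|n]] /=; rewrite ?fsub_id //; exact: ty_var.
Qed.

Lemma wt_sub_fun E a b T : has_ty S (ext E (KT a)) T b ->
  wt_sub S (exts E [:: KF (Some a) b]) E (Sub IVar (st sid) (scons T (sf sid)) (sh sid)).
Proof.
move=> HT; have [H1 H2 H3] := wt_sid S Lam E.
by split=> //= -[|n] /=; rewrite ?fsub_id //; have := H2 n; rewrite fsub_id.
Qed.

Lemma wt_sub_ex E a t T : has_ty S E T (finst t a) ->
  wt_sub S (exts E [:: KI L; KT a]) E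
    (Sub (scons t IVar) (scons T (st sid)) (sf sid) (sh sid)).
Proof.
move=> HT; have [H1 H2 H3] := wt_inst (S := S) (E := E) (i := InstI Lam t) (k := KI L) I.
by split=> //= -[|n] /=; [|exact: H1].
Qed.

Lemma tsub1_twk2 s j k T : sub_after_ren (sub_after_ren s (shift L k)) (shift L j) = sid ->
  tsub s (twk k (twk j T)) = T.
Proof. by move=> H; rewrite /twk !tsub_tren H tsub_id. Qed.

Lemma inst_after_shift i : sub_after_ren (sub_inst i) (shift L (inst_sort i)) = sid.
Proof. by case: i => *; apply: eq_sub => //= -[]. Qed.

Lemma arg_weak m b E G D A : pderiv b E G D A -> b = false -> bounded m D -> (mu A < m)%O ->
  arg_ok m E G D A.
Proof. by move=> HD Eb Hb Hm; split=> //; apply: pderiv_weak; rewrite -Eb. Qed.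

(** Every derivation put on an assumption, apart from reflexivity, concludes with a formula of
    measure below [mu C], hence below [m], so the new cuts lie strictly below [m] although the
    contracted one may have measure [m]. If [el] has no minor premise that transmits, [B] itself is
    such a component, up to instantiation, and the second alternative holds. *)
Lemma contract_ok m E G el r C qs ns B :
  pderiv false E G (Node el B (Node r C qs :: ns)) B -> eliminates el -> is_intro r ->
  (mu C <= m)%O -> bounded m (Node r C qs) -> all (bounded m) ns ->
  contracts m E G (Node el B (Node r C qs :: ns)) B (transmits el && has (fun p => top p) ns).
Proof.
move=> H Hel Hi Hm + Hns; rewrite bounded_node => /andP[_ Hq].
have [_ [prs [HB Hr Hs Hps]]] := pderiv_inv H (or_intror Hel).
have lt_m x : (x < mu C)%O -> (x < m)%O by move=> Hx; exact: Order.POrderTheory.lt_le_trans Hx Hm.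
have H0 pr : onth prs 0 = Some pr -> pkinds pr = [::] -> phyps pr = [::] ->
    pderiv false E G (Node r C qs) (pconcl pr).
  by move=> Hpr Ek Eh; have := Hps 0 _ _ erefl Hpr; rewrite Ek Eh ctx_nil.
clear H; case: Hr Hel Hs Hps HB H0 => {el prs B} //; rewrite /contracts.
- move=> T a b A _; case: ns Hns => [|M [|]] //= /andP[HM _] _ Hps HA /(_ _ erefl erefl erefl) /= H0.
  have {Hps}HMd := Hps 1 _ _ erefl erefl.
  have {H0}[EC [prs' [HC Hr' Hs' Hqs]]] := pderiv_inv H0 (or_introl Hi); subst C.
  move E1: (GTy T (FAnd a b)) Hr' => X Hr'; case: Hr' Hi E1 Hs' Hqs HC => // {r prs' X}
    T1 U1 a1 b1 _ [? ? ?]; subst; case: qs Hq => [|D1 [|D2 [|]]] // /and3P[Hb1 Hb2 _] _ Hqs HC.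
  have HD1 := Hqs 0 _ _ erefl erefl; have HD2 := Hqs 1 _ _ erefl erefl.
  rewrite ctx_nil /= in HD1 HD2.
  have [|//|[|[|[|i]]] d B' /=|H1 H2 H3] := plug_dsub_ok (m := m) (ds := [:: drefl (TAnd T1 U1); D1; D2])
    HMd (wt_sub_pair (pderiv_wf HD1) (pderiv_wf HD2)) _ _ _ HM.
  + by move=> B'; exact: gsub_gwk2.
  + move=> [<-] [<-] /=; rewrite tsub1_twk2 //; exact: drefl_ok HC.
  + move=> [<-] [<-] /=; rewrite fsub_id; split=> [||_] //; first exact: (pderiv_weak true HD1).
    by apply: lt_m; apply: lt_lexi1; rewrite /= ltnS leq_maxl.
  + move=> [<-] [<-] /=; rewrite fsub_id; split=> [||_] //; first exact: (pderiv_weak true HD2).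
    by apply: lt_m; apply: lt_lexi1; rewrite /= ltnS leq_maxr.
  + by rewrite onth0n.
  eexists; split; [exact: c_and | exact: H1 | exact: H2 | rewrite orbF; exact: H3].
- move=> T a1 a2 A _; case: ns Hns => [|M1 [|M2 [|]]] //= /and3P[HM1 HM2 _] _ Hps HA
    /(_ _ erefl erefl erefl) /= H0.
  have HMd1 := Hps 1 _ _ erefl erefl; have {Hps}HMd2 := Hps 2 _ _ erefl erefl.
  have {H0}[EC [prs' [HC Hr' Hs' Hqs]]] := pderiv_inv H0 (or_introl Hi); subst C.
  move E1: (GTy T (FOr a1 a2)) Hr' => X Hr'; case: Hr' Hi E1 Hs' Hqs HC => // {r prs' X}
    T1 a b1 b2 Ha _ [? ? ?]; subst; case: qs Hq => [|D1 [|]] // /andP[Hb1 _] _ Hqs HC.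
  have HD1 := Hqs 0 _ _ erefl erefl; rewrite ctx_nil /= in HD1.
  have Hma : (mu (GTy T1 a) < m)%O.
    by apply: lt_m; apply: lt_lexi1; rewrite /= ltnS; case: Ha => ->; rewrite ?leq_maxl ?leq_maxr.
  case: Ha => Ea; subst a.
    have [|//|[|[|i]] d B' /=|H1 H2 H3] := plug_dsub_ok (m := m) (ds := [:: drefl (TOr b1 b1 b2 T1); D1])
      HMd1 (wt_inst (i := InstT T1) (k := KT b1) (pderiv_wf HD1)) _ _ _ HM1.
    + by move=> B'; apply: gsub_gwk1; exact: (inst_after_shift (InstT T1)).
    + move=> [<-] [<-] /=; rewrite tsub1_twk // [X in GEq _ X]/tsub /= !fsub_id; exact: drefl_ok HC.
    + move=> [<-] [<-] /=; rewrite fsub_id; split=> [||_] //; exact: (pderiv_weak true HD1).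
    + by rewrite onth0n.
    eexists; split; [exact: c_or1 | exact: H1 | exact: H2 | ].
    by case/H3 => ->; [left | right].
  have [|//|[|[|i]] d B' /=|H1 H2 H3] := plug_dsub_ok (m := m) (ds := [:: drefl (TOr b2 b1 b2 T1); D1])
    HMd2 (wt_inst (i := InstT T1) (k := KT b2) (pderiv_wf HD1)) _ _ _ HM2.
  + by move=> B'; apply: gsub_gwk1; exact: (inst_after_shift (InstT T1)).
  + move=> [<-] [<-] /=; rewrite tsub1_twk // [X in GEq _ X]/tsub /= !fsub_id; exact: drefl_ok HC.
  + move=> [<-] [<-] /=; rewrite fsub_id; split=> [||_] //; exact: (pderiv_weak true HD1).
  + by rewrite onth0n.
  eexists; split; [exact: c_or2 | exact: H1 | exact: H2 | ].
  by case/H3 => ->; [left; rewrite orbT | right].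
- move=> T a b A _; case: ns Hns => [|M [|]] //= /andP[HM _] _ Hps HA /(_ _ erefl erefl erefl) /= H0.
  have {Hps}HMd := Hps 1 _ _ erefl erefl.
  have {H0}[EC [prs' [HC Hr' Hs' Hqs]]] := pderiv_inv H0 (or_introl Hi); subst C.
  move E1: (GTy T (FImp a b)) Hr' => X Hr'; case: Hr' Hi E1 Hs' Hqs HC => // {r prs' X}
    T1 a1 b1 _ [? ? ?]; subst; case: qs Hq => [|D1 [|]] // /andP[Hb1 _] _ Hqs HC.
  have HD1 := Hqs 0 _ _ erefl erefl.
  set F := GImp (GTy (TVar 0) a1) (GTy T1 b1).
  have HF : wf S (ext E (KT a1)) F.
    by split; [exact: (ty_var S Lam (ext E (KT a1)) 0) | exact: (pderiv_wf HD1)].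
  have HD2 : pderiv false E G (Node (RAllI Lam ST) (GAll (KT a1) F) [:: Node (RImpI Lam) F [:: D1]])
      (GAll (KT a1) F).
    apply: (PNode (prs := [:: Prem [:: KT a1] [::] F])) => //; first exact: (ok_allI S eqn E G (KT a1)).
    move=> [|i] p pr /=; rewrite ?onth0n // => -[<-] [<-].
    apply: (PNode (prs := [:: Prem [::] [:: GTy (TVar 0) a1] (GTy T1 b1)])) => //.
      exact: ok_impI.
    move=> [|i] p' pr' /=; rewrite ?onth0n // => -[<-] [<-] /=.
    by rewrite map_id.
  have [|//|[|[|i]] d B' /=|H1 H2 H3] := plug_dsub_ok (m := m)
    (ds := [:: drefl (TImp a1 T1); Node (RAllI Lam ST) (GAll (KT a1) F) [:: Node (RImpI Lam) F [:: D1]]])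
    HMd (wt_sub_fun (pderiv_wf HD1)) _ _ _ HM.
  + by move=> B'; exact: gsub_gwk1.
  (* Below the binder, [Tf 0 (TVar 0)] becomes [T1] itself by the eta law, so the discharged
     equivalence becomes an instance of reflexivity. *)
  + move=> [<-] [<-] /=; rewrite tsub1_twk // [X in GEq _ X]/tsub /= fsub_id tinst_var_up; exact: drefl_ok HC.
  + move=> [<-] [<-] /=; rewrite !fsub_id [tsub _ (Tf _ _)]tinst_var_up.
    split=> [||_]; first exact: (pderiv_weak true HD2).
      by rewrite bounded_node /= ?bounded_node /= Hb1.
    by apply: lt_m; apply: lt_lexi1; rewrite /= ltnS.
  + by rewrite onth0n.
  eexists; split; [exact: c_imp | exact: H1 | exact: H2 | rewrite orbF; exact: H3].
- move=> T a A _; case: ns Hns => [|M [|]] //= /andP[HM _] _ Hps HA /(_ _ erefl erefl erefl) /= H0.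
  have {Hps}HMd := Hps 1 _ _ erefl erefl.
  have {H0}[EC [prs' [HC Hr' Hs' Hqs]]] := pderiv_inv H0 (or_introl Hi); subst C.
  move E1: (GTy T (FAll a)) Hr' => X Hr'; case: Hr' Hi E1 Hs' Hqs HC => // {r prs' X}
    T1 a1 _ [? ?]; subst; case: qs Hq => [|D1 [|]] // /andP[Hb1 _] _ Hqs HC.
  have HD1 := Hqs 0 _ _ erefl erefl.
  have HD2 : pderiv false E G (Node (RAllI Lam SI) (GAll (KI L) (GTy T1 a1)) [:: D1])
      (GAll (KI L) (GTy T1 a1)).
    apply: (PNode (prs := [:: Prem [:: KI L] [::] (GTy T1 a1)])) => //.
      by split=> //; exact: (pderiv_wf HD1).
    exact: (ok_allI S eqn E G (KI L)).
  have [|//|[|[|i]] d B' /=|H1 H2 H3] := plug_dsub_ok (m := m)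
    (ds := [:: drefl (TAll T1); Node (RAllI Lam SI) (GAll (KI L) (GTy T1 a1)) [:: D1]])
    HMd (wt_inst (i := InstH T1) (k := KH a1) (pderiv_wf HD1)) _ _ _ HM.
  + by move=> B'; apply: gsub_gwk1; exact: (inst_after_shift (InstH T1)).
  + move=> [<-] [<-] /=; rewrite tsub1_twk // [X in GEq _ X]/tsub /= tinst_var_upI; exact: drefl_ok HC.
  + move=> [<-] [<-] /=; rewrite upi_id !fsub_id [tsub _ (Th _ _ _)]tinst_var_upI.
    split=> [||_]; first exact: (pderiv_weak true HD2).
      by rewrite bounded_node /= ?bounded_node /= Hb1.
    by apply: lt_m; apply: lt_lexi1; rewrite /= ltnS.
  + by rewrite onth0n.
  eexists; split; [exact: c_all | exact: H1 | exact: H2 | rewrite orbF; exact: H3].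
- move=> T a A _; case: ns Hns => [|M [|]] //= /andP[HM _] _ Hps HA /(_ _ erefl erefl erefl) /= H0.
  have {Hps}HMd := Hps 1 _ _ erefl erefl.
  have {H0}[EC [prs' [HC Hr' Hs' Hqs]]] := pderiv_inv H0 (or_introl Hi); subst C.
  move E1: (GTy T (FEx a)) Hr' => X Hr'; case: Hr' Hi E1 Hs' Hqs HC => // {r prs' X}
    T1 a1 t _ [? ?]; subst; case: qs Hq => [|D1 [|]] // /andP[Hb1 _] _ Hqs HC.
  have HD1 := Hqs 0 _ _ erefl erefl; rewrite ctx_nil /= in HD1.
  have [|//|[|[|i]] d B' /=|H1 H2 H3] := plug_dsub_ok (m := m)
    (ds := [:: drefl (TEx (finst t a1) a1 T1); D1]) HMd (wt_sub_ex (pderiv_wf HD1)) _ _ _ HM.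
  + by move=> B'; exact: gsub_gwk2.
  + move=> [<-] [<-] /=; rewrite tsub1_twk2 // [X in GEq _ X]/tsub /=.
    (* The quantified body was lifted past the proper variable; replacing this variable by [t] gives
       the body back. *)
    rewrite (fsub_comp (upi _)) upi_comp (_ : icomp _ _ = IVar) // upi_id fsub_id.
    exact: drefl_ok HC.
  + move=> [<-] [<-] /=; split=> [||_] //; first exact: (pderiv_weak true HD1).
    (* The instance [finst t a1] has the complexity of [a1]. *)
    by apply: lt_m; apply: lt_lexi1; rewrite /= k1_sub.
  + by rewrite onth0n.
  eexists; split; [exact: c_ex | exact: H1 | exact: H2 | rewrite orbF; exact: H3].
- move=> A B0 _ Hs Hps HA /(_ _ erefl erefl erefl) /= H0; case: ns Hns Hs {Hps} => // _ _.
  have {H0}[EC [prs' [HC Hr' Hs' Hqs]]] := pderiv_inv H0 (or_introl Hi); subst C.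
  move E1: (GAnd A B0) Hr' => X Hr'; case: Hr' Hi E1 Hs' Hqs HC => // {r prs' X}
    A1 B1 _ [? ?]; subst; case: qs Hq => [|D1 [|D2 [|]]] // /and3P[Hb1 _ _] _ Hqs HC.
  have HD1 := Hqs 0 _ _ erefl erefl; rewrite ctx_nil /= in HD1.
  exists D1; split=> //; [exact: c_land1 | exact: (pderiv_weak true HD1) | move=> _; right].
  by apply: lt_m; apply: lt_lexi2; rewrite /= ?ltnS leq_maxl.
- move=> A B0 _ Hs Hps HA /(_ _ erefl erefl erefl) /= H0; case: ns Hns Hs {Hps} => // _ _.
  have {H0}[EC [prs' [HC Hr' Hs' Hqs]]] := pderiv_inv H0 (or_introl Hi); subst C.
  move E1: (GAnd A B0) Hr' => X Hr'; case: Hr' Hi E1 Hs' Hqs HC => // {r prs' X}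
    A1 B1 _ [? ?]; subst; case: qs Hq => [|D1 [|D2 [|]]] // /and3P[_ Hb2 _] _ Hqs HC.
  have HD2 := Hqs 1 _ _ erefl erefl; rewrite ctx_nil /= in HD2.
  exists D2; split=> //; [exact: c_land2 | exact: (pderiv_weak true HD2) | move=> _; right].
  by apply: lt_m; apply: lt_lexi2; rewrite /= ?ltnS leq_maxr.
- move=> A B0 A0 _; case: ns Hns => [|M1 [|M2 [|]]] //= /and3P[HM1 HM2 _] _ Hps HA
    /(_ _ erefl erefl erefl) /= H0.
  have HMd1 := Hps 1 _ _ erefl erefl; have {Hps}HMd2 := Hps 2 _ _ erefl erefl.
  rewrite /= map_id in HMd1 HMd2.
  have {H0}[EC [prs' [HC Hr' Hs' Hqs]]] := pderiv_inv H0 (or_introl Hi); subst C.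
  move E1: (GOr A B0) Hr' => X Hr'; case: Hr' Hi E1 Hs' Hqs HC => // {r prs' X}
    A1 B1 _ [? ?]; subst; case: qs Hq => [|D1 [|]] // /andP[Hb1 _] _ Hqs HC.
    have HD1 := Hqs 0 _ _ erefl erefl; rewrite ctx_nil /= in HD1.
    have [//|[|i] d B' /=|//|H1 H2 H3] := @plug_arg_ok m _ E G [:: A1] [:: D1] _ _ HMd1.
      move=> [<-] [<-]; apply: arg_weak HD1 _ _ _ => //.
      by apply: lt_m; apply: lt_lexi2; rewrite /= ?ltnS leq_maxl.
    + by rewrite onth0n.
    eexists; split; [exact: c_lor1 | exact: H1 | exact: H2 | ].
    by case/H3 => ->; [left | right].
  have HD1 := Hqs 0 _ _ erefl erefl; rewrite ctx_nil /= in HD1.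
  have [//|[|i] d B' /=|//|H1 H2 H3] := @plug_arg_ok m _ E G [:: B1] [:: D1] _ _ HMd2.
    move=> [<-] [<-]; apply: arg_weak HD1 _ _ _ => //.
    by apply: lt_m; apply: lt_lexi2; rewrite /= ?ltnS leq_maxr.
  + by rewrite onth0n.
  eexists; split; [exact: c_lor2 | exact: H1 | exact: H2 | ].
  by case/H3 => ->; [left; rewrite orbT | right].
- move=> A B0 _; case: ns Hns => [|D2 [|]] //= /andP[HM _] _ Hps HA /(_ _ erefl erefl erefl) /= H0.
  have {Hps}HD2 := Hps 1 _ _ erefl erefl; rewrite ctx_nil /= in HD2.
  have {H0}[EC [prs' [HC Hr' Hs' Hqs]]] := pderiv_inv H0 (or_introl Hi); subst C.
  move E1: (GImp A B0) Hr' => X Hr'; case: Hr' Hi E1 Hs' Hqs HC => // {r prs' X}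
    A1 B1 _ [? ?]; subst; case: qs Hq => [|D1 [|]] // /andP[Hb1 _] _ Hqs HC.
  have HD1 := Hqs 0 _ _ erefl erefl; rewrite /= map_id in HD1.
  have [//|[|i] d B' /=|//|H1 H2 H3] := @plug_arg_ok m _ E G [:: A1] [:: D2] _ _ HD1.
    move=> [<-] [<-]; apply: arg_weak HD2 _ _ _ => //.
    by apply: lt_m; apply: lt_lexi2; rewrite /= ?ltnS leq_maxl.
  + by rewrite onth0n.
  eexists; split; [exact: c_limp | exact: H1 | exact: H2 | move=> _; right].
  by apply: lt_m; apply: lt_lexi2; rewrite /= ?ltnS leq_maxr.
- move=> k A i Hik _ Hs Hps HA /(_ _ erefl erefl erefl) /= H0; case: ns Hns Hs {Hps} => // _ _.
  have {H0}[EC [prs' [HC Hr' Hs' Hqs]]] := pderiv_inv H0 (or_introl Hi); subst C.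
  move E1: (GAll k A) Hr' => X Hr'; case: Hr' Hi E1 Hs' Hqs HC => // {r prs' X}
    k1 A1 _ [? ?]; subst; case: qs Hq => [|D1 [|]] // /andP[Hb1 _] _ Hqs HC.
  have HD1 := Hqs 0 _ _ erefl erefl; rewrite /= in HD1.
  have := dsub_ok HD1 (wt_inst Hik).
  rewrite -map_comp (_ : map _ G = G); last first.
    rewrite -[RHS]map_id; apply: eq_map => B' /=; rewrite (inst_ok_sort Hik).
    by apply: (@gsub_gwk1 _ (inst_sort i)); exact: inst_after_shift.
  move=> HD2; eexists; split; [exact: c_lall | exact: HD2 | by rewrite /bounded summ_dsub | ].
  by move=> _; right; rewrite mu_sub; apply: lt_m; exact: lt_lexi2.
- move=> k A B0 _; case: ns Hns => [|M [|]] //= /andP[HM _] _ Hps HA /(_ _ erefl erefl erefl) /= H0.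
  have {Hps}HMd := Hps 1 _ _ erefl erefl.
  have {H0}[EC [prs' [HC Hr' Hs' Hqs]]] := pderiv_inv H0 (or_introl Hi); subst C.
  move E1: (GEx k A) Hr' => X Hr'; case: Hr' Hi E1 Hs' Hqs HC => // {r prs' X}
    k1 A1 i Hik _ [? ?]; subst; case: qs Hq => [|D1 [|]] // /andP[Hb1 _] _ Hqs HC.
  have HD1 := Hqs 0 _ _ erefl erefl; rewrite ctx_nil /= in HD1.
  have [|//|[|j] d B' /=|H1 H2 H3] := plug_dsub_ok (m := m) (ds := [:: D1]) HMd (wt_inst Hik) _ _ _ HM.
  + by move=> B' /=; rewrite (inst_ok_sort Hik); exact: (gsub_gwk1 B' (inst_after_shift i)).
  + move=> [<-] [<-]; apply: arg_weak HD1 _ _ _ => //.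
    by rewrite mu_sub; apply: lt_m; exact: lt_lexi2.
  + by rewrite onth0n.
  eexists; split; [exact: c_lex | exact: H1 | exact: H2 | rewrite orbF; exact: H3].
Qed.

End Contraction.

(** * Permutations and normalisation *)

Lemma lexi_ind (P : nat *l nat -> Prop) :
  (forall m, (forall m', (m' < m)%O -> P m') -> P m) -> forall m, P m.
Proof.
move=> H [a b]; elim/ltn_ind: a b => a IHa b; elim/ltn_ind: b => b IHb.
apply: H => -[a' b']; rewrite Order.ProdLexiOrder.ltEprodlexi /= !Order.NatOrder.leEnat.
case: (ltngtP a' a) => //= [Ha _|-> Hb]; [exact: IHa | exact: IHb].
Qed.

Lemma max_seq (l : seq (nat *l nat)) : l = [::] \/
  exists2 x, x \in l & all (fun y => (y <= x)%O) l.
Proof.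
elim: l => [|y l [->|[x Hx Hl]]]; [by left | |]; right.
  by exists y; rewrite ?mem_head //= Order.POrderTheory.lexx.
case: (Order.TotalTheory.leP y x) => Hxy; first by exists x; rewrite ?inE ?Hx ?orbT //= Hxy.
exists y; rewrite ?mem_head //= Order.POrderTheory.lexx /=.
apply: sub_all Hl => z Hz; apply: Order.POrderTheory.le_trans Hz _; exact: Order.POrderTheory.ltW.
Qed.

Section Normalisation.
Variables (L : fol) (S : atsys L) (Lam : glang L) (Sigma : gsystem S Lam).
Notation gform := (gform Lam).
Notation term := (term Lam).
Notation sub := (sub Lam).
Notation der := (der Lam).
Notation rule := (rule Lam).
Notation eqn := (geqn Sigma).
Notation pderiv := (pderiv Sigma).
Notation top D := (top_ (summ D)).
Notation cuts D := (cuts_ (summ D)).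
Notation psorts pr := (map (@sort_of L) (pkinds pr)).
Implicit Types (E : env L) (A B : gform) (G : seq gform) (D : der) (r : rule) (s : sub).

(** * Reductions inside the premises of a rule *)

Notation premd E G p pr :=
  (pderiv false (exts E (pkinds pr)) (phyps pr ++ map (gwks (psorts pr)) G) p (pconcl pr)).
Notation premr E G p p' pr :=
  (reduces S eqn (exts E (pkinds pr)) (phyps pr ++ map (gwks (psorts pr)) G) (pconcl pr) p p').

Lemma node_pderiv E G r A ps prs : wf S E A -> rule_ok S eqn E G r prs A ->
  List.Forall2 (fun p pr => premd E G p pr) ps prs -> pderiv false E G (Node r A ps) A.
Proof. by move=> HA Hr /Forall2_onth[Hs Hps]; exact: PNode HA Hr Hs Hps. Qed.

(** [ired] relates derivations only, so the other premises have to be derivations throughout. *)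
Lemma reduces_premise E G r A ps1 ps2 p p' prs1 pr prs2 : wf S E A ->
  rule_ok S eqn E G r (prs1 ++ pr :: prs2) A ->
  List.Forall2 (fun p pr => premd E G p pr) ps1 prs1 ->
  List.Forall2 (fun p pr => premd E G p pr) ps2 prs2 -> premr E G p p' pr ->
  reduces S eqn E G A (Node r A (ps1 ++ p :: ps2)) (Node r A (ps1 ++ p' :: ps2)).
Proof.
move=> HA Hr H1 H2; elim=> {p p'} [p p' [/deriv_pderiv Hp /deriv_pderiv Hp' Hpp']|p|p q p' _ IH1 _ IH2].
- have Hn q : premd E G q pr -> pderiv false E G (Node r A (ps1 ++ q :: ps2)) A.
    by move=> Hq; apply: (node_pderiv HA Hr); apply: List.Forall2_app => //; constructor.
  apply: rt_step; split; try by apply/deriv_pderiv; exact: Hn.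
  by case: Hpp' => [->|Hst]; [left | right; exact: step_in].
- exact: rt_refl.
- exact: rt_trans IH1 IH2.
Qed.

(** Premises are reduced from left to right; [ps1] is the part already treated. *)
Lemma reduces_premises E G r A ps1 ps ps' prs1 prs : wf S E A ->
  rule_ok S eqn E G r (prs1 ++ prs) A -> List.Forall2 (fun p pr => premd E G p pr) ps1 prs1 ->
  size ps = size prs -> size ps' = size prs ->
  (forall i p p' pr, onth ps i = Some p -> onth ps' i = Some p' -> onth prs i = Some pr ->
     [/\ premd E G p pr, premd E G p' pr & premr E G p p' pr]) ->
  reduces S eqn E G A (Node r A (ps1 ++ ps)) (Node r A (ps1 ++ ps')).
Proof.
move=> HA; elim: ps ps' prs ps1 prs1 => [|p ps IH] [|p' ps'] [|pr prs] ps1 prs1 Hr H1 //= Hs Hs' H.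
  exact: rt_refl.
case: Hs Hs' => Hs [Hs']; have [Hp Hp' Hpp'] := H 0 _ _ _ erefl erefl erefl.
have H2 : List.Forall2 (fun p pr => premd E G p pr) ps prs.
  apply/Forall2_onth; split=> // i q pr' Hq Hpr'.
  have [q' Hq'] := onth_Some (etrans Hs' (esym Hs)) Hq.
  by have [] := H i.+1 _ _ _ Hq Hq' Hpr'.
apply: rt_trans (reduces_premise HA Hr H1 H2 Hpp') _.
rewrite -!cat_rcons -!cats1; apply: (IH _ prs _ (prs1 ++ [:: pr])) => //.
- by rewrite -catA.
- by apply: List.Forall2_app => //; constructor.
- by move=> i; exact: (H i.+1).
Qed.

Lemma resolve_refl D : resolve S eqn D D.
Proof.
elim/der_ind': D => r A ps IH; constructor; apply/Forall2_onth; split=> // i p q Hp.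
by rewrite Hp => -[<-]; exact: IH Hp.
Qed.

(** * Permutation of an elimination upwards *)

Lemma concl_dsub s D : concl (dsub s D) = gsub s (concl D).
Proof. by case: D. Qed.

Lemma concl_dren f D : concl (dren f D) = concl D.
Proof. by case: D => -[]. Qed.

Lemma binds_major r : eliminates r -> binds r 0 = ([::], 0).
Proof. by case: r. Qed.

(** Weakening may change the term carried by the rule, as in [RAllE], so [r'] is known only up to
    its class. *)
Lemma elim_weaken f ks r A p ps : eliminates r ->
  exists r' p' ps', dren f (dwks ks (Node r A (p :: ps))) = Node r' (gwks ks A) (p' :: ps') /\
    [/\ rclass r' = rclass r, map (@summ _ _) ps' = map (@summ _ _) ps & concl p' = gwks ks (concl p)].
Proof.
elim: ks r A p ps => [|k ks IH] r A p ps Hr.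
  have nass : forall n, r <> RAss Lam n by move=> n Er; rewrite Er in Hr.
  rewrite [dwks _ _]/= dren_node //; do 3 eexists; split; first by [].
  split=> //; last by rewrite concl_dren.
  apply: map_eq_onth; first by rewrite size_mapi.
  by move=> i x y; rewrite onth_mapi => + Hy; rewrite Hy => -[<-]; rewrite summ_dren.
have Hr' : eliminates (rule_sub (wk Lam k) r) by case: r Hr.
have [r' [p' [ps' [/= -> [H1 H2 H3]]]]] := IH _ (gsub (wk Lam k) A)
  (dsub (ups (binds r 0).1 (wk Lam k)) p)
  (mapi (fun i d => dsub (ups (binds r i).1 (wk Lam k)) d) 1 ps) Hr'.
exists r', p', ps'; split=> //; split.
- by rewrite H1; case: (r).
- rewrite H2; apply: map_eq_onth; first by rewrite size_mapi.
  by move=> i x y; rewrite onth_mapi => + Hy; rewrite Hy => -[<-]; rewrite summ_dsub.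
- by rewrite H3 concl_dsub binds_major.
Qed.

Lemma elim_class r r' : rclass r' = rclass r -> (eliminates r' = eliminates r) * (transmits r' = transmits r).
Proof. by case=> _ -> ->. Qed.

Lemma major_premise E G r prs A pr : rule_ok S eqn E G r prs A -> eliminates r ->
  onth prs 0 = Some pr -> pkinds pr = [::] /\ phyps pr = [::].
Proof. by case=> //= *; match goal with H : Some _ = Some _ |- _ => case: H => <- end. Qed.

Lemma all_map_summ m (ps ps' : seq der) : map (@summ _ _) ps' = map (@summ _ _) ps ->
  (all (bounded m) ps' = all (bounded m) ps) *
  (has (fun p => top p) ps' = has (fun p => top p) ps).
Proof.
elim: ps ps' => [|p ps IH] [|p' ps'] //= [E1 /IH[-> ->]].
by rewrite /bounded E1.
Qed.

(** The elimination is lifted to the environment of the minor premise, and its own minor derivations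
    are then resolved. The derivation [d] is kept literally, so an induction on the major premise
    can go on with it. *)
Lemma permute_ok m E G el B D ns pr r i d :
  pderiv false E G (Node el B (D :: ns)) B -> eliminates el ->
  binds r i = (psorts pr, size (phyps pr)) ->
  pconcl pr = gwks (psorts pr) (concl D) -> premd E G d pr ->
  exists el' ns', let P := Node el' (gwks (psorts pr) B) (d :: ns') in
  [/\ resolve S eqn (permute r el B (D :: ns) i d) P,
      pderiv false (exts E (pkinds pr)) (phyps pr ++ map (gwks (psorts pr)) G) P
        (gwks (psorts pr) B),
      (eliminates el' = eliminates el) * (transmits el' = transmits el),
      all (bounded m) ns' = all (bounded m) ns &
      has (fun p => top p) ns' = has (fun p => top p) ns].
Proof.
move=> H Hel Hb Hpr Hd.
have HW : pderiv true (exts E (pkinds pr)) (phyps pr ++ map (gwks (psorts pr)) G)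
    (dren (addn (size (phyps pr))) (dwks (psorts pr) (Node el B (D :: ns)))) (gwks (psorts pr) B).
  apply: (dren_ok (dwks_ok (pkinds pr) (pderiv_weak true H))) => n B' HB'.
  by rewrite onth_cat [_ + _ < _]ltnNge leq_addr /= addKn.
have [el' [D' [ns' [E1 [Hc Hsm HD']]]]] :=
  elim_weaken (addn (size (phyps pr))) (psorts pr) B D ns Hel.
rewrite /permute Hb [(_, _).1]/= [(_, _).2]/= E1; rewrite E1 in HW.
have Hel' : eliminates el' by rewrite (elim_class Hc).
have [_ [prs [HB Hr Hs Hps]]] := pderiv_inv HW (or_intror Hel').
have [|ns'' Hs'' Hns''] := @list_choice _ _ (fun j p p' => forall pr', onth prs j.+1 = Some pr' ->
    [/\ resolve S eqn p p', premd (exts E (pkinds pr)) (phyps pr ++ map (gwks (psorts pr)) G) p' pr'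
      & summ p' = summ p]) ns'.
  move=> j p Hp; have [pr' Hpr'] : exists pr', onth prs j.+1 = Some pr'.
    by apply: (onth_Some (esym Hs)); exact: Hp.
  have [p' Hp'] := resolve_ok (Hps j.+1 _ _ Hp Hpr').
  by exists p' => pr''; rewrite Hpr' => -[<-].
have {}Hns'' j p p' : onth ns' j = Some p -> onth ns'' j = Some p' ->
    exists2 pr', onth prs j.+1 = Some pr' & [/\ resolve S eqn p p',
    premd (exts E (pkinds pr)) (phyps pr ++ map (gwks (psorts pr)) G) p' pr' & summ p' = summ p].
  move=> Hp Hp'; have [pr' Hpr'] : exists pr', onth prs j.+1 = Some pr'.
    by apply: (onth_Some (esym Hs)); exact: Hp.
  by exists pr' => //; exact: Hns'' Hp Hp' _ Hpr'.
have Hsum : map (@summ _ _) ns'' = map (@summ _ _) ns.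
  rewrite -Hsm; apply: map_eq_onth => // j p' p Hp' Hp.
  by have [pr' _ []] := Hns'' _ _ _ Hp Hp'.
exists el', ns''; split.
(* [d] is a derivation already; only the copied minor derivations are resolved. *)
- constructor; constructor; first exact: resolve_refl.
  apply/Forall2_onth; split=> // j p p' Hp Hp'.
  by have [pr' _ []] := Hns'' _ _ _ Hp Hp'.
- apply: (PNode HB Hr); first by rewrite /= Hs''.
  move=> [|j] p' pr' Hp' Hpr'; last first.
    have [p Hp] := onth_Some (t := ns'') (esym Hs'') Hp'.
    by have [pr'' ] := Hns'' _ _ _ Hp Hp'; rewrite Hpr' => -[<-] [].
  have [Ek Eh] := major_premise Hr Hel' Hpr'.
  have := pderiv_concl (Hps 0 _ _ erefl Hpr'); rewrite HD' -Hpr => E2.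
  by move: Hp' => [<-]; rewrite Ek Eh -E2 ctx_nil.
- exact: elim_class.
- by rewrite (all_map_summ m Hsum).
- by rewrite (all_map_summ m Hsum).
Qed.

Definition replace_concl B (pr : premise Lam) :=
  Prem (pkinds pr) (phyps pr) (gwks (psorts pr) B).

(** These rules are schematic in their conclusion. *)
Lemma transmits_replace E G r prs C B : rule_ok S eqn E G r prs C -> transmits r ->
  exists pr prs', prs = pr :: prs' /\
    rule_ok S eqn E G r (pr :: map (replace_concl B) prs') B.
Proof.
case=> // [T a b A|T a1 a2 A|T a b A|T a A|T a A|A1 B1 A|k A1 A] _.
all: by do 2 eexists; split; [reflexivity | constructor].
Qed.

Lemma transmits_eliminates r : transmits r -> eliminates r.
Proof. by case: r. Qed.

Lemma eliminates_intro r : eliminates r -> is_intro r = false.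
Proof. by case: r. Qed.

Lemma reduce_root m D0 E G el ns B :
  pderiv false E G (Node el B (D0 :: ns)) B -> eliminates el -> (mu (concl D0) <= m)%O ->
  bounded m D0 -> all (bounded m) ns ->
  exists D', [/\ pderiv false E G D' B, reduces S eqn E G B (Node el B (D0 :: ns)) D',
    bounded m D' & top D' -> transmits el && has (fun p => top p) ns \/ (mu B < m)%O].
Proof.
elim/der_ind': D0 E G el ns B => r C qs IH E G el ns B H Hel /= Hm Hb Hns.
case Ht: (top (Node r C qs)); last first.
  exists (Node el B (Node r C qs :: ns)); split=> //; first exact: rt_refl.
    by rewrite bounded_node Ht andbF /= Hb.
  by rewrite top_node (eliminates_intro Hel) /=; left.
case Hi: (is_intro r).
  have [D1 [HD1 HdD1 Hb1 Ht1]] := contract_ok H Hel Hi Hm Hb Hns.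
  have [D' [HD' HdD' Es]] := resolve_ok HdD1.
  exists D'; split=> //; [|by rewrite /bounded Es | by rewrite Es].
  apply: rt_step; split; try exact/deriv_pderiv.
  by right; apply: step_here HD1 HD'.
have Htr : transmits r by move: Ht; rewrite top_node Hi /= => /andP[].
have [_ [eprs [HB Her Hes Heps]]] := pderiv_inv H (or_intror Hel).
have [epr Hepr] : exists epr, onth eprs 0 = Some epr by exact: (onth_Some (esym Hes)).
have [Ek Eh] := major_premise Her Hel Hepr.
have HD := Heps 0 _ _ erefl Hepr; rewrite Ek Eh ctx_nil in HD.
have [EC [prs [HC Hr Hs Hps]]] := pderiv_inv HD (or_intror (transmits_eliminates Htr)).
rewrite -{}EC in HC Hr {HD Ek Eh Hepr}.
have [pr0 [prs' [Eprs HrB]]] := transmits_replace B Hr Htr; subst prs.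
case: qs Hs Hps IH H Hb Ht Heps Hes => [|maj ms] //= [Hs] Hps IH H Hb Ht Heps Hes.
have Hbms : all (bounded m) ms by move: Hb; rewrite bounded_node => /and3P[].
(* For each minor premise, [y.1] is the resolved result of the permutation and [y.2] its reduct
   given by the induction hypothesis. *)
have [|ys Hys Hy] := @list_choice _ _ (fun i d (y : der * der) => forall pr, onth prs' i = Some pr ->
   [/\ resolve S eqn (permute r el B (Node r C (maj :: ms) :: ns) i.+1 d) y.1,
       premd E G y.1 (replace_concl B pr), premd E G y.2 (replace_concl B pr),
       premr E G y.1 y.2 (replace_concl B pr) &
       bounded m y.2 /\ (top y.2 -> transmits el && has (fun p => top p) ns \/ (mu B < m)%O)]) ms.
  move=> i d Hd; have [pr Hpr] := onth_Some (esym Hs) Hd.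
  have Hpd := Hps i.+1 _ _ Hd Hpr.
  have Hb' := @rule_ok_binds _ _ _ _ _ _ _ _ _ i.+1 _ Hr Hpr.
  have Hc := @transmits_concl _ _ _ _ _ _ _ _ _ i _ Hr Htr Hpr.
  have [el' [ns' [HP HdP Hcl Hns' Htop']]] := permute_ok m H Hel Hb' Hc Hpd.
  have [||||D' [HD' HR' Hb1 Ht1]] := IH i.+1 d Hd _ _ el' ns' _ HdP.
  - by rewrite Hcl.
  - by rewrite (pderiv_concl Hpd) Hc mu_gwks.
  - by move/onth_all: Hbms; apply; exact: Hd.
  - by rewrite Hns'.
  exists (Node el' (gwks (psorts pr) B) (d :: ns'), D') => pr'; rewrite Hpr => -[<-].
  by split=> //; split=> // /Ht1; rewrite Hcl Htop' mu_gwks.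
have {}Hy i d y : onth ms i = Some d -> onth ys i = Some y -> exists2 pr, onth prs' i = Some pr &
   [/\ resolve S eqn (permute r el B (Node r C (maj :: ms) :: ns) i.+1 d) y.1,
       premd E G y.1 (replace_concl B pr), premd E G y.2 (replace_concl B pr),
       premr E G y.1 y.2 (replace_concl B pr) &
       bounded m y.2 /\ (top y.2 -> transmits el && has (fun p => top p) ns \/ (mu B < m)%O)].
  move=> Hd Hyi; have [pr Hpr] := onth_Some (esym Hs) Hd.
  by exists pr => //; exact: Hy Hd Hyi _ Hpr.
have Hyy i y : onth ys i = Some y -> exists d pr, [/\ onth ms i = Some d, onth prs' i = Some pr &
   [/\ resolve S eqn (permute r el B (Node r C (maj :: ms) :: ns) i.+1 d) y.1,
       premd E G y.1 (replace_concl B pr), premd E G y.2 (replace_concl B pr),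
       premr E G y.1 y.2 (replace_concl B pr) &
       bounded m y.2 /\ (top y.2 -> transmits el && has (fun p => top p) ns \/ (mu B < m)%O)]].
  move=> Hyi; have [d Hd] := onth_Some (esym Hys) Hyi.
  by have [pr Hpr Hall] := Hy _ _ _ Hd Hyi; exists d, pr.
have Hsz : size ys = size prs' by rewrite Hys.
have Hnode (f : der * der -> der) :
    (forall i y pr, onth ys i = Some y -> onth prs' i = Some pr -> premd E G (f y) (replace_concl B pr)) ->
    pderiv false E G (Node r B (maj :: map f ys)) B.
  move=> Hf; apply: (PNode HB HrB); first by rewrite /= !size_map Hsz.
  move=> [|i] p pr; first exact: (Hps 0).
  rewrite /= !onth_map; case Hyi: (onth ys i) => [y|] //= [<-].
  by case Hpr: (onth prs' i) => [pr'|] //= [<-]; exact: Hf Hyi Hpr.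
have H1 : pderiv false E G (Node r B (maj :: map fst ys)) B.
  by apply: Hnode => i y pr /Hyy[d [pr' [_ ->]]] [] _ Hy1 _ _ _ [<-].
exists (Node r B (maj :: map snd ys)); split.
- by apply: Hnode => i y pr /Hyy[d [pr' [_ ->]]] [] _ _ Hy2 _ _ [<-].
(* One permutation leads to the first components; the minor premises are then reduced one after the
   other to the second ones. *)
- apply: (@rt_trans _ _ _ (Node r B (maj :: map fst ys))).
    apply: rt_step; split; try exact/deriv_pderiv.
    right; apply: step_here (c_perm _ _ _ _ _ Htr Hel) _.
    constructor; constructor; first exact: resolve_refl.
    apply/Forall2_onth; split; first by rewrite size_mapi size_map Hys.
    move=> i p p'; rewrite onth_mapi onth_map add1n.
    case Hd: (onth ms i) => [d|] //= [<-]; case Hyi: (onth ys i) => [y|] //= [<-].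
    by have [pr _ []] := Hy _ _ _ Hd Hyi.
  apply: (reduces_premises (ps1 := [:: maj]) (prs1 := [:: pr0]) HB HrB).
  + by constructor=> //; exact: (Hps 0).
  + by rewrite !size_map.
  + by rewrite !size_map.
  move=> i p p' pr; rewrite !onth_map; case Hyi: (onth ys i) => [y|] //= [<-] [<-].
  have [d [pr' [_ -> [_ Hy1 Hy2 Hy3 _]]]] := Hyy _ _ Hyi.
  by case=> <-.
(* The rule [r] keeps its major premise [maj], so a cut there is the same as before. *)
- move: Hb; rewrite !bounded_node => /and3P[-> Hbmaj _] /=; rewrite Hbmaj /=.
  apply/onth_all => i p; rewrite onth_map; case Hyi: (onth ys i) => [y|] //= [<-].
  by have [d [pr' [_ _ [_ _ _ _ []]]]] := Hyy _ _ Hyi.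
- rewrite top_node Hi Htr /= => /onth_has[i [p []]]; rewrite onth_map.
  case Hyi: (onth ys i) => [y|] //= [<-].
  by have [d [pr' [_ _ [_ _ _ _ []]]]] := Hyy _ _ Hyi.
Qed.

Lemma reduce_max m E G D A : pderiv false E G D A -> all (fun x => (x <= m)%O) (cuts D) ->
  exists D', [/\ pderiv false E G D' A, reduces S eqn E G A D D',
    bounded m D' & top D' -> top D \/ (mu A < m)%O].
Proof.
elim=> {E G D A} // E G r A ps prs HA Hr Hs Hps IH Hc.
have Hcp : forall i p, onth ps i = Some p -> all (fun x => (x <= m)%O) (cuts p).
  move: Hc; rewrite /= all_cat => /andP[_].
  elim: (ps) => [|p l IHl] /= H i q; first by rewrite onth0n.
  move: H; rewrite all_cat => /andP[Hp Hl]; case: i => [|i]; [by case=> <- | exact: IHl].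
have [|ps' Hs' Hps'] := @list_choice _ _ (fun i p p' => forall pr, onth prs i = Some pr ->
   [/\ premd E G p' pr, premr E G p p' pr, bounded m p' & top p' -> top p \/ (mu (pconcl pr) < m)%O]) ps.
  move=> i p Hp; have [pr Hpr] := onth_Some (esym Hs) Hp.
  have [p' Hp'] := IH _ _ _ Hp Hpr (Hcp _ _ Hp); exists p' => pr'.
  by rewrite Hpr => -[<-].
have {}Hps' i p' : onth ps' i = Some p' -> exists p pr, [/\ onth ps i = Some p, onth prs i = Some pr &
   [/\ premd E G p' pr, premr E G p p' pr, bounded m p' & top p' -> top p \/ (mu (pconcl pr) < m)%O]].
  move=> Hp'; have [p Hp] := onth_Some (esym Hs') Hp'; have [pr Hpr] := onth_Some (esym Hs) Hp.
  by exists p, pr; split=> //; exact: Hps' Hp Hp' _ Hpr.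
have Hd1 : pderiv false E G (Node r A ps') A.
  apply: (PNode HA Hr); first by rewrite Hs'.
  by move=> i p' pr /Hps'[p [pr' [_ -> []]]] + _ _ _ [<-].
have Hr1 : reduces S eqn E G A (Node r A ps) (Node r A ps').
  apply: (reduces_premises (ps1 := [::]) (prs1 := [::]) HA Hr) => //; first by rewrite Hs'.
  move=> i p p' pr Hp Hp' Hpr; have [q [pr' []]] := Hps' _ _ Hp'.
  by rewrite Hp Hpr => -[<-] [<-] []; split=> //; exact: Hps Hp Hpr.
have Hb1 : all (bounded m) ps' by apply/onth_all => i p' /Hps'[p [pr [_ _ []]]].
have Ht1 : transmits r -> has (fun p => top p) (behead ps') ->
    has (fun p => top p) (behead ps) \/ (mu A < m)%O.
  move=> Htr /onth_has[i [p']]; rewrite onth_behead => -[Hp' Htp'].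
  have [p [pr [Hp Hpr [_ _ _ Ht]]]] := Hps' _ _ Hp'.
  case: (Ht Htp') => [Htp|]; last by rewrite (transmits_concl Hr Htr Hpr) mu_gwks; right.
  by left; apply/onth_has; exists i, p; rewrite onth_behead.
(* The root needs no treatment unless a segment of measure at least [m] ends at its major
   premise. *)
have Hdone : (if ps' is p :: _ then eliminates r && top p ==> (mu (concl p) < m)%O else true) ->
    exists D', [/\ pderiv false E G D' A, reduces S eqn E G A (Node r A ps) D',
    bounded m D' & top D' -> top (Node r A ps) \/ (mu A < m)%O].
  move=> Hroot; exists (Node r A ps'); split=> //; first by rewrite bounded_node Hroot Hb1.
  rewrite !top_node; case: (is_intro r) => /=; first by left.
  by case/andP => Htr /(Ht1 Htr)[->|]; [rewrite Htr; left | right].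
case Eps' : ps' Hdone => [|p' ns'] Hdone; first exact: Hdone.
case Hel : (eliminates r) Hdone => Hdone; last exact: Hdone.
case Htp' : (top p') Hdone => Hdone; last exact: Hdone.
have [p [pr [Hp Hpr [Hdp' _ Hbp' Ht]]]] := Hps' 0 p' (congr1 (fun l => onth l 0) Eps').
have Hcc : concl p = concl p'.
  by rewrite (pderiv_concl Hdp') (pderiv_concl (Hps _ _ _ Hp Hpr)).
(* A segment that is new at the major premise has measure [< m]. Otherwise the root was a cut of the
   given derivation, so its measure is at most [m] and [reduce_root] applies. *)
case: (Ht Htp') => [Htp|Hlt]; last by apply: Hdone; rewrite (pderiv_concl Hdp') Hlt.
have Hle : (mu (concl p') <= m)%O.
  move: Hc; case: (ps) Hp => //= q l [->]; rewrite Hel Htp /= mu_summ Hcc.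
  by case/andP.
rewrite Eps' in Hd1 Hr1 Hb1 Ht1.
have /andP[_ Hbns] : bounded m p' && all (bounded m) ns' by [].
have [D' [HD' HR' Hb' Ht']] := reduce_root Hd1 Hel Hle Hbp' Hbns.
exists D'; split=> //; first exact: rt_trans Hr1 HR'.
case/Ht' => [/andP[Htr Hns']|]; last by right.
by rewrite top_node Htr; case: (Ht1 Htr Hns') => [->|]; [left; rewrite orbT | right].
Qed.

Lemma weak_normalisation E G D A : pderiv false E G D A ->
  exists D', [/\ pderiv false E G D' A, cuts D' = [::] & reduces S eqn E G A D D'].
Proof.
have H m : forall D, pderiv false E G D A -> all (fun x => (x <= m)%O) (cuts D) ->
    exists D', [/\ pderiv false E G D' A, cuts D' = [::] & reduces S eqn E G A D D'].
  elim/lexi_ind: m => m IH D0 HD0 /(reduce_max HD0)[D1 [HD1 HR1 Hb1 _]].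
  have [Hc|[x Hx Hle]] := max_seq (cuts D1); first by exists D1.
  have [D' [HD' Hc' HR']] := IH x (allP Hb1 x Hx) _ HD1 Hle.
  by exists D'; split=> //; exact: rt_trans HR1 HR'.
move=> HD; have [Hc|[x _ Hle]] := max_seq (cuts D); last exact: H HD Hle.
by exists D; split=> //; exact: rt_refl.
Qed.

End Normalisation.

Theorem corollary18 (L : fol) (S : atsys L) (Lam : glang L)
    (Sigma : gsystem S Lam) (E : env L) (G : seq (gform Lam)) (D : der Lam)
    (A : gform Lam) :
  deriv S (geqn Sigma) E G D A ->
  exists D' : der Lam,
    [/\ deriv S (geqn Sigma) E G D' A, normal D' &
        reduces S (geqn Sigma) E G A D D'].
Proof.
move=> /deriv_pderiv /weak_normalisation[D' [/deriv_pderiv HD' Hc HR]].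
by exists D'; split=> //; exact: cutfree_normal.
Qed.
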